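(* Let $p=k/l$, where $k,l$ are integers with $1\le l<k$, let $r\in\mathbb{R}$, $c(p)=p^p(p-1)^{1-p}$ and $x\in(0,c(p))$. Then \[ V_{p,r}(x)=\gamma(k,l,r)\sum_{h=1}^{k}c(h,k,l,r)\;{}_{k}F_{k-1}\!\left(\left.\begin{array}{c}\mathbf{a}(h,k,l,r)\\ \mathbf{b}(h,k)\end{array}\right|z\right)z^{(r+h)/k-1/l}, \] where $z=x^l/c(p)^l$, \[ \gamma(k,l,r)=\frac{l(p-1)^{p-r-1}}{p^{p-r-1/2}\sqrt{2\pi(k-l)}}, \] \[ c(h,k,l,r)=\frac{\prod_{j=1}^{h-1}\Gamma\left(\frac{j-h}{k}\right)\prod_{j=h+1}^{k}\Gamma\left(\frac{j-h}{k}\right)}{\prod_{j=1}^{l}\Gamma\left(\frac{j}{l}-\frac{r+h}{k}\right)\prod_{j=l+1}^{k}\Gamma\left(\frac{r+j-l}{k-l}-\frac{r+h}{k}\right)}, \] and the parameter vectors of the hypergeometric functions are \[ \mathbf{a}(h,k,l,r)=\left(\left\{\frac{r+h}{k}-\frac{j-l}{l}\right\}_{j=1}^{l},\left\{\frac{r+h}{k}-\frac{r+j-k}{k-l}\right\}_{j=l+1}^{k}\right), \] \[ \mathbf{b}(h,k)=\left(\left\{\frac{k+h-j}{k}\right\}_{j=1}^{h-1},\left\{\frac{k+h-j}{k}\right\}_{j=h+1}^{k}\right). \]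
   Context: ${}_kF_{k-1}$ is the generalized hypergeometric function, with upper parameters $\mathbf a$ and lower parameters $\mathbf b$. The reciprocal gamma function $1/\Gamma$ is taken to be $0$ at the poles of $\Gamma$. For $p>1$ and $r\in\mathbb{R}$, \[ \psi_{p,r}(\sigma)=\frac{\Gamma\big((\sigma-1)p+r+1\big)}{\Gamma(\sigma)\,\Gamma\big((\sigma-1)(p-1)+r+1\big)}, \] where at removable singularities the value is the limit. $V_{p,r}$ is the inverse Mellin transform of $\psi_{p,r}$: \[ V_{p,r}(x)=\frac{1}{2\pi\mathrm{i}}\int_{d-\mathrm{i}\infty}^{d+\mathrm{i}\infty}x^{-\sigma}\psi_{p,r}(\sigma)\,d\sigma,\qquad x\in(0,c(p)), \] where $d$ is any real number with $d>1-\frac{1+r}{p}$ and the integral is understood as $\lim_{T\to\infty}\int_{d-\mathrm{i}T}^{d+\mathrm{i}T}$ (it exists for rational $p>1$). *)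

(* Defs.v *)
From Stdlib Require Import Reals List Arith.
From Coquelicot Require Import Coquelicot.
Import ListNotations.

Local Open Scope R_scope.
Local Open Scope C_scope.

Definition Cexp (s : C) : C :=
  ((exp (Re s) * cos (Im s))%R, (exp (Re s) * sin (Im s))%R).

(* The power x^s for a real base x > 0. *)
Definition RCpow (x : R) (s : C) : C := Cexp (s * RtoC (ln x)).

(* The product of f j for a <= j <= b; it is 1 when b < a. *)
Definition Cprod (f : nat -> C) (a b : nat) : C :=
  fold_right Cmult (RtoC 1) (map f (seq a (S b - a))).

(* Reciprocal Gamma function, by Euler's limit formula
   Gamma(s) = lim_n n! n^s / (s (s+1) ... (s+n)).
   The reciprocal sequence converges for every complex s, and its limit is 0
   exactly at the poles 0, -1, -2, ... of Gamma. *)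
Definition rGamma_seq (s : C) (n : nat) : C :=
  Cprod (fun j => s + RtoC (INR j)) 0 n
  / (RtoC (INR (fact n)) * RCpow (INR n) s).

Definition rGamma (s : C) : C :=
  (real (Lim_seq (fun n => Re (rGamma_seq s n))),
   real (Lim_seq (fun n => Im (rGamma_seq s n)))).

(* Meaningful only away from the poles. *)
Definition Gamma (s : C) : C := / rGamma s.

(* Generalized hypergeometric series with parameter lists a (upper) and
   b (lower); real parameters and argument. *)
Fixpoint pochhammer (a : R) (n : nat) : R :=
  match n with
  | O => 1%R
  | S m => (pochhammer a m * (a + INR m))%R
  end.

Definition prod_poch (a : list R) (n : nat) : R :=
  fold_right Rmult 1%R (map (fun t => pochhammer t n) a).

Definition hypergeom (a b : list R) (z : R) : R :=
  Series (fun n => prod_poch a n / prod_poch b n * (z ^ n / INR (fact n)))%R.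

Definition psi_num (p r : R) (s : C) : C :=
  (s - RtoC 1) * RtoC p + RtoC r + RtoC 1.

Definition psi_den (p r : R) (s : C) : C :=
  (s - RtoC 1) * RtoC (p - 1) + RtoC r + RtoC 1.

Definition psi_ratio (p r : R) (s : C) : C :=
  Gamma (psi_num p r s) * rGamma s * rGamma (psi_den p r s).

(* At the poles of the numerator the value is the limit, which exists when the
   singularity is removable (the value is meaningless at the other poles). *)
Definition psi (p r : R) (s : C) : C :=
  match Ceq_dec (rGamma (psi_num p r s)) (RtoC 0) with
  | left _ => C_lim (psi_ratio p r) s
  | right _ => psi_ratio p r s
  end.

(* v is the limit, as T -> +oo, of the integral of f along the segment from
   d - iT to d + iT. *)
Definition is_vertical_integral (f : C -> C) (d : R) (v : C) : Prop :=
  exists J : R -> C,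
    (forall T : R, (0 < T)%R ->
       is_RInt (V := C_R_NormedModule) (fun t : R => f (d, t) * Ci)
         (- T)%R T (J T))
    /\ filterlim J (Rbar_locally p_infty) (locally v).

Definition is_inverse_Mellin (phi : C -> C) (d x : R) (v : C) : Prop :=
  exists J : C,
    is_vertical_integral (fun s => RCpow x (- s) * phi s) d J
    /\ v = / (RtoC 2 * RtoC PI * Ci) * J.

(* V_{p,r}(x) exists and equals v, whichever admissible abscissa d is used. *)
Definition is_V (p r x : R) (v : C) : Prop :=
  forall d : R, (1 - (1 + r) / p < d)%R -> is_inverse_Mellin (psi p r) d x v.

Definition c_const (p : R) : R := (Rpower p p * Rpower (p - 1) (1 - p))%R.

Definition gamma_coef (k l : nat) (r : R) : R :=
  let p := (INR k / INR l)%R in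
  (INR l * Rpower (p - 1) (p - r - 1)
   / (Rpower p (p - r - 1 / 2) * sqrt (2 * PI * (INR k - INR l))))%R.

(* The Gamma factors of the denominator are written with rGamma, so that a pole
   of one of them makes the coefficient 0. *)
Definition c_coef (h k l : nat) (r : R) : C :=
  Cprod (fun j => Gamma (RtoC ((INR j - INR h) / INR k))) 1 (h - 1)
  * Cprod (fun j => Gamma (RtoC ((INR j - INR h) / INR k))) (h + 1) k
  * Cprod (fun j => rGamma (RtoC (INR j / INR l - (r + INR h) / INR k))) 1 l
  * Cprod (fun j => rGamma (RtoC ((r + INR j - INR l) / (INR k - INR l)
                                  - (r + INR h) / INR k))) (l + 1) k.

Definition a_params (h k l : nat) (r : R) : list R :=
  map (fun j => ((r + INR h) / INR k - (INR j - INR l) / INR l)%R) (seq 1 l)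
  ++ map (fun j => ((r + INR h) / INR k
                    - (r + INR j - INR k) / (INR k - INR l))%R)
       (seq (l + 1) (k - l)).

Definition b_params (h k : nat) : list R :=
  map (fun j => ((INR k + INR h - INR j) / INR k)%R)
    (seq 1 (h - 1) ++ seq (h + 1) (k - h)).

(* Main.v *)
(** The transform psi has, up to the factor c(p)^s, size |s|^(-1/2) on vertical lines,
    and the numerator Gamma factor has simple poles; closing the contour to the left
    expresses V as the sum of the residues, and splitting that sum according to the
    residue class of the pole index modulo k gives the k hypergeometric series.

    To avoid analytic continuation of Gamma, the residue calculus is done on Euler's
    finite products.  If rGamma(u) is replaced by its m-th Euler product, with m = l n,
    (k - l) n and k n for the three Gamma factors, then x^(-s) psi(s) becomes
      const * kappa_n * exp (mu s) * prod_(i < k n) (s + b_i) / (s + a_i),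
    where mu = ln (c(p) / x) > 0: an exponential times a rational function with simple
    poles, for which the residue theorem follows from partial fractions.  As the sum of
    b_i - a_i over k consecutive indices is l/2, the inequality
    |1 + w| <= exp (Re w + |w|^2 / 2) bounds the products, on horizontal lines at height
    T and at the poles, by O((1/n + 1/T)^(1/2)) and O(1) after multiplication by
    kappa_n ~ C n^(-1/2); the constant C comes from Stirling's formula.  Hence the
    horizontal sides contribute O(T^(-1/2)) in the limit n -> oo, and dominated
    convergence yields the limit of the sum of residues. *)

Require Import Defs.
From Stdlib Require Import Reals Lra Lia List Arith.
From Coquelicot Require Import Coquelicot.

Local Open Scope R_scope.


(** The numbers of factors are dictated by [psi_num p r s + 1 = s + psi_den p r s]: with k n, l n
    and (k - l) n of them the powers n^s cancel, and after division by p and p - 1 the linear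
    factors fall into n blocks of k, each the translate of the previous one by l. Numerator and
    denominator then have the same degree k n, so for fixed n the quotient stays bounded far to the
    left and exp (mu s) kills the left side of the contour. The limits are therefore taken in a
    fixed order: left abscissa to - oo with n and T fixed, then n -> oo with T fixed, then T -> oo.
    The price is uniformity: the truncation n competes with the height T on horizontal lines and
    with the index of the pole in the residues. Both cases reduce to one telescoping bound for a sum
    of Re (1 / (w + m)) that holds for every real shift. After partial fractions only exp (la s) and
    exp (la (s + a)) / (s + a) are integrated round a rectangle. *)

(** * Modulus, exponential and complex powers *)

Lemma C_ext (x y : C) : Re x = Re y -> Im x = Im y -> x = y.
Proof. destruct x, y; simpl; intros; subst; reflexivity. Qed.

Lemma Cmod_le_abs (w : C) : Cmod w <= Rabs (Re w) + Rabs (Im w).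
Proof.
  replace w with (RtoC (Re w) + Ci * RtoC (Im w))%C at 1
    by (apply C_ext; simpl; ring).
  eapply Rle_trans; [apply Cmod_triangle|].
  rewrite Cmod_mult, !Cmod_R, Cmod_Ci; lra.
Qed.

Lemma im_le_Cmod (w : C) : Rabs (Im w) <= Cmod w.
Proof. eapply Rle_trans; [|apply Rmax_Cmod]; apply Rmax_r. Qed.

Lemma Cmod_sub_le (a b : C) : Cmod (a - b) <= Cmod a + Cmod b.
Proof.
  eapply Rle_trans; [apply Cmod_triangle|]; rewrite Cmod_opp; lra.
Qed.

Lemma Cmod_sub_sym (a b : C) : Cmod (a - b) = Cmod (b - a).
Proof. rewrite <- (Cmod_opp (a - b)); f_equal; ring. Qed.

Lemma Cmod_sqr (w : C) : Cmod w ^ 2 = Re w ^ 2 + Im w ^ 2.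
Proof. apply Cmod2_alt. Qed.

Lemma RtoC_neq (x : R) : x <> 0 -> RtoC x <> 0%C.
Proof. intros H E; apply H, RtoC_inj, E. Qed.

Lemma Re_neq_0 (w : C) : Re w <> 0 -> w <> 0%C.
Proof. intros H E; apply H; rewrite E; reflexivity. Qed.

Lemma Cexp_plus (a b : C) : Cexp (a + b) = (Cexp a * Cexp b)%C.
Proof.
  apply C_ext; simpl;
    rewrite exp_plus, ?cos_plus, ?sin_plus; unfold Re, Im; ring.
Qed.

Lemma Cexp_RtoC (x : R) : Cexp (RtoC x) = RtoC (exp x).
Proof. apply C_ext; simpl; rewrite ?cos_0, ?sin_0; ring. Qed.

Lemma Cexp_0 : Cexp 0 = 1%C.
Proof. rewrite Cexp_RtoC, exp_0; reflexivity. Qed.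

Lemma Cmod_Cexp (w : C) : Cmod (Cexp w) = exp (Re w).
Proof.
  unfold Cmod, Cexp; simpl.
  replace (_ + _) with (Rsqr (exp (Re w)) * (Rsqr (sin (Im w)) + Rsqr (cos (Im w))))
    by (unfold Rsqr; ring).
  rewrite sin2_cos2, Rmult_1_r, sqrt_Rsqr; [reflexivity|].
  left; apply exp_pos.
Qed.

Lemma Cexp_nz (w : C) : Cexp w <> 0%C.
Proof.
  apply Cmod_gt_0; rewrite Cmod_Cexp; apply exp_pos.
Qed.

Lemma Cexp_opp (w : C) : Cexp (- w) = (/ Cexp w)%C.
Proof.
  assert (H : (Cexp (- w) * Cexp w = 1)%C).
  { rewrite <- Cexp_plus, <- Cexp_0; f_equal; ring. }
  rewrite <- (Cmult_1_l (/ Cexp w)), <- H; field; apply Cexp_nz.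
Qed.

Lemma exp_le (a b : R) : a <= b -> exp a <= exp b.
Proof.
  intros [H|H]; [left; apply exp_increasing, H|right; f_equal; exact H].
Qed.

Lemma exp_sub_1_le (a : R) : Rabs (exp a - 1) <= Rabs a * exp (Rabs a).
Proof.
  rewrite Rmult_comm, <- exp_0.
  replace a with (a - 0) at 2 3 by ring.
  apply (bounded_variation exp exp).
  intros t Ht; split; [auto_derive; [trivial|ring]|].
  rewrite Rabs_pos_eq by (left; apply exp_pos).
  apply exp_le; rewrite !Rminus_0_r in *.
  eapply Rle_trans; [apply Rle_abs|lra].
Qed.

Lemma exp_sub_1_sub_le (a : R) :
  Rabs (exp a - 1 - a) <= Rabs a ^ 2 * exp (Rabs a).
Proof.
  replace (exp a - 1 - a) with ((exp a - a) - (exp 0 - 0)) by (rewrite exp_0; ring).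
  replace (Rabs a ^ 2 * exp (Rabs a))
    with (Rabs a * exp (Rabs a) * Rabs (a - 0)) by (rewrite Rminus_0_r; ring).
  apply (bounded_variation (fun t => exp t - t) (fun t => exp t - 1)).
  intros t Ht; split; [auto_derive; [trivial|ring]|].
  rewrite !Rminus_0_r in Ht.
  eapply Rle_trans; [apply exp_sub_1_le|].
  apply Rmult_le_compat; try apply Rabs_pos; try assumption.
  - left; apply exp_pos.
  - apply exp_le; assumption.
Qed.

Lemma sin_abs_le (b : R) : Rabs (sin b) <= Rabs b.
Proof.
  replace (sin b) with (sin b - sin 0) by (rewrite sin_0; ring).
  replace (Rabs b) with (1 * Rabs (b - 0)) by (rewrite Rminus_0_r; ring).
  apply (bounded_variation sin cos).
  intros t _; split; [auto_derive; [trivial|ring]|].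
  apply Rabs_le, COS_bound.
Qed.

Lemma cos_sub_1_le (b : R) : Rabs (cos b - 1) <= Rabs b ^ 2.
Proof.
  rewrite <- cos_0.
  replace (Rabs b ^ 2) with (Rabs b * Rabs (b - 0)) by (rewrite Rminus_0_r; ring).
  apply (bounded_variation cos (fun t => - sin t)).
  intros t Ht; split; [auto_derive; [trivial|ring]|].
  rewrite !Rminus_0_r in Ht.
  rewrite Rabs_Ropp; eapply Rle_trans; [apply sin_abs_le|assumption].
Qed.

Lemma cos_sub_1_le_2 (b : R) : Rabs (cos b - 1) <= Rabs b.
Proof.
  rewrite <- cos_0.
  replace (Rabs b) with (1 * Rabs (b - 0)) by (rewrite Rminus_0_r; ring).
  apply (bounded_variation cos (fun t => - sin t)).
  intros t Ht; split; [auto_derive; [trivial|ring]|].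
  rewrite Rabs_Ropp; apply Rabs_le, SIN_bound.
Qed.

Lemma sin_sub_le (b : R) : Rabs (sin b - b) <= Rabs b ^ 2.
Proof.
  replace (sin b - b) with ((sin b - b) - (sin 0 - 0)) by (rewrite sin_0; ring).
  replace (Rabs b ^ 2) with (Rabs b * Rabs (b - 0)) by (rewrite Rminus_0_r; ring).
  apply (bounded_variation (fun t => sin t - t) (fun t => cos t - 1)).
  intros t Ht; split; [auto_derive; [trivial|ring]|].
  rewrite !Rminus_0_r in Ht.
  eapply Rle_trans; [apply cos_sub_1_le_2|assumption].
Qed.

Lemma Cexp_taylor (w : C) :
  Cmod (Cexp w - 1 - w) <= 4 * Cmod w ^ 2 * exp (Cmod w).
Proof.
  pose proof (re_le_Cmod w) as Ha; pose proof (im_le_Cmod w) as Hb.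
  eapply Rle_trans; [apply Cmod_le_abs|].
  destruct w as [a b]; simpl Re in *; simpl Im in *.
  set (M := Cmod (a, b)) in *.
  (* Real and imaginary parts are split into two summands each; every one of the four is at most M^2
     exp M, whence the constant 4. *)
  replace (exp a * cos b + - (1) + - a)
    with ((exp a - 1 - a) + exp a * (cos b - 1)) by ring.
  replace (exp a * sin b + - 0 + - b)
    with (exp a * (sin b - b) + b * (exp a - 1)) by ring.
  pose proof (Rabs_pos a); pose proof (Rabs_pos b).
  assert (HE : exp (Rabs a) <= exp M) by (apply exp_le; assumption).
  assert (He : exp a <= exp M)
    by (apply exp_le; eapply Rle_trans; [apply Rle_abs|assumption]).
  pose proof (exp_pos a); pose proof (exp_pos (Rabs a)).
  assert (Hsq : forall t, 0 <= t <= M -> t ^ 2 <= M ^ 2)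
    by (intros; apply pow_incr; assumption).
  assert (T1 : Rabs (exp a - 1 - a) <= M ^ 2 * exp M).
  { eapply Rle_trans; [apply exp_sub_1_sub_le|].
    apply Rmult_le_compat; auto using pow2_ge_0 with real. }
  assert (T2 : Rabs (exp a * (cos b - 1)) <= exp M * M ^ 2).
  { rewrite Rabs_mult, (Rabs_pos_eq (exp a)) by lra.
    apply Rmult_le_compat; try lra; [apply Rabs_pos|].
    eapply Rle_trans; [apply cos_sub_1_le|auto]. }
  assert (T3 : Rabs (exp a * (sin b - b)) <= exp M * M ^ 2).
  { rewrite Rabs_mult, (Rabs_pos_eq (exp a)) by lra.
    apply Rmult_le_compat; try lra; [apply Rabs_pos|].
    eapply Rle_trans; [apply sin_sub_le|auto]. }
  assert (T4 : Rabs (b * (exp a - 1)) <= M * (M * exp M)).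
  { rewrite Rabs_mult.
    apply Rmult_le_compat; try lra; [apply Rabs_pos|].
    eapply Rle_trans; [apply exp_sub_1_le|].
    apply Rmult_le_compat; lra. }
  pose proof (Rabs_triang (exp a - 1 - a) (exp a * (cos b - 1))).
  pose proof (Rabs_triang (exp a * (sin b - b)) (b * (exp a - 1))).
  lra.
Qed.

Lemma RCpow_plus (x : R) (a b : C) : RCpow x (a + b) = (RCpow x a * RCpow x b)%C.
Proof. unfold RCpow; rewrite <- Cexp_plus; f_equal; ring. Qed.

Lemma RCpow_nz (x : R) (s : C) : RCpow x s <> 0%C.
Proof. apply Cexp_nz. Qed.

Lemma RCpow_opp (x : R) (s : C) : RCpow x (- s) = (/ RCpow x s)%C.
Proof. unfold RCpow; rewrite <- Cexp_opp; f_equal; ring. Qed.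

Lemma RCpow_RtoC (x a : R) : RCpow x (RtoC a) = RtoC (Rpower x a).
Proof. unfold RCpow, Rpower; rewrite <- RtoC_mult; apply Cexp_RtoC. Qed.

Lemma RCpow_mult_base (x y : R) (s : C) :
  0 < x -> 0 < y -> RCpow (x * y) s = (RCpow x s * RCpow y s)%C.
Proof.
  intros Hx Hy; unfold RCpow.
  rewrite <- Cexp_plus, ln_mult, RtoC_plus by assumption; f_equal; ring.
Qed.

Lemma Cmod_RCpow (x : R) (s : C) : Cmod (RCpow x s) = exp (Re s * ln x).
Proof. unfold RCpow; rewrite Cmod_Cexp; f_equal;
  unfold Re; simpl; ring. Qed.

(** * Finite complex products *)

(** The last factor is split off by the recursion, which suits inductions on the number of factors;
    [Cprod_cprod] translates the list products of the statement. *)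
Fixpoint cprod (f : nat -> C) (n : nat) : C :=
  match n with
  | O => RtoC 1
  | S m => (cprod f m * f m)%C
  end.

Lemma cprod_ext (f g : nat -> C) (n : nat) :
  (forall i, (i < n)%nat -> f i = g i) -> cprod f n = cprod g n.
Proof.
  induction n as [|n IH]; simpl; intros H; [reflexivity|].
  rewrite IH, H by (intros; try apply H; lia); reflexivity.
Qed.

Lemma cprod_mult (f g : nat -> C) (n : nat) :
  cprod (fun i => (f i * g i)%C) n = (cprod f n * cprod g n)%C.
Proof. induction n as [|n IH]; simpl; [ring|rewrite IH; ring]. Qed.

Lemma cprod_const (c : C) (n : nat) : cprod (fun _ => c) n = (c ^ n)%C.
Proof. induction n as [|n IH]; simpl; [reflexivity|rewrite IH; ring]. Qed.

Lemma cprod_nz (f : nat -> C) (n : nat) :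
  (forall i, (i < n)%nat -> f i <> 0%C) -> cprod f n <> 0%C.
Proof.
  induction n as [|n IH]; simpl; intros H; [apply C1_nz|].
  apply Cmult_neq_0; [apply IH; intros; apply H; lia|apply H; lia].
Qed.

Lemma cprod_inv (f : nat -> C) (n : nat) :
  (forall i, (i < n)%nat -> f i <> 0%C) ->
  cprod (fun i => (/ f i)%C) n = (/ cprod f n)%C.
Proof.
  induction n as [|n IH]; simpl; intros H; [field; apply C1_nz|].
  rewrite IH by (intros; apply H; lia); field.
  split; [apply H; lia|apply cprod_nz; intros; apply H; lia].
Qed.

Lemma cprod_div (f g : nat -> C) (n : nat) :
  (forall i, (i < n)%nat -> g i <> 0%C) ->
  cprod (fun i => (f i / g i)%C) n = (cprod f n / cprod g n)%C.
Proof.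
  intros H; unfold Cdiv; rewrite cprod_mult, cprod_inv by assumption; reflexivity.
Qed.

Lemma cprod_shift (f : nat -> C) (n : nat) :
  cprod f (S n) = (f O * cprod (fun i => f (S i)) n)%C.
Proof.
  induction n as [|n IH]; [simpl; ring|].
  change (cprod f (S (S n))) with (cprod f (S n) * f (S n))%C.
  rewrite IH; simpl; ring.
Qed.

Lemma cprod_add (f : nat -> C) (n m : nat) :
  cprod f (n + m) = (cprod f n * cprod (fun i => f (n + i)%nat) m)%C.
Proof.
  induction m as [|m IH]; simpl; [rewrite Nat.add_0_r; ring|].
  rewrite Nat.add_succ_r; simpl; rewrite IH; ring.
Qed.

(** In the index k m + j, m will number the blocks and j the residue class of a pole. *)
Lemma cprod_split (f : nat -> C) (k n : nat) :
  cprod f (k * n) = cprod (fun m => cprod (fun j => f (k * m + j)%nat) k) n.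
Proof.
  induction n as [|n IH]; simpl; [rewrite Nat.mul_0_r; reflexivity|].
  rewrite Nat.mul_succ_r, cprod_add, IH; reflexivity.
Qed.

Lemma cprod_exchange (f : nat -> nat -> C) (k n : nat) :
  cprod (fun m => cprod (f m) k) n = cprod (fun j => cprod (fun m => f m j) n) k.
Proof.
  induction n as [|n IH]; simpl.
  - rewrite cprod_const, Cpow_1_l; reflexivity.
  - rewrite IH, cprod_mult; reflexivity.
Qed.

Lemma Cprod_cprod (f : nat -> C) (a b : nat) :
  Cprod f a b = cprod (fun i => f (a + i)%nat) (S b - a).
Proof.
  unfold Cprod; generalize (S b - a)%nat; clear b; intros n.
  assert (F : forall s (c : C), fold_right Cmult c s = (fold_right Cmult 1 s * c)%C).
  { induction s as [|x s IH]; intros c; simpl; [ring|rewrite IH; ring]. }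
  induction n as [|n IH]; [reflexivity|].
  rewrite seq_S, map_app, fold_right_app, F, IH; simpl; ring.
Qed.

(** * Euler's product for the reciprocal Gamma function *)

(** Convergence through the modulus turns complex limits into real squeeze arguments;
    [Clim_components] links it to the componentwise limits in [rGamma]. *)
Definition Clim (u : nat -> C) (l : C) : Prop :=
  is_lim_seq (fun n => Cmod (u n - l)) 0.

Lemma Clim_le (u : nat -> C) (l : C) (e : nat -> R) :
  eventually (fun n => Cmod (u n - l) <= e n) -> is_lim_seq e 0 -> Clim u l.
Proof.
  intros H He.
  apply (is_lim_seq_le_le_loc (fun _ => 0) _ e); auto using is_lim_seq_const.
  destruct H as [N H]; exists N; intros n Hn; split; [apply Cmod_ge_0|auto].
Qed.

Lemma Clim_ext_loc (u v : nat -> C) (l : C) :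
  eventually (fun n => u n = v n) -> Clim u l -> Clim v l.
Proof.
  intros [N H]; apply is_lim_seq_ext_loc; exists N; intros n Hn; rewrite H; auto.
Qed.

Lemma Clim_const (c : C) : Clim (fun _ => c) c.
Proof.
  apply (is_lim_seq_ext (fun _ => 0)); [|apply is_lim_seq_const].
  intros _; replace (c - c)%C with (RtoC 0) by ring; symmetry; apply Cmod_0.
Qed.

Lemma Clim_bounded (u : nat -> C) (l : C) :
  Clim u l -> eventually (fun n => Cmod (u n) <= Cmod l + 1).
Proof.
  intros H; apply is_lim_seq_spec in H.
  destruct (H (mkposreal 1 Rlt_0_1)) as [N HN]; exists N; intros n Hn.
  specialize (HN n Hn); simpl in HN.
  rewrite Rminus_0_r, Rabs_pos_eq in HN by apply Cmod_ge_0.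
  generalize (Cmod_triangle (u n - l) l).
  replace (u n - l + l)%C with (u n) by ring; lra.
Qed.

Lemma Clim_plus (u v : nat -> C) (a b : C) :
  Clim u a -> Clim v b -> Clim (fun n => (u n + v n)%C) (a + b).
Proof.
  intros Hu Hv.
  apply (Clim_le _ _ (fun n => Cmod (u n - a) + Cmod (v n - b))).
  - exists O; intros n _.
    replace (u n + v n - (a + b))%C with ((u n - a) + (v n - b))%C by ring.
    apply Cmod_triangle.
  - replace (Finite 0) with (Rbar_plus 0 0) by (simpl; f_equal; ring).
    apply is_lim_seq_plus'; assumption.
Qed.

Lemma Clim_mult (u v : nat -> C) (a b : C) :
  Clim u a -> Clim v b -> Clim (fun n => (u n * v n)%C) (a * b).
Proof.
  intros Hu Hv.
  apply (Clim_le _ _ (fun n => Cmod (u n - a) * (Cmod b + 1) + Cmod a * Cmod (v n - b))).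
  - destruct (Clim_bounded v b Hv) as [N HN]; exists N; intros n Hn.
    replace (u n * v n - a * b)%C with ((u n - a) * v n + a * (v n - b))%C by ring.
    eapply Rle_trans; [apply Cmod_triangle|]; rewrite !Cmod_mult.
    apply Rplus_le_compat_r, Rmult_le_compat_l; [apply Cmod_ge_0|auto].
  - replace (Finite 0) with (Finite (0 * (Cmod b + 1) + Cmod a * 0)) by (f_equal; ring).
    apply is_lim_seq_plus'; apply is_lim_seq_mult';
      auto using is_lim_seq_const.
Qed.

Lemma Clim_inv (u : nat -> C) (a : C) :
  a <> 0%C -> Clim u a -> Clim (fun n => (/ u n)%C) (/ a).
Proof.
  intros Ha Hu.
  assert (P : 0 < Cmod a) by (apply Cmod_gt_0; assumption).
  apply (Clim_le _ _ (fun n => 2 / Cmod a ^ 2 * Cmod (u n - a))).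
  - apply is_lim_seq_spec in Hu.
    destruct (Hu (mkposreal _ (is_pos_div_2 (mkposreal _ P)))) as [N HN].
    exists N; intros n Hn; specialize (HN n Hn); simpl in HN.
    rewrite Rminus_0_r, Rabs_pos_eq in HN by apply Cmod_ge_0.
    assert (Q : Cmod a / 2 <= Cmod (u n)).
    { generalize (Cmod_sub_le (u n) (u n - a)).
      replace (u n - (u n - a))%C with a by ring; lra. }
    assert (Z : u n <> 0%C) by (apply Cmod_gt_0; lra).
    replace (/ u n - / a)%C with (- (u n - a) / (u n * a))%C by (field; auto).
    rewrite Cmod_div, Cmod_opp, Cmod_mult by (apply Cmult_neq_0; auto).
    unfold Rdiv; rewrite (Rmult_comm (Cmod (u n - a))).
    apply Rmult_le_compat_r; [apply Cmod_ge_0|].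
    replace (2 * / Cmod a ^ 2) with (/ (Cmod a / 2 * Cmod a)) by (field; lra).
    apply Rinv_le_contravar; [apply Rmult_lt_0_compat; lra|].
    apply Rmult_le_compat_r; lra.
  - replace (Finite 0) with (Finite (2 / Cmod a ^ 2 * 0)) by (f_equal; ring).
    apply is_lim_seq_mult'; auto using is_lim_seq_const.
Qed.

Lemma Clim_unique (u : nat -> C) (a b : C) : Clim u a -> Clim u b -> a = b.
Proof.
  intros Ha Hb; apply Ceq_minus, Cmod_eq_0.
  assert (H : is_lim_seq (fun _ => Cmod (a - b)) 0).
  { apply (is_lim_seq_le_le (fun _ => 0) _ (fun n => Cmod (u n - a) + Cmod (u n - b))).
    - intros n; split; [apply Cmod_ge_0|].
      rewrite (Cmod_sub_sym (u n) a).
      replace (a - b)%C with ((a - u n) + (u n - b))%C by ring; apply Cmod_triangle.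
    - apply is_lim_seq_const.
    - replace (Finite 0) with (Finite (0 + 0)) by (f_equal; ring).
      apply is_lim_seq_plus'; assumption. }
  apply is_lim_seq_unique in H; rewrite Lim_seq_const in H; congruence.
Qed.

Lemma Clim_components (u : nat -> C) (l : C) :
  Clim u l <->
  is_lim_seq (fun n => Re (u n)) (Re l) /\ is_lim_seq (fun n => Im (u n)) (Im l).
Proof.
  split.
  - intros H; split; apply is_lim_seq_spec; intros eps;
      apply is_lim_seq_spec in H; destruct (H eps) as [N HN]; exists N; intros n Hn;
      specialize (HN n Hn); rewrite Rminus_0_r, Rabs_pos_eq in HN by apply Cmod_ge_0;
      eapply Rle_lt_trans; [|exact HN| |exact HN].
    + apply (re_le_Cmod (u n - l)).
    + apply (im_le_Cmod (u n - l)).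
  - intros [HR HI].
    apply (Clim_le _ _ (fun n => Rabs (Re (u n) - Re l) + Rabs (Im (u n) - Im l))).
    + exists O; intros n _; apply (Cmod_le_abs (u n - l)).
    + replace (Finite 0) with (Finite (0 + 0)) by (f_equal; ring).
      assert (A : forall v (c : R), is_lim_seq v c -> is_lim_seq (fun n => Rabs (v n - c)) 0).
      { intros v c H; replace (Finite 0) with (Rbar_abs (c - c))
          by (simpl; f_equal; rewrite Rminus_diag; apply Rabs_R0).
        apply is_lim_seq_abs; apply is_lim_seq_minus'; auto using is_lim_seq_const. }
      apply is_lim_seq_plus'; auto.
Qed.

Lemma Clim_RtoC (u : nat -> R) (l : R) :
  is_lim_seq u l -> Clim (fun n => RtoC (u n)) l.
Proof.
  intros H; apply Clim_components; split; simpl; auto using is_lim_seq_const.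
Qed.

Lemma Clim_cprod (f : nat -> nat -> C) (l : nat -> C) (k : nat) :
  (forall j, (j < k)%nat -> Clim (fun n => f n j) (l j)) ->
  Clim (fun n => cprod (f n) k) (cprod l k).
Proof.
  induction k as [|k IH]; intros H; simpl; [apply Clim_const|].
  apply Clim_mult; [apply IH; intros; apply H|apply H]; lia.
Qed.

(** * Euler products: consecutive quotients, bounds and limit *)

Lemma ln_le_sub_1 (x : R) : 0 < x -> ln x <= x - 1.
Proof. intros H; generalize (exp_ineq1_le (ln x)); rewrite exp_ln by assumption; lra. Qed.

Lemma ln_1_plus_ge (v : R) : 0 <= v -> v - v ^ 2 <= ln (1 + v).
Proof.
  intros H; assert (0 < / (1 + v)) by (apply Rinv_0_lt_compat; lra).
  generalize (ln_le_sub_1 (/ (1 + v))); rewrite ln_Rinv by lra; intros L.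
  assert (E : v - v ^ 2 <= 1 - / (1 + v)).
  { apply Rmult_le_reg_r with (1 + v); [lra|].
    replace ((1 - / (1 + v)) * (1 + v)) with v by (field; lra).
    assert (0 <= v ^ 3) by (apply pow_le; lra); nra. }
  lra.
Qed.

Definition rising (s : C) (n : nat) : C := cprod (fun j => (s + INR j)%C) n.

(** The product of [rGamma_seq] indexed by its number m = n + 1 of factors, with m^s instead of n^s.
    Counting factors makes the products with l n, (k - l) n and k n factors fit together; the limit
    is unchanged because (1 + 1/n)^s tends to 1. *)
Definition euler (s : C) (m : nat) : C :=
  (rising s m / (INR (fact (pred m)) * RCpow (INR m) s))%C.

Lemma RtoC_fact_nz (n : nat) : RtoC (INR (fact n)) <> 0%C.
Proof. apply RtoC_neq, INR_fact_neq_0. Qed.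

(** The quotient is (1 + s/m) (1 + 1/m)^(-s) = 1 + O(1/m^2). The upper bound, the Cauchy property
    and the lower bound all rest on this step. *)
Lemma euler_step (s : C) (m : nat) : (0 < m)%nat ->
  euler s (S m) =
  (euler s m * ((1 + s * / INR m) * Cexp (- (s * ln (1 + / INR m)%R))))%C.
Proof.
  intros Hm; assert (P : 0 < INR m) by (apply lt_0_INR, Hm).
  unfold euler, rising; simpl cprod; simpl pred.
  destruct m as [|n]; [lia|]; simpl pred; set (m := S n) in *.
  replace (INR (S m)) with (INR m * (1 + / INR m)) by (rewrite S_INR; field; lra).
  rewrite RCpow_mult_base
    by (try assumption; generalize (Rinv_0_lt_compat _ P); lra).
  rewrite Cexp_opp; fold (RCpow (1 + / INR m) s).
  replace (fact m) with (m * fact n)%nat by reflexivity.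
  rewrite mult_INR, RtoC_mult.
  field; repeat split; try apply RCpow_nz; try apply RtoC_fact_nz.
  apply RtoC_neq; lra.
Qed.

(** One summand for each of the three error terms in [euler_factor_le]; the last is the Taylor
    remainder of [Cexp_taylor] times |1 + s v| <= 1 + r. *)
Definition euler_const (r : R) : R := r + r ^ 2 + 4 * r ^ 2 * exp r * (1 + r).

Lemma euler_const_pos (r : R) : 0 <= r -> 0 <= euler_const r.
Proof.
  intros H; unfold euler_const.
  assert (0 <= 4 * r ^ 2 * exp r * (1 + r)).
  { apply Rmult_le_pos; [|lra]; apply Rmult_le_pos; [nra|left; apply exp_pos]. }
  nra.
Qed.

Lemma euler_factor_le (r v : R) (s : C) : Cmod s <= r -> 0 < v <= 1 ->
  Cmod ((1 + s * v) * Cexp (- (s * ln (1 + v)%R)) - 1) <= euler_const r * v ^ 2.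
Proof.
  intros Hs [Hv Hv1]; set (t := ln (1 + v)).
  assert (T1 : t <= v) by (generalize (ln_le_sub_1 (1 + v)); unfold t; lra).
  assert (T2 : v - v ^ 2 <= t) by (apply ln_1_plus_ge; lra).
  assert (T0 : 0 <= t) by nra.
  pose proof (Cmod_ge_0 s) as S0.
  set (E := (Cexp (- (s * t)) - 1 - (- (s * t)))%C).
  assert (HE : Cmod E <= 4 * r ^ 2 * exp r * v ^ 2).
  { eapply Rle_trans; [apply Cexp_taylor|].
    rewrite Cmod_opp, Cmod_mult, Cmod_R, Rabs_pos_eq by assumption.
    replace (4 * r ^ 2 * exp r * v ^ 2) with (4 * (r * v) ^ 2 * exp r) by ring.
    assert (Q : Cmod s * t <= r * v) by (apply Rmult_le_compat; assumption).
    apply Rmult_le_compat.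
    - apply Rmult_le_pos; [lra|apply pow2_ge_0].
    - left; apply exp_pos.
    - apply Rmult_le_compat_l; [lra|].
      apply pow_incr; split; [apply Rmult_le_pos; assumption|exact Q].
    - apply exp_le; nra. }
  (* With exp (- s t) = 1 - s t + E the first-order terms combine to s (v - t), and v - t <= v^2. *)
  replace ((1 + s * v) * Cexp (- (s * t)) - 1)%C
    with (s * (v - t)%R + - (s * s * (v * t)%R) + E * (1 + s * v))%C
    by (unfold E; rewrite RtoC_minus, RtoC_mult; ring).
  eapply Rle_trans; [apply Cmod_triangle|].
  eapply Rle_trans; [apply Rplus_le_compat_r, Cmod_triangle|].
  rewrite Cmod_opp, !Cmod_mult, !Cmod_R.
  rewrite (Rabs_pos_eq (v - t)), (Rabs_pos_eq (v * t)) by nra.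
  assert (B1 : Cmod s * (v - t) <= r * v ^ 2) by (apply Rmult_le_compat; lra).
  assert (B2 : Cmod s * Cmod s * (v * t) <= r ^ 2 * v ^ 2).
  { apply Rmult_le_compat; try nra; apply Rmult_le_pos; assumption. }
  assert (B3 : Cmod E * Cmod (1 + s * v) <= 4 * r ^ 2 * exp r * v ^ 2 * (1 + r)).
  { apply Rmult_le_compat; try apply Cmod_ge_0; [exact HE|].
    eapply Rle_trans; [apply Cmod_triangle|].
    rewrite Cmod_1, Cmod_mult, Cmod_R, Rabs_pos_eq by lra; nra. }
  unfold euler_const; nra.
Qed.

(** Makes sums of 1/m^2 telescope: errors K/m^2 accumulated from m on amount to at most 2 K / m. *)
Lemma inv_sqr_telescope (m : nat) : (0 < m)%nat ->
  (/ INR m) ^ 2 <= 2 * (/ INR m - / INR (S m)).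
Proof.
  intros H; assert (1 <= INR m) by (apply (le_INR 1); lia).
  rewrite S_INR.
  replace (2 * (/ INR m - / (INR m + 1))) with (/ INR m * (2 * / (INR m + 1)))
    by (field; lra).
  simpl; rewrite Rmult_1_r; apply Rmult_le_compat_l;
    [left; apply Rinv_0_lt_compat; lra|].
  apply Rmult_le_reg_r with (INR m * (INR m + 1)); [nra|].
  replace (/ INR m * (INR m * (INR m + 1))) with (INR m + 1) by (field; lra).
  replace (2 * / (INR m + 1) * (INR m * (INR m + 1))) with (2 * INR m) by (field; lra).
  lra.
Qed.

Lemma inv_INR_range (m : nat) : (0 < m)%nat -> 0 < / INR m <= 1.
Proof.
  intros H; assert (1 <= INR m) by (apply (le_INR 1); lia); split.
  - apply Rinv_0_lt_compat; lra.
  - rewrite <- Rinv_1; apply Rinv_le_contravar; lra.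
Qed.

Lemma euler_1 (s : C) : euler s 1 = s.
Proof.
  unfold euler, rising; simpl.
  replace (RCpow 1 s) with (RtoC 1); [field; apply C1_nz|].
  unfold RCpow; rewrite ln_1, Cmult_0_r, Cexp_0; reflexivity.
Qed.

(** The bound r for the first product, which is s itself, times the whole telescoped product of
    quotients. *)
Definition euler_bound (r : R) : R := r * exp (2 * euler_const r).

Lemma euler_le (r : R) (s : C) (m : nat) : Cmod s <= r -> (0 < m)%nat ->
  Cmod (euler s m) <= euler_bound r.
Proof.
  intros Hs Hm.
  assert (Hr : 0 <= r) by (generalize (Cmod_ge_0 s); lra).
  pose proof (euler_const_pos r Hr) as HK; set (K := euler_const r) in *.
  (* The factor 1 - 1/m strengthens the claim so that the induction telescopes. *)
  assert (A : Cmod (euler s m) <= r * exp (2 * K * (1 - / INR m))).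
  { induction Hm as [|m Hm IH].
    - rewrite euler_1; simpl; rewrite Rinv_1, Rminus_diag, Rmult_0_r, exp_0; lra.
    - pose proof (inv_INR_range m Hm) as Hv.
      rewrite euler_step, Cmod_mult, <- RtoC_inv by (try assumption; apply not_0_INR; lia).
      pose proof (euler_factor_le r _ s Hs Hv) as F; fold K in F.
      set (q := ((1 + s * (/ INR m)%R) * Cexp (- (s * ln (1 + / INR m)%R)))%C) in *.
      assert (Q : Cmod q <= exp (2 * K * (/ INR m - / INR (S m)))).
      { eapply Rle_trans; [|apply exp_ineq1_le].
        generalize (Cmod_triangle (q - 1) 1); rewrite Cmod_1.
        replace (q - 1 + 1)%C with q by ring.
        pose proof (inv_sqr_telescope m Hm); nra. }
      replace (2 * K * (1 - / INR (S m)))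
        with (2 * K * (1 - / INR m) + 2 * K * (/ INR m - / INR (S m))) by ring.
      rewrite exp_plus, <- Rmult_assoc.
      apply Rmult_le_compat; auto using Cmod_ge_0. }
  eapply Rle_trans; [exact A|]; unfold euler_bound; fold K.
  apply Rmult_le_compat_l; [exact Hr|].
  apply exp_le; pose proof (inv_INR_range m Hm); nra.
Qed.

Definition euler_rate (r : R) : R := 2 * euler_const r * euler_bound r.

(** Each increment is at most [euler_bound r * euler_const r] / n^2, and these telescope. The rate
    depends on s through the radius only, which yields uniform convergence on segments of the
    vertical line. *)
Lemma euler_cauchy (r : R) (s : C) (m n : nat) :
  Cmod s <= r -> (0 < m)%nat -> (m <= n)%nat ->
  Cmod (euler s n - euler s m) <= euler_rate r * (/ INR m - / INR n).
Proof.
  intros Hs Hm Hn.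
  assert (Hr : 0 <= r) by (generalize (Cmod_ge_0 s); lra).
  induction Hn as [|n Hn IH].
  - replace (euler s m - euler s m)%C with (RtoC 0) by ring.
    rewrite Cmod_0; lra.
  - assert (Hn0 : (0 < n)%nat) by lia.
    pose proof (inv_INR_range n Hn0) as Hv.
    rewrite euler_step, <- RtoC_inv by (try assumption; apply not_0_INR; lia).
    pose proof (euler_factor_le r _ s Hs Hv) as F.
    set (q := ((1 + s * (/ INR n)%R) * Cexp (- (s * ln (1 + / INR n)%R)))%C) in *.
    replace (euler s n * q - euler s m)%C
      with ((euler s n - euler s m) + euler s n * (q - 1))%C by ring.
    eapply Rle_trans; [apply Cmod_triangle|]; rewrite Cmod_mult.
    pose proof (euler_le r s n Hs Hn0) as B.
    pose proof (inv_sqr_telescope n Hn0).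
    pose proof (euler_const_pos r Hr) as HK.
    assert (Cmod (euler s n) * Cmod (q - 1)
            <= euler_bound r * (euler_const r * (2 * (/ INR n - / INR (S n))))).
    { apply Rmult_le_compat; try apply Cmod_ge_0; [exact B|].
      eapply Rle_trans; [exact F|]; apply Rmult_le_compat_l; assumption. }
    unfold euler_rate in *; lra.
Qed.

Lemma is_lim_seq_const_div (c : R) : is_lim_seq (fun n => c * / INR n) 0.
Proof.
  replace (Finite 0) with (Rbar_mult c 0) by (simpl; f_equal; ring).
  apply is_lim_seq_scal_l.
  replace (Finite 0) with (Rbar_inv p_infty) by reflexivity.
  apply is_lim_seq_inv; [apply is_lim_seq_INR|discriminate].
Qed.

Lemma euler_rate_pos (r : R) : 0 <= r -> 0 <= euler_rate r.
Proof.
  intros H; unfold euler_rate, euler_bound.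
  pose proof (euler_const_pos r H); pose proof (exp_pos (2 * euler_const r)).
  apply Rmult_le_pos; [lra|apply Rmult_le_pos; lra].
Qed.

Lemma euler_converges (s : C) : exists l, Clim (euler s) l.
Proof.
  set (r := Cmod s).
  assert (Hr : 0 <= r) by apply Cmod_ge_0.
  pose proof (euler_rate_pos r Hr) as HK.
  assert (A : forall eps : posreal, exists N, forall n m, (N <= n)%nat -> (N <= m)%nat ->
            Cmod (euler s n - euler s m) < eps).
  { intros eps.
    pose proof (is_lim_seq_const_div (euler_rate r)) as L; apply is_lim_seq_spec in L.
    destruct (L eps) as [N HN]; exists (S N).
    assert (B : forall n m, (S N <= n)%nat -> (n <= m)%nat ->
                Cmod (euler s m - euler s n) < eps).
    { intros n m H1 H2.
      eapply Rle_lt_trans; [apply (euler_cauchy r); [apply Rle_refl|lia|lia]|].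
      eapply Rle_lt_trans; [|apply (HN n); lia].
      rewrite Rminus_0_r; eapply Rle_trans; [|apply Rle_abs].
      apply Rmult_le_compat_l; [exact HK|].
      generalize (inv_INR_range m ltac:(lia)); lra. }
    intros n m Hn Hm; destruct (Nat.le_ge_cases n m).
    - rewrite Cmod_sub_sym; auto.
    - auto. }
  assert (HR : ex_finite_lim_seq (fun n => Re (euler s n))).
  { apply ex_lim_seq_cauchy_corr; intros eps; destruct (A eps) as [N HN].
    exists N; intros n m Hn Hm; eapply Rle_lt_trans; [|apply (HN n m Hn Hm)].
    apply (re_le_Cmod (euler s n - euler s m)). }
  assert (HI : ex_finite_lim_seq (fun n => Im (euler s n))).
  { apply ex_lim_seq_cauchy_corr; intros eps; destruct (A eps) as [N HN].
    exists N; intros n m Hn Hm; eapply Rle_lt_trans; [|apply (HN n m Hn Hm)].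
    apply (im_le_Cmod (euler s n - euler s m)). }
  destruct HR as [a Ha], HI as [b Hb]; exists (a, b).
  apply Clim_components; split; assumption.
Qed.

Lemma RCpow_near_1 (s : C) :
  Clim (fun n => RCpow (1 + / INR n) s) 1.
Proof.
  apply (Clim_le _ _ (fun n => (Cmod s + 4 * Cmod s ^ 2 * exp (Cmod s)) * / INR n));
    [|apply is_lim_seq_const_div].
  exists 1%nat; intros n Hn; pose proof (inv_INR_range n Hn) as Hv.
  set (v := / INR n) in *; set (t := ln (1 + v)).
  assert (T1 : t <= v) by (generalize (ln_le_sub_1 (1 + v)); unfold t; lra).
  assert (T0 : 0 <= t) by (generalize (ln_1_plus_ge v); unfold t; nra).
  unfold RCpow; fold t.
  replace (Cexp (s * t) - 1)%C with ((Cexp (s * t) - 1 - s * t) + s * t)%C by ring.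
  eapply Rle_trans; [apply Cmod_triangle|].
  eapply Rle_trans; [apply Rplus_le_compat_r, Cexp_taylor|].
  rewrite Cmod_mult, Cmod_R, Rabs_pos_eq by assumption.
  pose proof (Cmod_ge_0 s) as S0.
  assert (Q : Cmod s * t <= Cmod s * v) by (apply Rmult_le_compat_l; assumption).
  assert ((Cmod s * t) ^ 2 * exp (Cmod s * t) <= Cmod s ^ 2 * v * exp (Cmod s)).
  { apply Rmult_le_compat; [apply pow2_ge_0|left; apply exp_pos| |apply exp_le; nra].
    replace ((Cmod s * t) ^ 2) with (Cmod s ^ 2 * t ^ 2) by ring.
    apply Rmult_le_compat_l; [apply pow2_ge_0|nra]. }
  lra.
Qed.

Lemma rGamma_seq_euler (s : C) (n : nat) : (0 < n)%nat ->
  rGamma_seq s n = (euler s (S n) * RCpow (1 + / INR n) s)%C.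
Proof.
  intros Hn; assert (P : 0 < INR n) by (apply lt_0_INR, Hn).
  unfold rGamma_seq, euler, rising; rewrite Cprod_cprod, Nat.sub_0_r.
  replace (INR (S n)) with (INR n * (1 + / INR n)) by (rewrite S_INR; field; lra).
  rewrite RCpow_mult_base
    by (try assumption; generalize (Rinv_0_lt_compat _ P); lra).
  change (pred (S n)) with n; cbn [Nat.add].
  field; repeat split; try apply RCpow_nz; apply RtoC_fact_nz.
Qed.

Lemma euler_lim (s : C) : Clim (euler s) (rGamma s).
Proof.
  destruct (euler_converges s) as [l Hl].
  replace (rGamma s) with l; [exact Hl|].
  assert (H : Clim (rGamma_seq s) l).
  { apply (Clim_ext_loc (fun n => (euler s (S n) * RCpow (1 + / INR n) s)%C)).
    - exists 1%nat; intros n Hn; symmetry; apply rGamma_seq_euler; lia.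
    - rewrite <- (Cmult_1_r l); apply Clim_mult; [|apply RCpow_near_1].
      apply is_lim_seq_incr_1 in Hl; exact Hl. }
  apply Clim_components in H; destruct H as [HR HI].
  unfold rGamma; rewrite (is_lim_seq_unique _ _ HR), (is_lim_seq_unique _ _ HI).
  apply C_ext; reflexivity.
Qed.

Lemma Cmod_lim_le (u : nat -> C) (l c : C) (B : R) :
  Clim u l -> eventually (fun n => Cmod (u n - c) <= B) -> Cmod (l - c) <= B.
Proof.
  intros Hu [N HB].
  assert (H : is_lim_seq (fun n => Cmod (u n - l) + B) (0 + B)).
  { apply is_lim_seq_plus'; [exact Hu|apply is_lim_seq_const]. }
  assert (L : Rbar_le (Cmod (l - c)) (0 + B)).
  { apply (is_lim_seq_le_loc (fun _ => Cmod (l - c)) (fun n => Cmod (u n - l) + B));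
      [|apply is_lim_seq_const|exact H].
    exists N; intros n Hn; rewrite Cmod_sub_sym.
    generalize (Cmod_triangle (u n - c) (l - u n)) (HB n Hn).
    replace (u n - c + (l - u n))%C with (l - c)%C by ring.
    rewrite (Cmod_sub_sym l c), (Cmod_sub_sym l (u n)); lra. }
  simpl in L; lra.
Qed.

Lemma rGamma_euler_rate (r : R) (s : C) (m : nat) :
  Cmod s <= r -> (0 < m)%nat ->
  Cmod (rGamma s - euler s m) <= euler_rate r * / INR m.
Proof.
  intros Hs Hm; apply (Cmod_lim_le (euler s)); [apply euler_lim|].
  exists m; intros n Hn.
  eapply Rle_trans; [apply (euler_cauchy r); assumption|].
  apply Rmult_le_compat_l; [apply euler_rate_pos; generalize (Cmod_ge_0 s); lra|].
  generalize (inv_INR_range n ltac:(lia)); lra.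
Qed.

Lemma rGamma_le (r : R) (s : C) : Cmod s <= r -> Cmod (rGamma s) <= euler_bound r.
Proof.
  intros Hs; replace (rGamma s) with (rGamma s - 0)%C by ring.
  apply (Cmod_lim_le (euler s)); [apply euler_lim|].
  exists 1%nat; intros n Hn; replace (euler s n - 0)%C with (euler s n) by ring.
  apply euler_le; [exact Hs|lia].
Qed.

(* The quotients of consecutive Euler products are [1 + O(1 / m ^ 2)], so far out the
   products stay comparable to a fixed one, none of whose factors vanishes. *)
Lemma euler_ge (r x0 : R) : 0 < x0 -> exists c, 0 < c /\ exists N, (0 < N)%nat /\
  forall (s : C) m, Cmod s <= r -> x0 <= Re s -> (N <= m)%nat -> c <= Cmod (euler s m).
Proof.
  intros Hx.
  destruct (Rle_lt_dec 0 r) as [Hr|Hr].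
  2:{ exists 1; split; [lra|]; exists 1%nat; split; [lia|]; intros s m Hs.
      generalize (Cmod_ge_0 s); lra. }
  pose proof (euler_const_pos r Hr) as HK; set (K := euler_const r) in *.
  (* For m >= N the deviation K / m^2 is at most 1/2, the range where 1 - u >= exp (- 2 u). *)
  destruct (INR_unbounded (2 * K + 1)) as [N HN].
  assert (N1 : (0 < N)%nat) by (apply INR_lt; simpl; lra).
  (* A lower bound for the N-th product: its N linear factors have real part at least x0, and |N^s|
     <= N^r. *)
  set (c0 := x0 ^ N * / (INR (fact (pred N)) * exp (r * ln (INR N)))).
  assert (Hc0 : 0 < c0).
  { apply Rmult_lt_0_compat; [apply pow_lt; assumption|].
    apply Rinv_0_lt_compat, Rmult_lt_0_compat; [apply INR_fact_lt_0|apply exp_pos]. }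
  exists (c0 * exp (- (4 * K))); split; [apply Rmult_lt_0_compat; auto using exp_pos|].
  exists N; split; [exact N1|].
  intros s m Hs Hre Hm.
  assert (A : c0 * exp (- (4 * K * (/ INR N - / INR m))) <= Cmod (euler s m)).
  { induction Hm as [|m Hm IH].
    - rewrite Rminus_diag, Rmult_0_r, Ropp_0, exp_0, Rmult_1_r.
      unfold euler; rewrite Cmod_div, Cmod_mult, Cmod_R, Rabs_pos_eq, Cmod_RCpow;
        [|apply pos_INR|apply Cmult_neq_0; auto using RtoC_fact_nz, RCpow_nz].
      apply Rmult_le_compat.
      + apply pow_le; lra.
      + left; apply Rinv_0_lt_compat, Rmult_lt_0_compat; [apply INR_fact_lt_0|apply exp_pos].
      + unfold rising; clear - Hx Hre; induction N as [|N IH]; simpl; [rewrite Cmod_1; lra|].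
        rewrite Cmod_mult, Rmult_comm; apply Rmult_le_compat; auto using pow_le with real.
        eapply Rle_trans; [|apply re_le_Cmod].
        change (Re (s + INR N)) with (Re s + INR N).
        eapply Rle_trans; [|apply Rle_abs]; generalize (pos_INR N); lra.
      + apply Rinv_le_contravar; [apply Rmult_lt_0_compat; [apply INR_fact_lt_0|apply exp_pos]|].
        apply Rmult_le_compat_l; [apply pos_INR|]; apply exp_le, Rmult_le_compat_r.
        * rewrite <- ln_1; apply ln_le; [lra|apply (le_INR 1); lia].
        * generalize (re_le_Cmod s) (Rle_abs (Re s)); lra.
    - assert (Hm0 : (0 < m)%nat) by lia.
      pose proof (inv_INR_range m Hm0) as Hv.
      rewrite euler_step, Cmod_mult, <- RtoC_inv by (try assumption; apply not_0_INR; lia).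
      pose proof (euler_factor_le r _ s Hs Hv) as F; fold K in F.
      set (q := ((1 + s * (/ INR m)%R) * Cexp (- (s * ln (1 + / INR m)%R)))%C) in *.
      set (v := / INR m) in *.
      assert (V : K * v ^ 2 <= / 2).
      { assert (INR N <= INR m) by (apply le_INR, Hm).
        assert (E : INR m * v = 1) by (unfold v; field; apply not_0_INR; lia).
        nra. }
      assert (Q : exp (- (4 * K * (v - / INR (S m)))) <= Cmod q).
      { apply Rle_trans with (1 - K * v ^ 2).
        - apply Rle_trans with (exp (- (2 * (K * v ^ 2)))).
          + apply exp_le, Ropp_le_contravar.
            pose proof (inv_sqr_telescope m Hm0) as T; fold v in T; nra.
          + rewrite exp_Ropp.
            pose proof (exp_ineq1_le (2 * (K * v ^ 2))) as X.
            assert (0 <= K * v ^ 2) by (apply Rmult_le_pos; [exact HK|apply pow2_ge_0]).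
            apply Rmult_le_reg_r with (exp (2 * (K * v ^ 2))); [apply exp_pos|].
            rewrite Rinv_l by (apply Rgt_not_eq, exp_pos).
            nra.
        - generalize (Cmod_sub_le q (q - 1)); replace (q - (q - 1))%C with (RtoC 1) by ring.
          rewrite Cmod_1; lra. }
      replace (- (4 * K * (/ INR N - / INR (S m))))
        with (- (4 * K * (/ INR N - v)) + - (4 * K * (v - / INR (S m)))) by ring.
      rewrite exp_plus, <- Rmult_assoc.
      apply Rmult_le_compat; auto; [|left; apply exp_pos].
      apply Rmult_le_pos; [lra|left; apply exp_pos]. }
  eapply Rle_trans; [|exact A]; apply Rmult_le_compat_l; [lra|].
  apply exp_le, Ropp_le_contravar.
  pose proof (inv_INR_range N N1); pose proof (inv_INR_range m ltac:(lia)); nra.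
Qed.

Lemma rGamma_ge (c : R) (N : nat) (s : C) :
  (forall m, (N <= m)%nat -> c <= Cmod (euler s m)) -> c <= Cmod (rGamma s).
Proof.
  intros H.
  assert (L : Rbar_le c (Cmod (rGamma s) + 0)).
  { apply (is_lim_seq_le_loc (fun _ => c)
             (fun n => Cmod (rGamma s) + Cmod (euler s n - rGamma s))).
    - exists N; intros n Hn; specialize (H n Hn).
      generalize (Cmod_triangle (rGamma s) (euler s n - rGamma s)).
      replace (rGamma s + (euler s n - rGamma s))%C with (euler s n) by ring; lra.
    - apply is_lim_seq_const.
    - apply is_lim_seq_plus'; [apply is_lim_seq_const|apply euler_lim]. }
  simpl in L; lra.
Qed.

Lemma rGamma_nz (s : C) : 0 < Re s -> rGamma s <> 0%C.
Proof.
  intros H; destruct (euler_ge (Cmod s) (Re s) H) as [c [Hc [N [_ HN]]]].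
  apply Cmod_gt_0; apply Rlt_le_trans with c; [exact Hc|].
  apply (rGamma_ge c N); intros m Hm; apply HN; auto with real.
Qed.

(** Both sides contain s (s + 1) ... (s + m); the surplus factor 1 + s/m tends to 1 and leaves the
    functional equation. *)
Lemma euler_shift (s : C) (m : nat) : (0 < m)%nat ->
  (s * euler (s + 1) m = euler s m * (1 + s * / INR m))%C.
Proof.
  intros Hm.
  assert (M : RtoC (INR m) <> 0%C) by (apply RtoC_neq, not_0_INR; lia).
  unfold euler.
  assert (E : (s * rising (s + 1) m = rising s m * (s + INR m))%C).
  { change (rising s m * (s + INR m))%C with (cprod (fun j => (s + INR j)%C) (S m)).
    rewrite cprod_shift; change (INR 0) with 0; f_equal; [ring|].
    apply cprod_ext; intros i _; rewrite S_INR, RtoC_plus; ring. }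
  rewrite RCpow_plus, RCpow_RtoC, Rpower_1 by (apply lt_0_INR, Hm).
  replace (s * (rising (s + 1) m / (INR (fact (pred m)) * (RCpow (INR m) s * INR m))))%C
    with (rising s m * (s + INR m) / (INR (fact (pred m)) * (RCpow (INR m) s * INR m)))%C
    by (rewrite <- E; field; repeat split; auto using RtoC_fact_nz, RCpow_nz).
  field; repeat split; auto using RtoC_fact_nz, RCpow_nz.
Qed.

Lemma rGamma_func_eq (s : C) : rGamma s = (s * rGamma (s + 1))%C.
Proof.
  apply (Clim_unique (fun m => (euler s m * (1 + s * / INR m))%C)).
  - rewrite <- (Cmult_1_r (rGamma s)); apply Clim_mult; [apply euler_lim|].
    apply (eq_ind (1 + s * 0)%C (Clim _)); [|ring].
    apply Clim_plus; [apply Clim_const|]; apply Clim_mult; [apply Clim_const|].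
    apply (Clim_ext_loc (fun n => RtoC (/ INR n))).
    + exists 1%nat; intros n Hn; apply RtoC_inv, not_0_INR; lia.
    + apply Clim_RtoC; generalize (is_lim_seq_const_div 1).
      apply is_lim_seq_ext; intros; ring.
  - apply (Clim_ext_loc (fun m => (s * euler (s + 1) m)%C)).
    + exists 1%nat; intros n Hn; apply euler_shift; lia.
    + apply Clim_mult; [apply Clim_const|apply euler_lim].
Qed.

(** * Wallis' product and Stirling's formula *)

Definition wallis (n : nat) : R := RInt (fun t => sin t ^ n) 0 (PI / 2).

Lemma ex_RInt_sin_pow (n : nat) (a b : R) : ex_RInt (fun t => sin t ^ n) a b.
Proof.
  apply (ex_RInt_continuous (V := R_CompleteNormedModule)); intros t _.
  apply (ex_derive_continuous (fun t => sin t ^ n)); auto_derive; trivial.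
Qed.

Lemma wallis_0 : wallis 0 = PI / 2.
Proof.
  unfold wallis; rewrite (RInt_ext _ (fun _ => 1)) by (intros; reflexivity).
  rewrite RInt_const; unfold scal; simpl; unfold mult; simpl; ring.
Qed.

Lemma wallis_1 : wallis 1 = 1.
Proof.
  unfold wallis; apply is_RInt_unique.
  replace 1 with (minus (- cos (PI / 2)) (- cos 0))
    by (rewrite cos_0, cos_PI2; unfold minus, plus, opp; simpl; ring).
  apply (is_RInt_derive (fun t => - cos t)).
  - intros t _; auto_derive; [trivial|ring].
  - intros t _; apply (ex_derive_continuous (fun t => sin t ^ 1)); auto_derive; trivial.
Qed.

(** The function - cos t sin^(n+1) t vanishes at 0 and pi/2, and by cos^2 = 1 - sin^2 its derivative
    is the difference of the two integrands. *)
Lemma wallis_rec (n : nat) : INR (n + 2) * wallis (n + 2) = INR (n + 1) * wallis n.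
Proof.
  assert (H : is_RInt (fun t => INR (n + 2) * sin t ^ (n + 2) - INR (n + 1) * sin t ^ n)
                0 (PI / 2) 0).
  { replace 0 with (minus (- cos (PI / 2) * sin (PI / 2) ^ (n + 1))
                      (- cos 0 * sin 0 ^ (n + 1))) at 2.
    2:{ rewrite cos_PI2, sin_0, Nat.add_1_r; unfold minus, plus, opp; simpl; ring. }
    apply (is_RInt_derive (fun t => - cos t * sin t ^ (n + 1))).
    - intros t _; auto_derive; [trivial|].
      rewrite Nat.add_1_r; simpl pred.
      replace (n + 2)%nat with (S (S n)) by lia; rewrite !S_INR.
      assert (E : cos t * cos t = 1 - sin t * sin t)
        by (generalize (sin2_cos2 t); unfold Rsqr; lra).
      simpl pow.
      transitivity (sin t * (sin t * sin t ^ n) - (INR n + 1) * (cos t * cos t) * sin t ^ n);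
        [ring|rewrite E; ring].
    - intros t _; apply (ex_derive_continuous
        (fun t => INR (n + 2) * sin t ^ (n + 2) - INR (n + 1) * sin t ^ n)).
      auto_derive; trivial. }
  assert (K : is_RInt (fun t => INR (n + 2) * sin t ^ (n + 2) - INR (n + 1) * sin t ^ n)
                0 (PI / 2) (INR (n + 2) * wallis (n + 2) - INR (n + 1) * wallis n)).
  { apply (is_RInt_minus (V := R_NormedModule));
      apply (is_RInt_scal (V := R_NormedModule)),
        (RInt_correct (V := R_CompleteNormedModule)), ex_RInt_sin_pow. }
  apply (is_RInt_unique (V := R_CompleteNormedModule)) in H.
  apply (is_RInt_unique (V := R_CompleteNormedModule)) in K.
  assert (E : INR (n + 2) * wallis (n + 2) - INR (n + 1) * wallis n = 0)
    by (rewrite <- K; exact H).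
  lra.
Qed.

Lemma wallis_decr (n : nat) : wallis (S n) <= wallis n.
Proof.
  apply RInt_le; [generalize PI_RGT_0; lra|apply ex_RInt_sin_pow|apply ex_RInt_sin_pow|].
  intros t Ht; pose proof (SIN_bound t).
  assert (0 <= sin t) by (apply sin_ge_0; generalize PI_RGT_0; lra).
  simpl; rewrite <- (Rmult_1_l (sin t ^ n)) at 2.
  apply Rmult_le_compat_r; [apply pow_le; assumption|lra].
Qed.

(** The central binomial coefficient over 4^n, through which Wallis' product enters Stirling's
    formula. *)
Definition central (n : nat) : R := INR (fact (2 * n)) / (4 ^ n * INR (fact n) ^ 2).

Lemma central_pos (n : nat) : 0 < central n.
Proof.
  apply Rdiv_lt_0_compat; [apply INR_fact_lt_0|].
  apply Rmult_lt_0_compat; [apply pow_lt; lra|apply pow_lt, INR_fact_lt_0].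
Qed.

Lemma central_S (n : nat) :
  central (S n) = central n * (INR (2 * n + 1) / INR (2 * n + 2)).
Proof.
  unfold central.
  replace (2 * S n)%nat with (S (S (2 * n))) by lia.
  replace (fact (S (S (2 * n)))) with ((2 * n + 2) * ((2 * n + 1) * fact (2 * n)))%nat
    by (simpl fact; nia).
  replace (fact (S n)) with ((n + 1) * fact n)%nat by (simpl fact; nia).
  rewrite !mult_INR, !plus_INR, !mult_INR; simpl (4 ^ S n).
  change (INR 2) with (1 + 1); change (INR 1) with 1.
  generalize (pos_INR n) (INR_fact_lt_0 n); intros; field.
  repeat split; try lra; apply pow_nonzero; lra.
Qed.

Lemma wallis_even (n : nat) : wallis (2 * n) = PI / 2 * central n.
Proof.
  induction n as [|n IH].
  - simpl; rewrite wallis_0; unfold central; simpl; field.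
  - replace (2 * S n)%nat with (2 * n + 2)%nat by lia.
    pose proof (wallis_rec (2 * n)) as H; rewrite IH in H.
    rewrite central_S.
    assert (0 < INR (2 * n + 2)) by (apply lt_0_INR; lia).
    apply (Rmult_eq_reg_l (INR (2 * n + 2))); [rewrite H; field|]; lra.
Qed.

Lemma wallis_odd (n : nat) : wallis (2 * n + 1) = / (INR (2 * n + 1) * central n).
Proof.
  induction n as [|n IH].
  - simpl; rewrite wallis_1; unfold central; simpl; field.
  - replace (2 * S n + 1)%nat with (2 * n + 1 + 2)%nat by lia.
    pose proof (wallis_rec (2 * n + 1)) as H; rewrite IH in H.
    rewrite central_S; pose proof (central_pos n).
    replace (2 * n + 1 + 1)%nat with (2 * n + 2)%nat in H by lia.
    assert (0 < INR (2 * n + 1)) by (apply lt_0_INR; lia).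
    assert (0 < INR (2 * n + 2)) by (apply lt_0_INR; lia).
    assert (0 < INR (2 * n + 1 + 2)) by (apply lt_0_INR; lia).
    apply (Rmult_eq_reg_l (INR (2 * n + 1 + 2))); [rewrite H; field; lra|lra].
Qed.

(** [wallis (2 n + 1)] lies between [wallis (2 n + 2)] and [wallis (2 n)]. The even integrals are
    proportional to [central], the odd one to its inverse, so the squeeze isolates
    [central n ^ 2]. *)
Lemma central_lim : is_lim_seq (fun n => / (INR n * central n ^ 2)) PI.
Proof.
  assert (B : forall n, (0 < n)%nat ->
            PI / 2 * (2 + / INR n) * (1 - / INR n) <= / (INR n * central n ^ 2)
            <= PI / 2 * (2 + / INR n)).
  { intros n Hn; pose proof (wallis_decr (2 * n)) as H1.
    pose proof (wallis_decr (2 * n + 1)) as H2.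
    replace (S (2 * n)) with (2 * n + 1)%nat in H1 by lia.
    replace (S (2 * n + 1)) with (2 * n + 2)%nat in H2 by lia.
    pose proof (wallis_rec (2 * n)) as H3.
    rewrite wallis_even in H1, H3; rewrite wallis_odd in H1, H2.
    pose proof (central_pos n) as Hc; set (c := central n) in *.
    rewrite !plus_INR, !mult_INR in *.
    change (INR 2) with (1 + 1) in *; change (INR 1) with 1 in *.
    assert (Hx : 0 < INR n) by (apply lt_0_INR, Hn); set (x := INR n) in *.
    set (y := wallis (2 * n + 2)) in *.
    assert (Ey : y = ((1 + 1) * x + 1) * (PI / 2 * c) / ((1 + 1) * x + (1 + 1))).
    { apply (Rmult_eq_reg_l ((1 + 1) * x + (1 + 1))); [rewrite H3; field; lra|lra]. }
    set (u := / (((1 + 1) * x + 1) * c)) in *.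
    (* [u] is [wallis (2 n + 1)]; multiplying the chain of three integrals by (2 + 1/x) / c puts the
       wanted quantity in the middle. *)
    assert (Eu : / (x * c ^ 2) = u * ((2 + / x) / c)) by (unfold u; field; lra).
    rewrite Eu.
    assert (P : 0 < (2 + / x) / c).
    { apply Rdiv_lt_0_compat; [generalize (Rinv_0_lt_compat x Hx); lra|assumption]. }
    split.
    - apply Rle_trans with (y * ((2 + / x) / c)).
      + rewrite Ey.
        replace (((1 + 1) * x + 1) * (PI / 2 * c) / ((1 + 1) * x + (1 + 1)) * ((2 + / x) / c))
          with (PI / 2 * (2 + / x) * (((1 + 1) * x + 1) / ((1 + 1) * x + (1 + 1))))
          by (field; lra).
        apply Rmult_le_compat_l.
        * generalize PI_RGT_0 (Rinv_0_lt_compat x Hx); intros; apply Rmult_le_pos; lra.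
        * apply Rmult_le_reg_r with (x * ((1 + 1) * x + (1 + 1))); [nra|].
          replace ((1 - / x) * (x * ((1 + 1) * x + (1 + 1))))
            with ((x - 1) * ((1 + 1) * x + (1 + 1))) by (field; lra).
          replace (((1 + 1) * x + 1) / ((1 + 1) * x + (1 + 1)) * (x * ((1 + 1) * x + (1 + 1))))
            with (((1 + 1) * x + 1) * x) by (field; lra).
          nra.
      + apply Rmult_le_compat_r; lra.
    - replace (PI / 2 * (2 + / x)) with (PI / 2 * c * ((2 + / x) / c)) by (field; lra).
      apply Rmult_le_compat_r; lra. }
  assert (I : is_lim_seq (fun n => / INR n) 0).
  { generalize (is_lim_seq_const_div 1); apply is_lim_seq_ext; intros; ring. }
  assert (U : is_lim_seq (fun n => PI / 2 * (2 + / INR n)) PI).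
  { replace (Finite PI) with (Finite (PI / 2 * (2 + 0))) by (f_equal; field).
    apply is_lim_seq_mult'; [apply is_lim_seq_const|].
    apply is_lim_seq_plus'; [apply is_lim_seq_const|exact I]. }
  apply (is_lim_seq_le_le_loc (fun n => PI / 2 * (2 + / INR n) * (1 - / INR n)) _
           (fun n => PI / 2 * (2 + / INR n))); [|  |exact U].
  - exists 1%nat; intros n Hn; apply B; lia.
  - replace (Finite PI) with (Finite (PI * (1 - 0))) by (f_equal; ring).
    apply is_lim_seq_mult'; [exact U|].
    apply is_lim_seq_minus'; [apply is_lim_seq_const|exact I].
Qed.

(** The logarithm of n! / (n^(n + 1/2) e^(-n)). *)
Definition stirling_log (n : nat) : R :=
  ln (INR (fact n)) - (INR n + / 2) * ln (INR n) + INR n.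

(** The difference vanishes at 0 and has a nonnegative derivative. The bound is exactly what gives
    (1/v + 1/2) ln (1 + v) >= 1, that is, [stirling_log] decreases. *)
Lemma ln_1_plus_lower (v : R) : 0 <= v -> 2 * v / (2 + v) <= ln (1 + v).
Proof.
  intros Hv.
  destruct (MVT_gen (fun t => ln (1 + t) - 2 * t / (2 + t)) 0 v
              (fun t => t ^ 2 / ((1 + t) * (2 + t) ^ 2))) as [c [Hc E]].
  - intros t; rewrite Rmin_left, Rmax_right by lra; intros Ht.
    auto_derive; [lra|field; lra].
  - intros t; rewrite Rmin_left, Rmax_right by lra; intros Ht.
    apply derivable_continuous_pt, ex_derive_Reals_0; auto_derive; lra.
  - rewrite Rmin_left, Rmax_right in Hc by lra.
    rewrite Rplus_0_r, ln_1 in E.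
    assert (0 <= c ^ 2 / ((1 + c) * (2 + c) ^ 2)).
    { apply Rmult_le_pos; [apply pow2_ge_0|left; apply Rinv_0_lt_compat; nra]. }
    replace (0 - 2 * 0 / (2 + 0)) with 0 in E by field; nra.
Qed.

(** Third order is needed for a summable step of [stirling_log]: the terms in v cancel and v^2/12 +
    v^3/6 remains. *)
Lemma ln_1_plus_upper (v : R) : 0 <= v -> ln (1 + v) <= v - v ^ 2 / 2 + v ^ 3 / 3.
Proof.
  intros Hv.
  destruct (MVT_gen (fun t => t - t ^ 2 / 2 + t ^ 3 / 3 - ln (1 + t)) 0 v
              (fun t => t ^ 3 / (1 + t))) as [c [Hc E]].
  - intros t; rewrite Rmin_left, Rmax_right by lra; intros Ht.
    auto_derive; [lra|field; lra].
  - intros t; rewrite Rmin_left, Rmax_right by lra; intros Ht.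
    apply derivable_continuous_pt, ex_derive_Reals_0; auto_derive; lra.
  - rewrite Rmin_left, Rmax_right in Hc by lra.
    rewrite Rplus_0_r, ln_1 in E.
    assert (0 <= c ^ 3 / (1 + c)).
    { apply Rmult_le_pos; [apply pow_le; lra|left; apply Rinv_0_lt_compat; lra]. }
    replace (0 - 0 ^ 2 / 2 + 0 ^ 3 / 3 - 0) with 0 in E by field; nra.
Qed.

Lemma stirling_log_step (n : nat) : (0 < n)%nat ->
  0 <= stirling_log n - stirling_log (S n) <= (/ INR n) ^ 2.
Proof.
  intros Hn; assert (P : 0 < INR n) by (apply lt_0_INR, Hn).
  pose proof (inv_INR_range n Hn) as Hv; set (v := / INR n) in *.
  assert (E : stirling_log n - stirling_log (S n) = (/ v + / 2) * ln (1 + v) - 1).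
  { unfold stirling_log.
    replace (INR (S n)) with (INR n * (1 + v)) by (unfold v; rewrite S_INR; field; lra).
    replace (fact (S n)) with (S n * fact n)%nat by reflexivity.
    rewrite mult_INR.
    replace (INR (S n)) with (INR n * (1 + v)) by (unfold v; rewrite S_INR; field; lra).
    rewrite !ln_mult by (try apply INR_fact_lt_0; try apply Rmult_lt_0_compat; lra).
    unfold v; field; lra. }
  rewrite E; split.
  - pose proof (ln_1_plus_lower v ltac:(lra)) as L.
    apply Rle_trans with ((/ v + / 2) * (2 * v / (2 + v)) - 1).
    + right; field; lra.
    + apply Rplus_le_compat_r, Rmult_le_compat_l; [|exact L].
      generalize (Rinv_0_lt_compat v ltac:(lra)); lra.
  - pose proof (ln_1_plus_upper v ltac:(lra)) as L.
    apply Rle_trans with ((/ v + / 2) * (v - v ^ 2 / 2 + v ^ 3 / 3) - 1).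
    + apply Rplus_le_compat_r, Rmult_le_compat_l; [|exact L].
      generalize (Rinv_0_lt_compat v ltac:(lra)); lra.
    + replace ((/ v + / 2) * (v - v ^ 2 / 2 + v ^ 3 / 3) - 1) with (v ^ 2 / 12 + v ^ 3 / 6)
        by (field; lra).
      assert (v ^ 3 <= v ^ 2) by nra. nra.
Qed.

Lemma stirling_log_converges : exists l : R, is_lim_seq stirling_log l.
Proof.
  assert (B : forall n, stirling_log 1 - 2 * (1 - / INR (S n)) <= stirling_log (S n)).
  { induction n as [|n IH].
    - simpl; rewrite Rinv_1; lra.
    - pose proof (stirling_log_step (S n) ltac:(lia)).
      pose proof (inv_sqr_telescope (S n) ltac:(lia)); lra. }
  destruct (ex_finite_lim_seq_decr (fun n => stirling_log (S n)) (stirling_log 1 - 2))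
    as [l Hl].
  - intros n; pose proof (stirling_log_step (S n) ltac:(lia)); lra.
  - intros n; specialize (B n); pose proof (inv_INR_range (S n) ltac:(lia)); lra.
  - exists l; apply is_lim_seq_incr_1; exact Hl.
Qed.

Lemma filterlim_mult_eventually (k : nat) : (0 < k)%nat ->
  filterlim (fun n => (k * n)%nat) eventually eventually.
Proof.
  intros Hk P [N HN]; exists N; intros n Hn; apply HN; nia.
Qed.

(** In 2 S(n) - S(2 n) the terms n ln n and n cancel and only [central n] is left. The limit is 2 l
    - l on one hand and given by Wallis' product on the other. *)
Lemma stirling_log_lim : is_lim_seq stirling_log (ln (2 * PI) / 2).
Proof.
  destruct stirling_log_converges as [l Hl].
  replace (ln (2 * PI) / 2) with l; [exact Hl|].
  assert (H : is_lim_seq (fun n => 2 * stirling_log n - stirling_log (2 * n)) l).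
  { replace (Finite l) with (Finite (2 * l - l)) by (f_equal; ring).
    apply is_lim_seq_minus'.
    - apply is_lim_seq_mult'; [apply is_lim_seq_const|exact Hl].
    - apply (is_lim_seq_subseq stirling_log l (fun n => (2 * n)%nat));
        [apply filterlim_mult_eventually; lia|exact Hl]. }
  assert (K : is_lim_seq (fun n => 2 * stirling_log n - stirling_log (2 * n))
                (ln PI / 2 + ln 2 / 2)).
  { apply (is_lim_seq_ext_loc (fun n => ln (/ (INR n * central n ^ 2)) / 2 + ln 2 / 2)).
    - exists 1%nat; intros n Hn; assert (P : 0 < INR n) by (apply lt_0_INR; lia).
      unfold stirling_log, central; rewrite mult_INR; change (INR 2) with (1 + 1).
      replace (1 + 1) with 2 by ring.
      pose proof (INR_fact_lt_0 n); pose proof (INR_fact_lt_0 (2 * n)).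
      assert (0 < 4 ^ n) by (apply pow_lt; lra).
      assert (D : 0 < 4 ^ n * INR (fact n) ^ 2)
        by (apply Rmult_lt_0_compat; [assumption|apply pow_lt; assumption]).
      assert (C : 0 < INR (fact (2 * n)) / (4 ^ n * INR (fact n) ^ 2))
        by (apply Rdiv_lt_0_compat; assumption).
      rewrite ln_Rinv by (apply Rmult_lt_0_compat; [|apply pow_lt]; assumption).
      rewrite (ln_mult (INR n)) by (first [assumption | apply pow_lt; assumption]).
      rewrite ln_pow by assumption; rewrite ln_div by assumption.
      rewrite (ln_mult (4 ^ n)) by (first [assumption | apply pow_lt; assumption]).
      rewrite !ln_pow by (try assumption; lra).
      rewrite ln_mult by lra.
      replace (ln 4) with (2 * ln 2)
        by (replace 4 with (2 * 2) by ring; rewrite ln_mult by lra; ring).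
      change (INR 2) with (1 + 1); field.
    - apply is_lim_seq_plus'; [|apply is_lim_seq_const].
      replace (Finite (ln PI / 2)) with (Rbar_mult (ln PI) (/ 2)) by (simpl; f_equal; field).
      apply (is_lim_seq_scal_r (fun n => ln (/ (INR n * central n ^ 2))) (/ 2) (ln PI)).
      apply (is_lim_seq_continuous ln); [|apply central_lim].
      apply derivable_continuous_pt, ex_derive_Reals_0; auto_derive; apply PI_RGT_0. }
  apply is_lim_seq_unique in H; apply is_lim_seq_unique in K.
  rewrite H in K; injection K; intros ->.
  rewrite ln_mult by (generalize PI_RGT_0; lra); field.
Qed.

(** * Partial fractions and contour integrals *)

Fixpoint csum (f : nat -> C) (n : nat) : C :=
  match n with
  | O => RtoC 0
  | S m => (csum f m + f m)%C
  end.

Lemma csum_ext (f g : nat -> C) (n : nat) :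
  (forall i, (i < n)%nat -> f i = g i) -> csum f n = csum g n.
Proof.
  induction n as [|n IH]; simpl; intros H; [reflexivity|].
  rewrite IH, H by (intros; try apply H; lia); reflexivity.
Qed.

Lemma csum_scal (c : C) (f : nat -> C) (n : nat) :
  csum (fun i => (c * f i)%C) n = (c * csum f n)%C.
Proof. induction n as [|n IH]; simpl; [ring|rewrite IH; ring]. Qed.

Lemma csum_plus (f g : nat -> C) (n : nat) :
  csum (fun i => (f i + g i)%C) n = (csum f n + csum g n)%C.
Proof. induction n as [|n IH]; simpl; [ring|rewrite IH; ring]. Qed.

(** The residue at s = - a_i of the product of the (s + b_j) / (s + a_j), j < n: the factor of the
    denominator that vanishes there is replaced by 1. *)
Definition residue (a b : nat -> C) (n i : nat) : C :=
  cprod (fun j => ((b j - a i) / (if (j =? i)%nat then 1 else a j - a i))%C) n.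

Lemma partial_fractions (a b : nat -> C) (n : nat) :
  (forall i j, (i < n)%nat -> (j < n)%nat -> a i = a j -> i = j) ->
  forall s, (forall i, (i < n)%nat -> s + a i <> 0)%C ->
  cprod (fun i => ((s + b i) / (s + a i))%C) n =
  (1 + csum (fun i => residue a b n i / (s + a i)) n)%C.
Proof.
  induction n as [|n IH]; intros inj s Hs; [simpl; ring|].
  assert (D : forall i, (i < n)%nat -> (a n - a i <> 0)%C).
  { intros i Hi E; apply Ceq_minus in E; apply inj in E; lia. }
  assert (D' : forall i, (i < n)%nat -> (a i - a n <> 0)%C).
  { intros i Hi E; apply Ceq_minus in E; apply inj in E; lia. }
  assert (R1 : forall i, (i < n)%nat ->
            residue a b (S n) i = (residue a b n i * ((b n - a i) / (a n - a i)))%C).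
  { intros i Hi; unfold residue; cbn [cprod].
    replace (n =? i)%nat with false by (symmetry; apply Nat.eqb_neq; lia); reflexivity. }
  (* The residue at the new pole is b_n - a_n times the old product at s = - a_n, to which the
     induction hypothesis applies; this closes the induction. *)
  assert (R2 : residue a b (S n) n =
            ((1 + csum (fun i => residue a b n i / (a i - a n)) n) * (b n - a n))%C).
  { unfold residue at 1; cbn [cprod]; rewrite Nat.eqb_refl.
    rewrite (cprod_ext _ (fun j => ((- a n + b j) / (- a n + a j))%C)).
    2:{ intros i Hi; replace (i =? n)%nat with false by (symmetry; apply Nat.eqb_neq; lia).
        f_equal; ring. }
    rewrite IH.
    - rewrite (csum_ext _ (fun i => (residue a b n i / (a i - a n))%C)).
      + field; apply C1_nz.
      + intros i Hi; f_equal; ring.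
    - intros; apply inj; lia || assumption.
    - intros i Hi; replace (- a n + a i)%C with (a i - a n)%C by ring; auto. }
  cbn [cprod csum]; rewrite IH, R2 by (intros; try apply inj; try apply Hs; lia || assumption).
  rewrite (csum_ext (fun i => (residue a b (S n) i / (s + a i))%C)
    (fun i => ((s + b n) / (s + a n) * (residue a b n i / (s + a i)) +
               - ((b n - a n) / (s + a n)) * (residue a b n i / (a i - a n)))%C)).
  2:{ intros i Hi; rewrite R1 by assumption.
      assert (A : (a i - a n)%C = (- (a n - a i))%C) by ring; rewrite A.
      field; repeat split; try (apply Hs; lia); try (apply D; assumption). }
  rewrite csum_plus, !csum_scal; field; apply Hs; lia.
Qed.

(** * Continuity and integration of complex functions of a real variable; contours *)

Definition ccont (f : R -> C) (t : R) : Prop :=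
  continuous (fun t => Re (f t)) t /\ continuous (fun t => Im (f t)) t.

Lemma ccont_const (c : C) (t : R) : ccont (fun _ => c) t.
Proof. split; apply continuous_const. Qed.

Lemma ccont_plus (f g : R -> C) (t : R) :
  ccont f t -> ccont g t -> ccont (fun t => (f t + g t)%C) t.
Proof.
  intros [f1 f2] [g1 g2]; split; simpl.
  - apply (continuous_plus (V := R_NormedModule) (fun t => Re (f t)) (fun t => Re (g t))); assumption.
  - apply (continuous_plus (V := R_NormedModule) (fun t => Im (f t)) (fun t => Im (g t))); assumption.
Qed.

Lemma ccont_mult (f g : R -> C) (t : R) :
  ccont f t -> ccont g t -> ccont (fun t => (f t * g t)%C) t.
Proof.
  intros [f1 f2] [g1 g2]; split; simpl.
  - apply (continuous_minus (V := R_NormedModule) (fun t => Re (f t) * Re (g t)) (fun t => Im (f t) * Im (g t)));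
      apply (continuous_mult (K := R_AbsRing)); assumption.
  - apply (continuous_plus (V := R_NormedModule) (fun t => Re (f t) * Im (g t)) (fun t => Im (f t) * Re (g t)));
      apply (continuous_mult (K := R_AbsRing)); assumption.
Qed.

Lemma ccont_inv (f : R -> C) (t : R) :
  f t <> 0%C -> ccont f t -> ccont (fun t => (/ f t)%C) t.
Proof.
  intros Hf [f1 f2].
  assert (N : Re (f t) ^ 2 + Im (f t) ^ 2 <> 0).
  { rewrite <- Cmod_sqr; apply pow_nonzero, Rgt_not_eq, Cmod_gt_0, Hf. }
  assert (Sq : forall h : R -> R, continuous h t -> continuous (fun t => h t ^ 2) t).
  { intros h Hh; apply (continuous_mult (K := R_AbsRing) h (fun t => h t * 1)); [exact Hh|].
    apply (continuous_mult (K := R_AbsRing) h (fun _ => 1)); [exact Hh|apply continuous_const]. }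
  assert (Q : continuous (fun t => / (Re (f t) ^ 2 + Im (f t) ^ 2)) t).
  { apply (continuous_comp (fun t => Re (f t) ^ 2 + Im (f t) ^ 2) Rinv);
      [|apply continuous_Rinv; exact N].
    apply (continuous_plus (V := R_NormedModule)
      (fun t => Re (f t) ^ 2) (fun t => Im (f t) ^ 2));
      [apply (Sq (fun t => Re (f t)))|apply (Sq (fun t => Im (f t)))]; assumption. }
  split; simpl; unfold Rdiv; apply (continuous_mult (K := R_AbsRing)).
  - exact f1.
  - exact Q.
  - apply (continuous_opp (V := R_NormedModule)); exact f2.
  - exact Q.
Qed.

Lemma ccont_Cexp (f : R -> C) (t : R) :
  ccont f t -> ccont (fun t => Cexp (f t)) t.
Proof.
  intros [f1 f2]; split; simpl; apply (continuous_mult (K := R_AbsRing)).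
  1, 3: apply (continuous_comp (fun t => Re (f t)) exp); [exact f1|];
    apply (ex_derive_continuous exp); auto_derive; trivial.
  - apply (continuous_comp (fun t => Im (f t)) cos); [exact f2|apply continuous_cos].
  - apply (continuous_comp (fun t => Im (f t)) sin); [exact f2|apply continuous_sin].
Qed.

Definition cint (f : R -> C) (a b : R) (v : C) : Prop :=
  is_RInt (V := C_R_NormedModule) f a b v.

Lemma cint_components (f : R -> C) (a b : R) (v : C) :
  cint f a b v <->
  is_RInt (fun t => Re (f t)) a b (Re v) /\ is_RInt (fun t => Im (f t)) a b (Im v).
Proof.
  split.
  - intros H; split.
    + apply (is_RInt_fct_extend_fst (U := R_NormedModule) (V := R_NormedModule) f a b v H).
    + apply (is_RInt_fct_extend_snd (U := R_NormedModule) (V := R_NormedModule) f a b v H).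
  - intros [H1 H2]; destruct v as [v1 v2].
    apply (is_RInt_fct_extend_pair (U := R_NormedModule) (V := R_NormedModule)); assumption.
Qed.

Lemma cint_ext (f g : R -> C) (a b : R) (v : C) : a <= b ->
  (forall t, a <= t <= b -> f t = g t) -> cint f a b v -> cint g a b v.
Proof.
  intros Hab H; apply (is_RInt_ext (V := C_R_NormedModule)).
  intros t; rewrite Rmin_left, Rmax_right by exact Hab; intros Ht; apply H; lra.
Qed.

Lemma cint_plus (f g : R -> C) (a b : R) (u v : C) :
  cint f a b u -> cint g a b v -> cint (fun t => (f t + g t)%C) a b (u + v)%C.
Proof. apply (is_RInt_plus (V := C_R_NormedModule)). Qed.

Lemma cint_scal (c : C) (f : R -> C) (a b : R) (v : C) :
  cint f a b v -> cint (fun t => (c * f t)%C) a b (c * v)%C.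
Proof.
  intros H; apply cint_components in H; destruct H as [H1 H2].
  apply cint_components; split.
  - apply (is_RInt_minus (V := R_NormedModule));
      apply (is_RInt_scal (V := R_NormedModule)); assumption.
  - apply (is_RInt_plus (V := R_NormedModule));
      apply (is_RInt_scal (V := R_NormedModule)); assumption.
Qed.

Lemma cint_unique (f : R -> C) (a b : R) (u v : C) :
  cint f a b u -> cint f a b v -> u = v.
Proof.
  intros H1 H2.
  apply (is_RInt_unique (V := C_R_CompleteNormedModule)) in H1.
  apply (is_RInt_unique (V := C_R_CompleteNormedModule)) in H2; congruence.
Qed.

Lemma cint_cont (f : R -> C) (a b : R) : a <= b ->
  (forall t, a <= t <= b -> ccont f t) -> exists v, cint f a b v.
Proof.
  intros Hab H.
  exists (RInt (fun t => Re (f t)) a b, RInt (fun t => Im (f t)) a b).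
  apply cint_components; split; apply (RInt_correct (V := R_CompleteNormedModule));
    apply (ex_RInt_continuous (V := R_CompleteNormedModule)); intros t;
    rewrite Rmin_left, Rmax_right by exact Hab; intros Ht; apply H; exact Ht.
Qed.

Lemma norm_Cmod (v : C) : norm (K := R_AbsRing) (V := C_R_NormedModule) v = Cmod v.
Proof.
  change (sqrt (Rabs (fst v) ^ 2 + Rabs (snd v) ^ 2) = Cmod v).
  rewrite !RPow_abs, !Rabs_pos_eq by apply pow2_ge_0; reflexivity.
Qed.

Lemma cint_le (f : R -> C) (g : R -> R) (a b : R) (v : C) (w : R) : a <= b ->
  (forall t, a <= t <= b -> Cmod (f t) <= g t) ->
  cint f a b v -> is_RInt g a b w -> Cmod v <= w.
Proof.
  intros Hab H Hf Hg; rewrite <- norm_Cmod.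
  apply (norm_RInt_le (V := C_R_NormedModule) f g a b); try assumption.
  intros t Ht; rewrite norm_Cmod; auto.
Qed.

Lemma cint_le_const (f : R -> C) (M a b : R) (v : C) : a <= b ->
  (forall t, a <= t <= b -> Cmod (f t) <= M) ->
  cint f a b v -> Cmod v <= (b - a) * M.
Proof.
  intros Hab H Hf; apply (cint_le f (fun _ => M) a b); try assumption.
  apply (is_RInt_const (V := R_NormedModule)).
Qed.

Lemma cint_const (c : C) (a b : R) : cint (fun _ => c) a b (RtoC (b - a) * c).
Proof.
  apply cint_components; split.
  - replace (Re (RtoC (b - a) * c)) with (scal (b - a) (Re c))
      by (unfold scal, Re, Im; simpl; unfold mult; simpl; ring).
    apply (is_RInt_const (V := R_NormedModule)).
  - replace (Im (RtoC (b - a) * c)) with (scal (b - a) (Im c))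
      by (unfold scal, Re, Im; simpl; unfold mult; simpl; ring).
    apply (is_RInt_const (V := R_NormedModule)).
Qed.

Lemma cint_derive (F f : R -> C) (a b : R) : a <= b ->
  (forall t, a <= t <= b ->
     is_derive (fun t => Re (F t)) t (Re (f t)) /\
     is_derive (fun t => Im (F t)) t (Im (f t)) /\ ccont f t) ->
  cint f a b (F b - F a)%C.
Proof.
  intros Hab H; apply cint_components; split.
  - apply (is_RInt_derive (fun t => Re (F t)) (fun t => Re (f t)));
      intros t; rewrite Rmin_left, Rmax_right by exact Hab; intros Ht;
      destruct (H t Ht) as [H1 [H2 [H3 H4]]]; assumption.
  - apply (is_RInt_derive (fun t => Im (F t)) (fun t => Im (f t)));
      intros t; rewrite Rmin_left, Rmax_right by exact Hab; intros Ht;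
      destruct (H t Ht) as [H1 [H2 [H3 H4]]]; assumption.
Qed.

(* The boundary of [x1, x2] x [-T, T] is traversed counterclockwise. *)
Definition is_contour (f : C -> C) (x1 x2 T : R) (v : C) : Prop :=
  exists r l u d : C,
    cint (fun t => f (x2, t) * Ci)%C (- T) T r /\
    cint (fun t => f (x1, t) * Ci)%C (- T) T l /\
    cint (fun x => f (x, T)) x1 x2 u /\
    cint (fun x => f (x, - T)) x1 x2 d /\
    v = (r - l - u + d)%C.

Definition on_rect (x1 x2 T : R) (s : C) : Prop :=
  ((Re s = x1 \/ Re s = x2) /\ - T <= Im s <= T) \/
  ((Im s = T \/ Im s = - T) /\ x1 <= Re s <= x2).

Section Contour.

Variables x1 x2 T : R.
Hypothesis Hx : x1 <= x2.
Hypothesis HT : 0 <= T.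

Lemma is_contour_ext (f g : C -> C) (v : C) :
  (forall s, on_rect x1 x2 T s -> f s = g s) ->
  is_contour f x1 x2 T v -> is_contour g x1 x2 T v.
Proof.
  intros H [r [l [u [d [Hr [Hl [Hu [Hd E]]]]]]]]; exists r, l, u, d.
  repeat split; [| | | |exact E].
  1: apply (cint_ext (fun t => f (x2, t) * Ci)%C); [lra|intros t Ht|exact Hr].
  2: apply (cint_ext (fun t => f (x1, t) * Ci)%C); [lra|intros t Ht|exact Hl].
  3: apply (cint_ext (fun x => f (x, T))); [lra|intros t Ht|exact Hu].
  4: apply (cint_ext (fun x => f (x, - T))); [lra|intros t Ht|exact Hd].
  1, 2: f_equal.
  all: apply H; unfold on_rect; simpl; lra.
Qed.

Lemma is_contour_plus (f g : C -> C) (u v : C) :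
  is_contour f x1 x2 T u -> is_contour g x1 x2 T v ->
  is_contour (fun s => (f s + g s)%C) x1 x2 T (u + v).
Proof.
  intros [r [l [w [d [Hr [Hl [Hu [Hd E]]]]]]]] [r' [l' [u' [d' [Hr' [Hl' [Hu' [Hd' E']]]]]]]].
  exists (r + r')%C, (l + l')%C, (w + u')%C, (d + d')%C.
  repeat split; [| | | |rewrite E, E'; ring].
  1: apply (cint_ext (fun t => f (x2, t) * Ci + g (x2, t) * Ci)%C); [lra|intros; ring|].
  2: apply (cint_ext (fun t => f (x1, t) * Ci + g (x1, t) * Ci)%C); [lra|intros; ring|].
  all: apply cint_plus; assumption.
Qed.

Lemma is_contour_scal (c : C) (f : C -> C) (v : C) :
  is_contour f x1 x2 T v -> is_contour (fun s => (c * f s)%C) x1 x2 T (c * v).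
Proof.
  intros [r [l [u [d [Hr [Hl [Hu [Hd E]]]]]]]].
  exists (c * r)%C, (c * l)%C, (c * u)%C, (c * d)%C.
  repeat split; [| | | |rewrite E; ring].
  1: apply (cint_ext (fun t => c * (f (x2, t) * Ci))%C); [lra|intros; ring|].
  2: apply (cint_ext (fun t => c * (f (x1, t) * Ci))%C); [lra|intros; ring|].
  all: apply cint_scal; assumption.
Qed.

Lemma is_contour_csum (f : nat -> C -> C) (v : nat -> C) (n : nat) :
  (forall i, (i < n)%nat -> is_contour (f i) x1 x2 T (v i)) ->
  is_contour (fun s => csum (fun i => f i s) n) x1 x2 T (csum v n).
Proof.
  induction n as [|n IH]; intros H.
  - apply (is_contour_ext (fun _ => RtoC 0)); [reflexivity|].
    exists (RtoC 0), (RtoC 0), (RtoC 0), (RtoC 0).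
    assert (Z : forall a b, cint (fun _ => RtoC 0) a b 0).
    { intros a b; apply (eq_ind _ (cint _ a b) (cint_const 0 a b)); ring. }
    repeat split; [| | | |simpl; ring].
    1: apply (cint_ext (fun _ => RtoC 0)); [lra|intros; ring|].
    2: apply (cint_ext (fun _ => RtoC 0)); [lra|intros; ring|].
    1-4: apply Z.
  - cbn [csum]; apply (is_contour_plus (fun s => csum (fun i => f i s) n) (f n)).
    + apply IH; intros; apply H; lia.
    + apply H; lia.
Qed.

(** Continuity is asked along arbitrary continuous curves, so that one hypothesis serves all four
    sides. *)
Lemma ex_contour (f : C -> C) :
  (forall p t, ccont p t -> on_rect x1 x2 T (p t) -> ccont (fun t => f (p t)) t) ->
  exists v, is_contour f x1 x2 T v.
Proof.
  intros H.
  assert (Pv : forall x t, ccont (fun t => (x, t)) t).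
  { intros; split; simpl; [apply continuous_const|apply continuous_id]. }
  assert (Ph : forall x t, ccont (fun t => (t, x)) t).
  { intros; split; simpl; [apply continuous_id|apply continuous_const]. }
  destruct (cint_cont (fun t => f (x2, t) * Ci)%C (- T) T) as [r Hr].
  { lra. }
  { intros t Ht; apply ccont_mult; [|apply ccont_const].
    apply (H (fun t => (x2, t))); [apply Pv|unfold on_rect; simpl; lra]. }
  destruct (cint_cont (fun t => f (x1, t) * Ci)%C (- T) T) as [l Hl].
  { lra. }
  { intros t Ht; apply ccont_mult; [|apply ccont_const].
    apply (H (fun t => (x1, t))); [apply Pv|unfold on_rect; simpl; lra]. }
  destruct (cint_cont (fun t => f (t, T)) x1 x2) as [u Hu].
  { lra. }
  { intros t Ht; apply (H (fun t => (t, T))); [apply Ph|unfold on_rect; simpl; lra]. }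
  destruct (cint_cont (fun t => f (t, - T)) x1 x2) as [d Hd].
  { lra. }
  { intros t Ht; apply (H (fun t => (t, - T))); [apply Ph|unfold on_rect; simpl; lra]. }
  exists (r - l - u + d)%C, r, l, u, d; repeat split; assumption.
Qed.

Lemma is_contour_le (f : C -> C) (M : R) (v : C) :
  (forall s, on_rect x1 x2 T s -> Cmod (f s) <= M) ->
  is_contour f x1 x2 T v -> Cmod v <= (4 * T + 2 * (x2 - x1)) * M.
Proof.
  intros H [r [l [u [d [Hr [Hl [Hu [Hd E]]]]]]]].
  apply (cint_le_const _ M) in Hr; [|lra|].
  2:{ intros t Ht; rewrite Cmod_mult, Cmod_Ci, Rmult_1_r; apply H.
      unfold on_rect; simpl; lra. }
  apply (cint_le_const _ M) in Hl; [|lra|].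
  2:{ intros t Ht; rewrite Cmod_mult, Cmod_Ci, Rmult_1_r; apply H.
      unfold on_rect; simpl; lra. }
  apply (cint_le_const _ M) in Hu; [|lra|].
  2:{ intros t Ht; apply H; unfold on_rect; simpl; lra. }
  apply (cint_le_const _ M) in Hd; [|lra|].
  2:{ intros t Ht; apply H; unfold on_rect; simpl; lra. }
  rewrite E.
  eapply Rle_trans; [apply Cmod_triangle|].
  eapply Rle_trans; [apply Rplus_le_compat_r, Cmod_sub_le|].
  eapply Rle_trans; [apply Rplus_le_compat_r, Rplus_le_compat_r, Cmod_sub_le|].
  lra.
Qed.

Lemma is_contour_unique (f : C -> C) (u v : C) :
  is_contour f x1 x2 T u -> is_contour f x1 x2 T v -> u = v.
Proof.
  intros [r [l [w [d [Hr [Hl [Hu [Hd E]]]]]]]] [r' [l' [u' [d' [Hr' [Hl' [Hu' [Hd' E']]]]]]]].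
  rewrite E, E'.
  rewrite (cint_unique _ _ _ _ _ Hr Hr'), (cint_unique _ _ _ _ _ Hl Hl'),
    (cint_unique _ _ _ _ _ Hu Hu'), (cint_unique _ _ _ _ _ Hd Hd'); reflexivity.
Qed.

(** The primitive exp (la s) / la makes the four sides cancel at the corners; la = 0 is treated
    apart because of the division. *)
Lemma is_contour_Cexp (la : R) : is_contour (fun s => Cexp (la * s)) x1 x2 T 0.
Proof.
  destruct (Req_dec la 0) as [->|Hla].
  - apply (is_contour_ext (fun _ => RtoC 1)).
    { intros s _; rewrite Cmult_0_l, Cexp_0; reflexivity. }
    exists ((T - - T)%R * (1 * Ci))%C, ((T - - T)%R * (1 * Ci))%C,
      ((x2 - x1)%R * 1)%C, ((x2 - x1)%R * 1)%C.
    repeat split; try apply cint_const; ring.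
  - assert (V : forall x, cint (fun t => Cexp (la * (x, t)) * Ci)%C (- T) T
                  (/ la * Cexp (la * (x, T)) - / la * Cexp (la * (x, (- T)%R)))%C).
    { intros x.
      apply (cint_derive (fun t => / la * Cexp (la * (x, t)))%C); [lra|intros t _].
      rewrite <- RtoC_inv by exact Hla.
      split; [|split].
      - unfold Re, Im; simpl; auto_derive; [trivial|unfold Rminus; field; exact Hla].
      - unfold Re, Im; simpl; auto_derive; [trivial|unfold Rminus; field; exact Hla].
      - apply ccont_mult; [|apply ccont_const].
        apply ccont_Cexp, ccont_mult; [apply ccont_const|].
        split; simpl; [apply continuous_const|apply continuous_id]. }
    assert (H : forall y, cint (fun x => Cexp (la * (x, y))) x1 x2
                  (/ la * Cexp (la * (x2, y)) - / la * Cexp (la * (x1, y)))%C).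
    { intros y.
      apply (cint_derive (fun x => / la * Cexp (la * (x, y)))%C); [lra|intros t _].
      rewrite <- RtoC_inv by exact Hla.
      split; [|split].
      - unfold Re, Im; simpl; auto_derive; [trivial|unfold Rminus; field; exact Hla].
      - unfold Re, Im; simpl; auto_derive; [trivial|unfold Rminus; field; exact Hla].
      - apply ccont_Cexp, ccont_mult; [apply ccont_const|].
        split; simpl; [apply continuous_id|apply continuous_const]. }
    do 4 eexists; repeat split; [apply V|apply V|apply H|apply H|].
    ring.
Qed.

(** A primitive is chosen side by side: the real part is ln |s + a|, the imaginary part an
    arctangent of t / (x + a) on vertical sides and of (x + a) / t on horizontal ones, each smooth
    along its own side. *)
Lemma is_contour_inv (a : R) : 0 < T -> x1 < - a < x2 ->
  is_contour (fun s => (/ (s + a))%C) x1 x2 T (2 * PI * Ci)%C.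
Proof.
  intros HT' [H1 H2].
  assert (V : forall x, x + a <> 0 -> cint (fun t => / ((x, t) + a) * Ci)%C (- T) T
                (0, 2 * atan (T / (x + a)))).
  { intros x Hxa.
    set (F := fun t => (ln ((x + a) ^ 2 + t ^ 2) / 2, atan (t / (x + a))) : C).
    replace (0, 2 * atan (T / (x + a))) with (F T - F (- T)%R)%C.
    2:{ unfold F; apply C_ext; simpl.
        - replace (- T * (- T * 1)) with (T * (T * 1)) by ring; ring.
        - replace (- T / (x + a)) with (- (T / (x + a))) by (field; exact Hxa).
          rewrite atan_opp; ring. }
    apply cint_derive; [lra|intros t _].
    assert (P : 0 < (x + a) ^ 2 + t ^ 2).
    { generalize (pow2_ge_0 t) (pow2_gt_0 (x + a) Hxa); lra. }
    split; [|split].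
    - unfold F, Re, Im; simpl; auto_derive; [exact P|field].
      simpl in P; repeat split; lra.
    - unfold F, Re, Im; simpl; auto_derive; [trivial|field].
      simpl in P; repeat split; first [exact Hxa|lra].
    - apply ccont_mult; [|apply ccont_const]; apply ccont_inv.
      + apply Re_neq_0; exact Hxa.
      + apply ccont_plus; [|apply ccont_const].
        split; simpl; [apply continuous_const|apply continuous_id]. }
  assert (H : forall y, y <> 0 -> cint (fun x => / ((x, y) + a))%C x1 x2
     (ln ((x2 + a) ^ 2 + y ^ 2) / 2 - ln ((x1 + a) ^ 2 + y ^ 2) / 2,
      atan ((x1 + a) / y) - atan ((x2 + a) / y))).
  { intros y Hy.
    set (F := fun x => (ln ((x + a) ^ 2 + y ^ 2) / 2, - atan ((x + a) / y)) : C).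
    match goal with |- cint _ _ _ ?v => replace v with (F x2 - F x1)%C end.
    2:{ unfold F; apply C_ext; simpl; ring. }
    apply cint_derive; [lra|intros t _].
    assert (P : 0 < (t + a) ^ 2 + y ^ 2).
    { generalize (pow2_ge_0 (t + a)) (pow2_gt_0 y Hy); lra. }
    split; [|split].
    - unfold F, Re, Im; simpl; auto_derive; [exact P|field].
      simpl in P; repeat split; lra.
    - unfold F, Re, Im; simpl; auto_derive; [trivial|field].
      simpl in P; repeat split; first [exact Hy|lra].
    - apply ccont_inv.
      + intros E; apply Hy; apply (f_equal Im) in E; simpl in E; lra.
      + apply ccont_plus; [|apply ccont_const].
        split; simpl; [apply continuous_id|apply continuous_const]. }
  do 4 eexists; repeat split; [apply V; lra|apply V; lra|apply H; lra|apply H; lra|].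
  apply C_ext; simpl.
  - replace (- T * (- T * 1)) with (T * (T * 1)) by ring; ring.
  (* As x1 + a < 0 < x2 + a, signs are normalised to positive arguments, where atan u + atan (1/u) =
     pi/2; the angles then add up to 2 pi. *)
  - replace (T / (x1 + a)) with (- / (- (x1 + a) / T)) by (field; lra).
    replace (T / (x2 + a)) with (/ ((x2 + a) / T)) by (field; lra).
    replace ((x1 + a) / - T) with (- (x1 + a) / T) by (field; lra).
    replace ((x1 + a) / T) with (- (- (x1 + a) / T)) by (field; lra).
    replace ((x2 + a) / - T) with (- ((x2 + a) / T)) by (field; lra).
    rewrite !atan_opp, !atan_inv by (apply Rdiv_lt_0_compat; lra).
    field.
Qed.

End Contour.

(** Subdividing [0, L] into n equal steps bounds the total increment by K L^2 / n. This stands in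
    for differentiation under the integral sign. *)
Lemma quadratic_increments_const (f : R -> C) (K L : R) : 0 <= L ->
  (forall x y, 0 <= x <= y -> y <= L -> Cmod (f y - f x) <= K * (y - x) ^ 2) ->
  f L = f 0.
Proof.
  intros HL H.
  assert (K0 : 0 < L -> 0 <= K).
  { intros P; pose proof (H 0 L ltac:(lra) ltac:(lra)) as Q.
    generalize (Cmod_ge_0 (f L - f 0)); rewrite Rminus_0_r in Q; intros.
    assert (0 < L ^ 2) by (apply pow_lt; exact P); nra. }
  assert (B : forall n, (0 < n)%nat -> Cmod (f L - f 0) <= K * L ^ 2 * / INR n).
  { intros n Hn; assert (P : 0 < INR n) by (apply lt_0_INR, Hn).
    assert (Q : forall q, (q <= n)%nat ->
              Cmod (f (INR q * (L / INR n)) - f 0) <= INR q * (K * (L / INR n) ^ 2)).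
    { assert (D : 0 <= L / INR n)
        by (apply Rmult_le_pos; [exact HL|left; apply Rinv_0_lt_compat, P]).
      induction q as [|q IH]; intros Hq.
      - simpl INR; rewrite !Rmult_0_l.
        replace (f 0 - f 0)%C with (RtoC 0) by ring; rewrite Cmod_0; lra.
      - replace (f (INR (S q) * (L / INR n))%R - f 0)%C
          with ((f (INR (S q) * (L / INR n))%R - f (INR q * (L / INR n))%R)
                + (f (INR q * (L / INR n))%R - f 0))%C by ring.
        eapply Rle_trans; [apply Cmod_triangle|].
        specialize (IH ltac:(lia)).
        assert (HqL : INR (S q) * (L / INR n) <= L).
        { apply Rle_trans with (INR n * (L / INR n)).
          - apply Rmult_le_compat_r; [exact D|apply le_INR, Hq].
          - right; field; lra. }
        assert (J : Cmod (f (INR (S q) * (L / INR n)) - f (INR q * (L / INR n)))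
                    <= K * (L / INR n) ^ 2).
        { eapply Rle_trans; [apply H; [split|exact HqL]|].
          - apply Rmult_le_pos; [apply pos_INR|exact D].
          - apply Rmult_le_compat_r; [exact D|apply le_INR; lia].
          - right; rewrite S_INR; ring. }
        rewrite S_INR in *; lra. }
    specialize (Q n (Nat.le_refl n)).
    replace (INR n * (L / INR n)) with L in Q by (field; lra).
    eapply Rle_trans; [exact Q|right; field; lra]. }
  apply Ceq_minus, Cmod_eq_0, Rle_antisym; [|apply Cmod_ge_0].
  assert (X : Rbar_le (Cmod (f L - f 0)) 0).
  { apply (is_lim_seq_le_loc (fun _ => Cmod (f L - f 0)) (fun n => K * L ^ 2 * / INR n)).
    - exists 1%nat; intros n Hn; apply B; lia.
    - apply is_lim_seq_const.
    - apply is_lim_seq_const_div. }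
  exact X.
Qed.

Lemma on_rect_nz (x1 x2 T a : R) (s : C) : 0 < T -> x1 < - a < x2 ->
  on_rect x1 x2 T s -> (s + a <> 0)%C.
Proof.
  intros HT H Hs E.
  pose proof (f_equal Re E) as E1; pose proof (f_equal Im E) as E2.
  unfold Re, Im in E1, E2; simpl in E1, E2.
  unfold on_rect, Re, Im in Hs; lra.
Qed.

(* The contour integral of [exp (la (s + a)) / (s + a)] does not depend on [la]: its
   derivative in [la] is the integral of an entire function. *)
Lemma is_contour_kernel (x1 x2 T a la : R) : 0 <= la -> 0 < T -> x1 < - a < x2 ->
  is_contour (fun s => (Cexp (la * (s + a)) / (s + a))%C) x1 x2 T (2 * PI * Ci)%C.
Proof.
  intros Hla HT Ha.
  assert (Hx : x1 <= x2) by lra; assert (HT0 : 0 <= T) by lra.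
  set (g := fun (m : R) (s : C) => (Cexp (m * (s + a)) / (s + a))%C).
  assert (Ex : forall m : R, exists v, is_contour (g m) x1 x2 T v).
  { intros m; apply ex_contour; [exact Hx|exact HT0|].
    intros p t Hp Hs; unfold g, Cdiv.
    assert (Q : ccont (fun t => p t + a)%C t) by (apply ccont_plus; [exact Hp|apply ccont_const]).
    apply ccont_mult.
    - apply ccont_Cexp, ccont_mult; [apply ccont_const|exact Q].
    - apply ccont_inv; [|exact Q]; apply (on_rect_nz x1 x2 T); assumption. }
  (* The contour value is written with [RInt] to make it a function of the parameter. *)
  set (Phi := fun m => (RInt (V := C_R_CompleteNormedModule) (fun t => g m (x2, t) * Ci)%C (- T) T
     - RInt (V := C_R_CompleteNormedModule) (fun t => g m (x1, t) * Ci)%C (- T) T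
     - RInt (V := C_R_CompleteNormedModule) (fun x => g m (x, T)) x1 x2
     + RInt (V := C_R_CompleteNormedModule) (fun x => g m (x, (- T)%R)) x1 x2)%C).
  assert (HPhi : forall m, is_contour (g m) x1 x2 T (Phi m)).
  { intros m; destruct (Ex m) as [v Hv].
    replace (Phi m) with v; [exact Hv|].
    destruct Hv as [r [l [u [d [Hr [Hl [Hu [Hd E]]]]]]]]; unfold Phi.
    rewrite (is_RInt_unique (V := C_R_CompleteNormedModule) _ _ _ _ Hr),
      (is_RInt_unique (V := C_R_CompleteNormedModule) _ _ _ _ Hl),
      (is_RInt_unique (V := C_R_CompleteNormedModule) _ _ _ _ Hu),
      (is_RInt_unique (V := C_R_CompleteNormedModule) _ _ _ _ Hd); exact E. }
  assert (P0 : Phi 0 = (2 * PI * Ci)%C).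
  { apply (is_contour_unique x1 x2 T (g 0)); [apply HPhi|].
    apply (is_contour_ext x1 x2 T Hx HT0 (fun s => (/ (s + a))%C)).
    - intros s _; unfold g; rewrite Cmult_0_l, Cexp_0; unfold Cdiv; ring.
    - apply is_contour_inv; assumption. }
  rewrite <- P0.
  set (B := Rabs x1 + Rabs x2 + T + Rabs a).
  assert (HB : forall s, on_rect x1 x2 T s -> Cmod (s + a) <= B).
  { intros s Hs; eapply Rle_trans; [apply Cmod_triangle|]; rewrite Cmod_R.
    apply Rplus_le_compat_r; eapply Rle_trans; [apply Cmod_le_abs|].
    assert (Rabs (Re s) <= Rabs x1 + Rabs x2) by
      (destruct Hs as [[[->| ->] _]|[_ Hs]]; unfold Rabs; repeat destruct Rcase_abs; lra).
    assert (Rabs (Im s) <= T) by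
      (destruct Hs as [[_ Hs]|[[->| ->] _]]; unfold Rabs; repeat destruct Rcase_abs; lra).
    lra. }
  assert (B0 : 0 <= B).
  { unfold B; generalize (Rabs_pos x1) (Rabs_pos x2) (Rabs_pos a); lra. }
  replace (Phi 0) with (Phi la); [apply HPhi|].
  apply (quadratic_increments_const Phi
    ((4 * T + 2 * (x2 - x1)) * (exp (la * B) * (4 * B * exp (la * B)))) la Hla).
  intros x y Hxy Hy; set (h := y - x).
  (* The increment of the kernel is h exp (x (s + a)), entire with zero contour integral, plus this
     remainder of order h^2. *)
  set (rem := fun s : C => (Cexp (x * (s + a)) * ((Cexp (h * (s + a)) - 1 - h * (s + a)) / (s + a)))%C).
  assert (Hrem : is_contour rem x1 x2 T (Phi y - Phi x)%C).
  { replace (Phi y - Phi x)%C with (Phi y + (- (1)) * Phi x + (- h * Cexp (x * a)) * 0)%C by ring.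
    apply (is_contour_ext x1 x2 T Hx HT0
      (fun s => g y s + (- (1)) * g x s + (- h * Cexp (x * a)) * Cexp (x * s))%C).
    - intros s Hs; unfold rem, g.
      replace (y * (s + a))%C with (x * (s + a) + h * (s + a))%C
        by (unfold h; rewrite RtoC_minus; ring).
      rewrite Cexp_plus.
      replace (Cexp (x * (s + a))) with (Cexp (x * s) * Cexp (x * a))%C
        by (rewrite <- Cexp_plus; f_equal; ring).
      field; apply (on_rect_nz x1 x2 T); assumption.
    - apply is_contour_plus; [exact HT0| |].
      + apply is_contour_plus; [exact HT0|apply HPhi|].
        apply is_contour_scal; [exact HT0|apply HPhi].
      + apply is_contour_scal; [exact HT0|].
        apply is_contour_Cexp; assumption. }
  rewrite Rmult_assoc.
  apply (is_contour_le x1 x2 T Hx HT0 rem); [|exact Hrem].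
  intros s Hs; unfold rem.
  assert (NZ : (s + a <> 0)%C) by (apply (on_rect_nz x1 x2 T); assumption).
  assert (MP : 0 < Cmod (s + a)) by (apply Cmod_gt_0, NZ).
  pose proof (HB s Hs) as HBs.
  rewrite Cmod_mult, Cmod_div by exact NZ.
  assert (h0 : 0 <= h <= la) by (unfold h; lra).
  assert (G1 : Cmod (Cexp (x * (s + a))) <= exp (la * B)).
  { rewrite Cmod_Cexp; apply exp_le.
    eapply Rle_trans; [apply Rle_abs|]; eapply Rle_trans; [apply re_le_Cmod|].
    rewrite Cmod_mult, Cmod_R, Rabs_pos_eq by lra.
    apply Rmult_le_compat; lra. }
  assert (G2 : Cmod (Cexp (h * (s + a)) - 1 - h * (s + a)) / Cmod (s + a)
               <= 4 * B * exp (la * B) * h ^ 2).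
  { apply Rmult_le_reg_r with (Cmod (s + a)); [exact MP|].
    unfold Rdiv; rewrite Rmult_assoc, Rinv_l, Rmult_1_r by lra.
    eapply Rle_trans; [apply Cexp_taylor|].
    rewrite Cmod_mult, Cmod_R, Rabs_pos_eq by lra.
    assert (E1 : exp (h * Cmod (s + a)) <= exp (la * B))
      by (apply exp_le, Rmult_le_compat; lra).
    replace (4 * (h * Cmod (s + a)) ^ 2 * exp (h * Cmod (s + a)))
      with (4 * h ^ 2 * Cmod (s + a) * (Cmod (s + a) * exp (h * Cmod (s + a)))) by ring.
    replace (4 * B * exp (la * B) * h ^ 2 * Cmod (s + a))
      with (4 * h ^ 2 * Cmod (s + a) * (B * exp (la * B))) by ring.
    apply Rmult_le_compat_l.
    - apply Rmult_le_pos; [|lra]; generalize (pow2_ge_0 h); lra.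
    - apply Rmult_le_compat; [lra|left; apply exp_pos|exact HBs|exact E1]. }
  rewrite Rmult_assoc.
  apply Rmult_le_compat; [apply Cmod_ge_0| |exact G1|fold h; exact G2].
  apply Rmult_le_pos; [apply Cmod_ge_0|left; apply Rinv_0_lt_compat, MP].
Qed.

(** * Bounds for products of ratios *)

Fixpoint rsum (f : nat -> R) (n : nat) : R :=
  match n with
  | O => 0
  | S m => rsum f m + f m
  end.

Lemma rsum_ge (f : nat -> R) (n : nat) : (forall i, 0 <= f i) ->
  forall i, (i < n)%nat -> f i <= rsum f n.
Proof.
  intros H; assert (P : forall m, 0 <= rsum f m).
  { induction m as [|m IH]; simpl; [lra|specialize (H m); lra]. }
  induction n as [|n IH]; simpl; intros i Hi; [lia|].
  destruct (Nat.eq_dec i n) as [->|Hn]; [specialize (P n); lra|].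
  specialize (IH i ltac:(lia)); specialize (H n); lra.
Qed.

Lemma rsum_nonneg (f : nat -> R) (n : nat) : (forall i, 0 <= f i) -> 0 <= rsum f n.
Proof.
  intros H; induction n as [|n IH]; simpl; [lra|specialize (H n); lra].
Qed.

Lemma Cmod_cprod_le_exp (f : nat -> C) (e : nat -> R) (n : nat) :
  (forall i, (i < n)%nat -> Cmod (f i) <= exp (e i)) ->
  Cmod (cprod f n) <= exp (rsum e n).
Proof.
  induction n as [|n IH]; intros H; simpl.
  - rewrite Cmod_1, exp_0; lra.
  - rewrite Cmod_mult, exp_plus.
    apply Rmult_le_compat; try apply Cmod_ge_0; [apply IH; intros|]; apply H; lia.
Qed.

(** |1 + w|^2 = 1 + (2 Re w + |w|^2), and 1 + u <= exp u. *)
Lemma Cmod_1_plus_le (w : C) : Cmod (1 + w) <= exp (Re w + Cmod w ^ 2 / 2).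
Proof.
  apply Rsqr_incr_0_var; [|left; apply exp_pos].
  unfold Rsqr; rewrite <- exp_plus.
  replace (Cmod (1 + w) * Cmod (1 + w)) with (Cmod (1 + w) ^ 2) by ring.
  eapply Rle_trans; [|apply exp_ineq1_le].
  rewrite !Cmod_sqr; unfold Re, Im; simpl; right; field.
Qed.

(** Since g_j / (w + d_j) = g_j / w + O(1/|w|^2), a block depends to first order only on the sum of
    the g_j; B keeps w + d_j comparable to w. *)
Lemma Cmod_group_le (k : nat) (g d : nat -> R) (B : R) : 0 <= B ->
  exists K, 0 <= K /\ forall w : C, w <> 0%C ->
  (forall j, (j < k)%nat -> w + d j <> 0 /\ Cmod w <= B * Cmod (w + d j))%C ->
  Cmod (cprod (fun j => 1 + g j / (w + d j))%C k)
  <= exp (rsum g k * Re (/ w) + K / Cmod w ^ 2).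
Proof.
  intros HB.
  set (Kj := fun j => Rabs (g j) * Rabs (d j) * B + g j ^ 2 * B ^ 2 / 2).
  assert (HKj : forall j, 0 <= Kj j).
  { intros j; unfold Kj; generalize (Rabs_pos (g j)) (Rabs_pos (d j)); intros.
    apply Rplus_le_le_0_compat; [repeat apply Rmult_le_pos; assumption|].
    generalize (pow2_ge_0 (g j * B)); rewrite Rpow_mult_distr; lra. }
  exists (rsum Kj k); split; [apply rsum_nonneg, HKj|].
  intros w Hw H.
  assert (M : 0 < Cmod w) by (apply Cmod_gt_0, Hw).
  eapply Rle_trans.
  - apply (Cmod_cprod_le_exp _ (fun j => g j * Re (/ w) + Kj j / Cmod w ^ 2)).
    intros j Hj; destruct (H j Hj) as [N L].
    eapply Rle_trans; [apply Cmod_1_plus_le|]; apply exp_le.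
    assert (Mj : 0 < Cmod (w + d j)) by (apply Cmod_gt_0, N).
    assert (I : / Cmod (w + d j) <= B / Cmod w).
    { apply Rmult_le_reg_r with (Cmod (w + d j)); [exact Mj|].
      rewrite Rinv_l by lra.
      apply Rmult_le_reg_r with (Cmod w); [exact M|].
      replace (B / Cmod w * Cmod (w + d j) * Cmod w) with (B * Cmod (w + d j)) by (field; lra).
      lra. }
    assert (I0 : 0 < / Cmod (w + d j)) by (apply Rinv_0_lt_compat, Mj).
    assert (R1 : Re (g j / (w + d j)) <= g j * Re (/ w) + Rabs (g j) * Rabs (d j) * B / Cmod w ^ 2).
    { replace (g j / (w + d j))%C
        with (g j * / w + - (g j * d j) * / w * / (w + d j))%C by (field; auto).
      change (Re (g j * / w + - (g j * d j) * / w * / (w + d j)))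
        with (Re (g j * / w) + Re (- (g j * d j) * / w * / (w + d j))).
      rewrite re_scal_l; apply Rplus_le_compat_l.
      eapply Rle_trans; [apply Rle_abs|]; eapply Rle_trans; [apply re_le_Cmod|].
      rewrite !Cmod_mult, Cmod_opp, Cmod_mult, !Cmod_R, !Cmod_inv by assumption.
      replace (Rabs (g j) * Rabs (d j) * B / Cmod w ^ 2)
        with (Rabs (g j) * Rabs (d j) * / Cmod w * (B / Cmod w)) by (field; lra).
      apply Rmult_le_compat_l; [|exact I].
      generalize (Rabs_pos (g j)) (Rabs_pos (d j)) (Rinv_0_lt_compat _ M); intros.
      repeat apply Rmult_le_pos; lra. }
    assert (R2 : Cmod (g j / (w + d j)) ^ 2 <= g j ^ 2 * B ^ 2 / Cmod w ^ 2).
    { rewrite Cmod_div, Cmod_R by exact N; unfold Rdiv at 1.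
      rewrite Rpow_mult_distr, pow2_abs.
      replace (g j ^ 2 * B ^ 2 / Cmod w ^ 2) with (g j ^ 2 * (B / Cmod w) ^ 2) by (field; lra).
      apply Rmult_le_compat_l; [apply pow2_ge_0|].
      apply pow_incr; lra. }
    replace (Kj j / Cmod w ^ 2) with (Rabs (g j) * Rabs (d j) * B / Cmod w ^ 2
      + g j ^ 2 * B ^ 2 / Cmod w ^ 2 / 2) by (unfold Kj; field; lra).
    lra.
  - apply exp_le; right; clear H; induction k as [|k IH]; cbn [rsum].
    + unfold Rdiv; ring.
    + rewrite IH; unfold Rdiv; ring.
Qed.

(** Mean value theorem with 1 + c^2 <= 3 (1 + x^2) for |c - x| <= 1. Sums of the left side along x +
    m are thus at most 3 pi for every real x. *)
Lemma atan_step (x : R) : / (1 + x ^ 2) <= 3 * (atan (x + 1) - atan x).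
Proof.
  destruct (MVT_gen atan x (x + 1) (fun t => / (1 + t ^ 2))) as [c [Hc E]].
  - intros t _; auto_derive; [trivial|]; simpl; field.
    generalize (pow2_ge_0 t); simpl; lra.
  - intros t _; apply derivable_continuous_pt, derivable_pt_atan.
  - rewrite Rmin_left, Rmax_right in Hc by lra; rewrite E.
    replace (x + 1 - x) with 1 by ring; rewrite Rmult_1_r.
    assert (D : 1 + c ^ 2 <= 3 * (1 + x ^ 2)).
    { assert ((c - x) ^ 2 <= 1) by nra; generalize (pow2_ge_0 (c - 2 * x)); nra. }
    assert (D0 : 0 < 1 + c ^ 2) by (generalize (pow2_ge_0 c); lra).
    apply Rmult_le_reg_r with (1 + c ^ 2); [exact D0|].
    replace (3 * / (1 + c ^ 2) * (1 + c ^ 2)) with 3 by (field; lra).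
    assert (X0 : 0 < 1 + x ^ 2) by (generalize (pow2_ge_0 x); lra).
    apply Rmult_le_reg_l with (1 + x ^ 2); [exact X0|].
    rewrite <- Rmult_assoc, Rinv_r by lra; lra.
Qed.

(** With a and b the values of x^2 + t^2 at x and x - 1, b = a - 2 x + 1 and ln (b / a) <= b / a -
    1: the real part of 1 / (x + i t) telescopes up to a summable error. *)
Lemma ln_step (x t : R) : 1 <= t ^ 2 ->
  x / (x ^ 2 + t ^ 2) <=
  ln (x ^ 2 + t ^ 2) / 2 - ln ((x - 1) ^ 2 + t ^ 2) / 2 + / (x ^ 2 + t ^ 2) / 2.
Proof.
  intros Ht.
  set (a := x ^ 2 + t ^ 2); set (b := (x - 1) ^ 2 + t ^ 2).
  assert (Ha : 0 < a) by (unfold a; generalize (pow2_ge_0 x); lra).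
  assert (Hb : 0 < b) by (unfold b; generalize (pow2_ge_0 (x - 1)); lra).
  assert (L : ln (b / a) <= b / a - 1).
  { apply ln_le_sub_1, Rdiv_lt_0_compat; assumption. }
  rewrite ln_div in L by assumption.
  replace (b / a - 1) with (- (2 * (x / a)) + / a) in L.
  - lra.
  - replace b with (a - 2 * x + 1) by (unfold a, b; ring); field; lra.
Qed.

(** The bound is free of y. It is used with y the real part of a point on a horizontal line, and
    with y = - n and t = 1 at a pole. *)
Lemma harmonic_sum_le (K y t : R) (n : nat) : 0 <= K -> 1 <= t ^ 2 ->
  rsum (fun m => / 2 * ((y + INR m) / ((y + INR m) ^ 2 + t ^ 2))
                 + K / ((y + INR m) ^ 2 + t ^ 2)) n
  <= ln (2 + 2 * INR n ^ 2 / t ^ 2) / 4 + 3 * PI * (K + / 4).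
Proof.
  intros HK Ht.
  assert (A : rsum (fun m => / 2 * ((y + INR m) / ((y + INR m) ^ 2 + t ^ 2))
                 + K / ((y + INR m) ^ 2 + t ^ 2)) n
     <= (ln ((y + INR n - 1) ^ 2 + t ^ 2) - ln ((y - 1) ^ 2 + t ^ 2)) / 4
        + 3 * (K + / 4) * (atan (y + INR n) - atan y)).
  { induction n as [|n IH].
    - simpl INR; rewrite Rplus_0_r; simpl rsum; lra.
    - cbn [rsum]; rewrite S_INR; set (x := y + INR n) in *.
      replace (y + (INR n + 1)) with (x + 1) by (unfold x; ring).
      replace (x + 1 - 1) with x by ring.
      pose proof (ln_step x t Ht) as L; pose proof (atan_step x) as T.
      assert (D : / (x ^ 2 + t ^ 2) <= / (1 + x ^ 2)).
      { apply Rinv_le_contravar; generalize (pow2_ge_0 x); lra. }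
      set (i := / (x ^ 2 + t ^ 2)) in *.
      assert (D2 : (K + / 4) * i <= (K + / 4) * (3 * (atan (x + 1) - atan x)))
        by (apply Rmult_le_compat_l; lra).
      unfold Rdiv in *; fold i; fold i in L; lra. }
  eapply Rle_trans; [exact A|]; apply Rplus_le_compat.
  - set (a := (y + INR n - 1) ^ 2 + t ^ 2); set (b := (y - 1) ^ 2 + t ^ 2).
    assert (Ha : 0 < a) by (unfold a; generalize (pow2_ge_0 (y + INR n - 1)); lra).
    assert (Hb : 0 < b) by (unfold b; generalize (pow2_ge_0 (y - 1)); lra).
    rewrite <- ln_div by assumption.
    (* (u + n)^2 <= 2 u^2 + 2 n^2 with u = y - 1 gives a <= 2 b + 2 n^2, and b >= t^2 removes y. *)
    assert (Q : a / b <= 2 + 2 * INR n ^ 2 / t ^ 2).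
    { apply Rmult_le_reg_r with b; [exact Hb|].
      replace (a / b * b) with a by (field; lra).
      apply Rle_trans with (2 * b + 2 * INR n ^ 2).
      - unfold a, b; generalize (pow2_ge_0 (y - 1 - INR n)); nra.
      - rewrite Rmult_plus_distr_r; apply Rplus_le_compat_l.
        replace (2 * INR n ^ 2) with (2 * INR n ^ 2 / t ^ 2 * t ^ 2) at 1 by (field; nra).
        apply Rmult_le_compat_l.
        + apply Rmult_le_pos; [generalize (pow2_ge_0 (INR n)); lra|].
          left; apply Rinv_0_lt_compat; lra.
        + unfold b; generalize (pow2_ge_0 (y - 1)); lra. }
    apply Rmult_le_compat_r; [lra|]; apply ln_le; [|exact Q].
    apply Rdiv_lt_0_compat; assumption.
  - replace (3 * PI * (K + / 4)) with (3 * (K + / 4) * PI) by ring.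
    apply Rmult_le_compat_l; [lra|].
    pose proof (atan_bound (y + INR n)); pose proof (atan_bound y); lra.
Qed.

Lemma Re_inv (w : C) : Re (/ w) = Re w / Cmod w ^ 2.
Proof. rewrite Cmod_sqr; unfold Re, Im; simpl; reflexivity. Qed.

Section Bounds.

Variables (k : nat) (g d : nat -> R).
Hypothesis Hg : rsum g k = / 2.

(** For |t| >= 1 every w + d_j has modulus at least 1, so |w| <= (1 + A) |w + d_j|. The sum 1/2 of
    the [g j] becomes the exponent 1/4 of 2 + 2 n^2 / t^2. *)
Lemma horizontal_le : exists K, forall (y t : R) (n : nat), 1 <= t ^ 2 ->
  Cmod (cprod (fun m => cprod (fun j => 1 + g j / ((y, t) + INR m + d j))%C k) n)
  <= exp (ln (2 + 2 * INR n ^ 2 / t ^ 2) / 4 + K).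
Proof.
  set (A := rsum (fun j => Rabs (d j)) k).
  assert (HA0 : 0 <= A) by (apply rsum_nonneg; intros; apply Rabs_pos).
  assert (HA : forall j, (j < k)%nat -> Rabs (d j) <= A).
  { intros j Hj; apply (rsum_ge (fun j => Rabs (d j))); [intros; apply Rabs_pos|exact Hj]. }
  destruct (Cmod_group_le k g d (1 + A)) as [K [HK H]]; [lra|].
  exists (3 * PI * (K + / 4)); intros y t n Ht.
  eapply Rle_trans; [|apply exp_le, (harmonic_sum_le K y t n HK Ht)].
  apply Cmod_cprod_le_exp; intros m _.
  set (w := ((y, t) + INR m)%C).
  assert (Rw : Re w = y + INR m) by reflexivity.
  assert (Iw : Im w = t) by (unfold w, Im; simpl; ring).
  assert (t0 : 1 <= Rabs t).
  { apply Rsqr_incr_0_var; [|apply Rabs_pos].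
    rewrite <- Rsqr_abs; unfold Rsqr; lra. }
  eapply Rle_trans; [apply (H w)|].
  - intros E; rewrite E in Iw; simpl in Iw; rewrite <- Iw, Rabs_R0 in t0; lra.
  - intros j Hj.
    assert (L : 1 <= Cmod (w + d j)).
    { eapply Rle_trans; [|apply im_le_Cmod].
      replace (Im (w + d j)) with t; [exact t0|].
      change (t = Im w + 0); lra. }
    split; [apply Cmod_gt_0; lra|].
    generalize (Cmod_sub_le (w + d j) (d j)).
    replace (w + d j - d j)%C with w by ring.
    rewrite Cmod_R; specialize (HA j Hj); nra.
  - rewrite Re_inv, Cmod_sqr, Rw, Iw, Hg; apply Rle_refl.
Qed.

(** At a pole w = m - n is a nonzero integer once the block m = n is set aside, and shifts of size
    at most 1 - 1/B leave |w + d| >= |w| / B. *)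
Lemma residue_product_le (j0 : nat) (B : R) : 1 <= B ->
  (forall j, (j < k)%nat -> Rabs (d j - d j0) <= 1 - / B) ->
  exists K, forall n nu : nat,
  Cmod (cprod (fun m => if (m =? n)%nat then 1 else
          cprod (fun j => 1 + g j / (INR m - INR n + (d j - d j0)))%C k) nu)
  <= exp (ln (2 + 2 * INR nu ^ 2 / 1 ^ 2) / 4 + K).
Proof.
  intros HB Hd.
  destruct (Cmod_group_le k g (fun j => d j - d j0) B) as [K [HK H]]; [lra|].
  exists (3 * PI * ((/ 2 + 2 * K) + / 4)); intros n nu.
  eapply Rle_trans;
    [|apply exp_le, (harmonic_sum_le (/ 2 + 2 * K) (- INR n) 1 nu); lra].
  apply Cmod_cprod_le_exp; intros m _.
  destruct (Nat.eqb_spec m n) as [->|Hmn].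
  - rewrite Cmod_1; apply Rle_trans with (exp 0); [rewrite exp_0; lra|apply exp_le].
    replace (- INR n + INR n) with 0 by ring.
    replace (0 ^ 2 + 1 ^ 2) with 1 by ring; rewrite !Rdiv_1_r; lra.
  - set (q := INR m - INR n).
    assert (Hq : 1 <= Rabs q).
    { unfold q; rewrite !INR_IZR_INZ, <- minus_IZR, <- abs_IZR.
      apply (IZR_le 1); lia. }
    assert (Q1 : 1 <= q ^ 2) by (rewrite <- pow2_abs; nra).
    assert (Hq0 : q <> 0) by (intros E; rewrite E, Rabs_R0 in Hq; lra).
    eapply Rle_trans.
    + rewrite (cprod_ext _ (fun j => 1 + g j / (RtoC q + (d j - d j0)%R))%C).
      2:{ intros j _; unfold q; rewrite !RtoC_minus; reflexivity. }
      apply H; [apply RtoC_neq, Hq0|].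
      intros j Hj; rewrite <- RtoC_plus, !Cmod_R.
      specialize (Hd j Hj).
      assert (IB : 0 < / B) by (apply Rinv_0_lt_compat; lra).
      assert (EB : B * / B = 1) by (apply Rinv_r; lra).
      pose proof (Rabs_triang (q + (d j - d j0)) (- (d j - d j0))) as T.
      rewrite Rabs_Ropp in T; replace (q + (d j - d j0) + - (d j - d j0)) with q in T by ring.
      assert (L : Rabs q * / B <= Rabs (q + (d j - d j0))).
      { assert (Rabs q * (1 - / B) >= 1 - / B); [|nra].
        assert (/ B <= 1) by (rewrite <- Rinv_1; apply Rinv_le_contravar; lra).
        nra. }
      split.
      * apply RtoC_neq; intros E; rewrite E, Rabs_R0 in L.
        assert (0 < Rabs q * / B) by (apply Rmult_lt_0_compat; lra); lra.
      * replace (Rabs q) with (B * (Rabs q * / B)) by (field; lra).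
        apply Rmult_le_compat_l; lra.
    + apply exp_le; rewrite Hg, <- RtoC_inv, re_RtoC, Cmod_R, pow2_abs by exact Hq0.
      replace (- INR n + INR m) with q by (unfold q; ring).
      rewrite pow1; set (i := / (q ^ 2 + 1)).
      assert (I0 : 0 < i) by (apply Rinv_0_lt_compat; lra).
      (* Replacing 1/q by q / (q^2 + 1) brings the sum to the form of [harmonic_sum_le] with t = 1.
         The errors i/2 and K / q^2 <= 2 K i explain the constant / 2 + 2 K. *)
      assert (E1 : / q = q * i + i * / q) by (unfold i; field; split; [exact Hq0|lra]).
      assert (E2 : i * / q <= i).
      { rewrite <- (Rmult_1_r i) at 2; apply Rmult_le_compat_l; [lra|].
        eapply Rle_trans; [apply Rle_abs|]; rewrite Rabs_inv, <- Rinv_1.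
        apply Rinv_le_contravar; lra. }
      assert (E3 : / q ^ 2 <= 2 * i).
      { replace (2 * i) with (/ ((q ^ 2 + 1) / 2)) by (unfold i; field; lra).
        apply Rinv_le_contravar; lra. }
      unfold Rdiv; fold i; nra.
Qed.

End Bounds.

(** * Normalising constants and limits of sums *)

(** What remains of the three Euler products besides factors depending on s: the factorials, the
    powers of p and p - 1 taken out of the linear factors, and one surplus 1/n. *)
Definition kappa (k l n : nat) : R :=
  INR (fact (pred (k * n))) / (INR (fact (pred (l * n))) * INR (fact (pred ((k - l) * n))))
  * (INR l ^ (l * n) * INR (k - l) ^ ((k - l) * n) / (INR k ^ (k * n) * INR n)).

Definition kappa_inf (k l : nat) : R :=
  sqrt (INR l * INR (k - l) / (2 * PI * INR k)).

Lemma ln_fact_pred (m n : nat) : (0 < m)%nat -> (0 < n)%nat ->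
  ln (INR (fact (pred (m * n)))) =
  stirling_log (m * n) + (INR m * INR n - / 2) * (ln (INR m) + ln (INR n)) - INR m * INR n.
Proof.
  intros Hm Hn.
  assert (Pm : 0 < INR m) by (apply lt_0_INR, Hm).
  assert (Pn : 0 < INR n) by (apply lt_0_INR, Hn).
  assert (E : INR (fact (m * n)) = INR m * INR n * INR (fact (pred (m * n)))).
  { rewrite <- !mult_INR; f_equal.
    destruct (m * n)%nat as [|q] eqn:F; [nia|]; reflexivity. }
  unfold stirling_log; rewrite E, mult_INR.
  rewrite !ln_mult by (repeat apply Rmult_lt_0_compat; first [assumption|apply INR_fact_lt_0]).
  field.
Qed.

(** On taking logarithms, k = l + (k - l) cancels all terms growing with n, leaving three values of
    [stirling_log] and the constant [c]. *)
Lemma kappa_lim (k l : nat) : (0 < l)%nat -> (l < k)%nat ->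
  is_lim_seq (fun n => sqrt (INR n) * kappa k l n) (kappa_inf k l).
Proof.
  intros Hl Hk.
  assert (Pl : 0 < INR l) by (apply lt_0_INR, Hl).
  assert (Pk : 0 < INR k) by (apply lt_0_INR; lia).
  assert (Pe : 0 < INR (k - l)) by (apply lt_0_INR; lia).
  assert (Ee : INR (k - l) = INR k - INR l) by (apply minus_INR; lia).
  assert (P1 : 0 < INR l * INR (k - l)) by (apply Rmult_lt_0_compat; assumption).
  assert (P2 : 0 < 2 * PI) by (generalize PI_RGT_0; lra).
  assert (P3 : 0 < 2 * PI * INR k) by (apply Rmult_lt_0_compat; assumption).
  set (c := (ln (INR l) + ln (INR (k - l)) - ln (INR k)) / 2).
  assert (Einf : kappa_inf k l = exp (- (ln (2 * PI) / 2) + c)).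
  { unfold kappa_inf; rewrite <- Rpower_sqrt.
    2:{ apply Rdiv_lt_0_compat; assumption. }
    unfold Rpower; f_equal; unfold c.
    rewrite ln_div, (ln_mult (INR l)), (ln_mult (2 * PI)) by assumption.
    field. }
  rewrite Einf.
  apply (is_lim_seq_ext_loc (fun n => exp
    (stirling_log (k * n) - stirling_log (l * n) - stirling_log ((k - l) * n) + c))).
  - exists 1%nat; intros n Hn.
    assert (Pn : 0 < INR n) by (apply lt_0_INR; lia).
    assert (Pw : forall a m, 0 < INR a -> 0 < INR a ^ m) by (intros; apply pow_lt; assumption).
    assert (Pf : forall m, 0 < INR (fact m)) by (intros; apply INR_fact_lt_0).
    assert (Pkap : 0 < kappa k l n).
    { unfold kappa; apply Rmult_lt_0_compat; apply Rdiv_lt_0_compat;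
        try apply Rmult_lt_0_compat; auto. }
    rewrite <- (exp_ln (sqrt (INR n) * kappa k l n))
      by (apply Rmult_lt_0_compat; [apply sqrt_lt_R0, Pn|exact Pkap]).
    f_equal; rewrite ln_mult by (first [apply sqrt_lt_R0, Pn|exact Pkap]).
    rewrite <- Rpower_sqrt by exact Pn; unfold Rpower; rewrite ln_exp.
    unfold kappa.
    rewrite ln_mult by (apply Rdiv_lt_0_compat; try apply Rmult_lt_0_compat; auto).
    rewrite !ln_div by (try apply Rmult_lt_0_compat; auto).
    rewrite !ln_mult by auto; rewrite !ln_pow by assumption.
    rewrite !ln_fact_pred by lia.
    unfold c; rewrite !mult_INR, Ee; field.
  - assert (H : forall m, (0 < m)%nat ->
              is_lim_seq (fun n => stirling_log (m * n)) (ln (2 * PI) / 2)).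
    { intros m Hm; apply (is_lim_seq_subseq stirling_log _ (fun n => (m * n)%nat)).
      - apply filterlim_mult_eventually, Hm.
      - apply stirling_log_lim. }
    apply (is_lim_seq_continuous exp).
    + apply derivable_continuous_pt, derivable_pt_exp.
    + apply is_lim_seq_plus'; [|apply is_lim_seq_const].
      replace (Finite (- (ln (2 * PI) / 2)))
        with (Finite (ln (2 * PI) / 2 - ln (2 * PI) / 2 - ln (2 * PI) / 2)) by (f_equal; ring).
      repeat apply is_lim_seq_minus'; apply H; lia.
Qed.

(** * Finite sums and dominated convergence *)

Lemma csum_add (f : nat -> C) (n m : nat) :
  csum f (n + m) = (csum f n + csum (fun i => f (n + i)%nat) m)%C.
Proof.
  induction m as [|m IH]; simpl; [rewrite Nat.add_0_r; ring|].
  rewrite Nat.add_succ_r; simpl; rewrite IH; ring.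
Qed.

Lemma csum_split (f : nat -> C) (k n : nat) :
  csum f (k * n) = csum (fun m => csum (fun j => f (k * m + j)%nat) k) n.
Proof.
  induction n as [|n IH]; simpl; [rewrite Nat.mul_0_r; reflexivity|].
  rewrite Nat.mul_succ_r, csum_add, IH; reflexivity.
Qed.

Lemma csum_exchange (f : nat -> nat -> C) (k n : nat) :
  csum (fun m => csum (f m) k) n = csum (fun j => csum (fun m => f m j) n) k.
Proof.
  induction n as [|n IH]; simpl.
  - induction k as [|k IHk]; simpl; [reflexivity|rewrite <- IHk; ring].
  - rewrite IH, csum_plus; reflexivity.
Qed.

Lemma Cmod_csum_geom (f : nat -> C) (K q : R) (n : nat) : 0 <= q < 1 ->
  (forall i, (i < n)%nat -> Cmod (f i) <= K * q ^ i) ->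
  Cmod (csum f n) <= K * (1 - q ^ n) / (1 - q).
Proof.
  intros Hq; induction n as [|n IH]; intros H; simpl.
  - rewrite Cmod_0; unfold Rdiv; lra.
  - eapply Rle_trans; [apply Cmod_triangle|].
    specialize (IH ltac:(intros; apply H; lia)); specialize (H n ltac:(lia)).
    replace (K * (1 - q * q ^ n) / (1 - q))
      with (K * (1 - q ^ n) / (1 - q) + K * q ^ n) by (field; lra).
    lra.
Qed.

Lemma Clim_csum (f : nat -> nat -> C) (g : nat -> C) (k : nat) :
  (forall j, (j < k)%nat -> Clim (fun n => f n j) (g j)) ->
  Clim (fun n => csum (f n) k) (csum g k).
Proof.
  induction k as [|k IH]; intros H; simpl; [apply Clim_const|].
  apply Clim_plus; [apply IH; intros; apply H|apply H]; lia.
Qed.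

(** Dominated convergence when the terms and their number both vary: a cut at N leaves a finite sum
    with termwise limits, a geometric tail, and the tail of [csum g]. *)
Lemma tannery (f : nat -> nat -> C) (g : nat -> C) (S : C) (K q : R) :
  0 <= q < 1 -> 0 <= K ->
  (forall n i, (i < n)%nat -> Cmod (f n i) <= K * q ^ i) ->
  (forall i, Clim (fun n => f n i) (g i)) ->
  Clim (csum g) S -> Clim (fun n => csum (f n) n) S.
Proof.
  intros Hq HK Hf Hg HS; apply is_lim_seq_spec; intros eps.
  assert (E4 : 0 < eps / 4) by (generalize (cond_pos eps); lra).
  assert (G : is_lim_seq (fun n => K / (1 - q) * q ^ n) 0).
  { replace (Finite 0) with (Rbar_mult (K / (1 - q)) 0) by (simpl; f_equal; ring).
    apply is_lim_seq_scal_l, is_lim_seq_geom; rewrite Rabs_pos_eq; lra. }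
  apply is_lim_seq_spec in G; apply is_lim_seq_spec in HS.
  destruct (G (mkposreal _ E4)) as [N1 HN1]; destruct (HS (mkposreal _ E4)) as [N2 HN2].
  set (N := max N1 N2).
  pose proof (Clim_csum f g N (fun j _ => Hg j)) as HC; apply is_lim_seq_spec in HC.
  destruct (HC (mkposreal _ E4)) as [N3 HN3].
  exists (max N3 N); intros n Hn.
  specialize (HN1 N ltac:(lia)); specialize (HN2 N ltac:(lia)); specialize (HN3 n ltac:(lia)).
  simpl in HN1, HN2, HN3.
  rewrite Rminus_0_r, Rabs_pos_eq in HN2, HN3 by apply Cmod_ge_0.
  rewrite Rminus_0_r, Rabs_pos_eq by apply Cmod_ge_0.
  rewrite Rminus_0_r in HN1; apply (Rle_lt_trans _ _ _ (Rle_abs _)) in HN1.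
  destruct (Nat.le_exists_sub N n ltac:(lia)) as [m [Em _]].
  assert (T : Cmod (csum (fun i => f n (N + i)%nat) m) <= K / (1 - q) * q ^ N).
  { eapply Rle_trans.
    - apply (Cmod_csum_geom _ (K * q ^ N) q); [exact Hq|].
      intros i Hi; rewrite Rmult_assoc, <- pow_add; apply Hf; lia.
    - replace (K / (1 - q) * q ^ N) with (K * q ^ N * 1 / (1 - q)) by (field; lra).
      unfold Rdiv; apply Rmult_le_compat_r; [left; apply Rinv_0_lt_compat; lra|].
      apply Rmult_le_compat_l; [apply Rmult_le_pos; [exact HK|apply pow_le; lra]|].
      generalize (pow_le q m ltac:(lra)); lra. }
  replace (csum (f n) n - S)%C
    with ((csum (f n) N - csum g N) + csum (fun i => f n (N + i)%nat) m + (csum g N - S))%C.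
  2:{ rewrite Em at 3; rewrite Nat.add_comm, csum_add; ring. }
  eapply Rle_lt_trans; [apply Cmod_triangle|].
  eapply Rle_lt_trans; [apply Rplus_le_compat_r, Cmod_triangle|].
  lra.
Qed.

Lemma Clim_Cmod_le (u : nat -> C) (l : C) (B : R) :
  Clim u l -> eventually (fun n => Cmod (u n) <= B) -> Cmod l <= B.
Proof.
  intros Hu [N HN]; replace l with (l - 0)%C by ring.
  apply (Cmod_lim_le u); [exact Hu|]; exists N; intros n Hn.
  replace (u n - 0)%C with (u n) by ring; auto.
Qed.

(* When [c = 0] the series of [h] may diverge, but its value is then irrelevant. *)
Lemma tannery_scal (f : nat -> nat -> C) (c : C) (h : nat -> R) (K q : R) :
  0 <= q < 1 -> 0 <= K ->
  (forall n i, (i < n)%nat -> Cmod (f n i) <= K * q ^ i) ->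
  (forall i, Clim (fun n => f n i) (c * h i)) ->
  Clim (fun n => csum (f n) n) (c * Series h).
Proof.
  intros Hq HK Hf Hg; apply (tannery f (fun i => c * h i)%C _ K q); try assumption.
  destruct (Ceq_dec c 0) as [->|Hc].
  - apply (Clim_ext_loc (fun _ => RtoC 0)); [|rewrite Cmult_0_l; apply Clim_const].
    exists O; intros n _; rewrite csum_scal; ring.
  - assert (Pc : 0 < Cmod c) by (apply Cmod_gt_0, Hc).
    assert (B : forall i, Rabs (h i) <= K / Cmod c * q ^ i).
    { intros i; apply Rmult_le_reg_l with (Cmod c); [exact Pc|].
      rewrite <- Cmod_R, <- Cmod_mult.
      replace (Cmod c * (K / Cmod c * q ^ i)) with (K * q ^ i) by (field; lra).
      apply (Clim_Cmod_le (fun n => f n i)); [apply Hg|].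
      exists (S i); intros n Hn; apply Hf; lia. }
    assert (X : ex_series h).
    { apply (ex_series_le h (fun i => K / Cmod c * q ^ i)); [exact B|].
      apply (ex_series_scal_l (K / Cmod c) (fun i => q ^ i)), ex_series_geom; rewrite Rabs_pos_eq; lra. }
    apply (Clim_ext_loc (fun n => c * csum (fun i => RtoC (h i)) n)%C).
    { exists O; intros n _; rewrite csum_scal; reflexivity. }
    apply Clim_mult; [apply Clim_const|].
    assert (E : forall n, csum (fun i => RtoC (h i)) (S n) = RtoC (sum_n h n)).
    { induction n as [|n IH]; [simpl; rewrite sum_O; ring|].
      rewrite sum_Sn; change (csum (fun i => RtoC (h i)) (S (S n)))
        with (csum (fun i => RtoC (h i)) (S n) + h (S n))%C.
      rewrite IH, <- RtoC_plus; reflexivity. }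
    apply is_lim_seq_incr_1.
    apply (is_lim_seq_ext (fun n => Cmod (RtoC (sum_n h n) - Series h))).
    + intros n; rewrite E; reflexivity.
    + apply Clim_RtoC; apply (Series_correct h X).
Qed.

(** * Shifted arguments: Pochhammer symbols and the factor at a pole *)

(** The functional equation iterated n times; it turns the n-th residue of a class into the first
    one times Pochhammer symbols. *)
Lemma rGamma_sub_nat (s : R) (n : nat) :
  rGamma (s - INR n) = ((- (1)) ^ n * pochhammer (1 - s) n * rGamma s)%C.
Proof.
  induction n as [|n IH].
  - simpl INR; simpl pochhammer.
    replace (s - 0)%C with (RtoC s) by ring; simpl; ring.
  - rewrite rGamma_func_eq.
    replace (s - INR (S n) + 1)%C with (s - INR n)%C by (rewrite S_INR, RtoC_plus; ring).
    rewrite IH; simpl pochhammer.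
    rewrite S_INR, !RtoC_mult, !RtoC_plus, RtoC_minus, Cpow_S; ring.
Qed.

Lemma pochhammer_pos (a : R) (n : nat) : 0 < a -> 0 < pochhammer a n.
Proof.
  intros Ha; induction n as [|n IH]; simpl; [lra|].
  apply Rmult_lt_0_compat; [exact IH|generalize (pos_INR n); lra].
Qed.

Lemma cprod_extract (f : nat -> C) (n m : nat) : (n < m)%nat ->
  cprod f m = (f n * cprod (fun i => if (i =? n)%nat then 1 else f i) m)%C.
Proof.
  induction m as [|m IH]; intros H; [lia|]; simpl.
  destruct (Nat.eq_dec n m) as [->|Hn].
  - rewrite Nat.eqb_refl, (cprod_ext (fun i => if (i =? m)%nat then RtoC 1 else f i) f).
    + ring.
    + intros i Hi; replace (i =? m)%nat with false by (symmetry; apply Nat.eqb_neq; lia).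
      reflexivity.
  - rewrite IH by lia.
    replace (m =? n)%nat with false by (symmetry; apply Nat.eqb_neq; lia); ring.
Qed.

(** [rising] at - n with its zero factor replaced by 1, as needed in the class that contains the
    pole itself. *)
Definition punctured (n m : nat) : C :=
  cprod (fun i => if (i =? n)%nat then RtoC 1 else (INR i - INR n)%C) m.

Lemma punctured_eq (n m : nat) :
  punctured n (n + S m) = ((- (1)) ^ n * INR (fact n) * INR (fact m))%C.
Proof.
  induction n as [|n IH].
  - rewrite Nat.add_0_l; unfold punctured; rewrite cprod_shift; simpl Nat.eqb.
    rewrite Cmult_1_l; simpl (_ ^ 0)%C; simpl (fact 0); simpl (INR 1); rewrite !Cmult_1_l.
    induction m as [|m IHm]; [reflexivity|].
    cbn [cprod]; rewrite IHm.
    replace (fact (S m)) with (S m * fact m)%nat by reflexivity.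
    rewrite mult_INR, RtoC_mult; simpl (INR 0); ring.
  - change (S n + S m)%nat with (S (n + S m)); unfold punctured; rewrite cprod_shift.
    rewrite (cprod_ext _ (fun i => if (i =? n)%nat then RtoC 1 else (INR i - INR n)%C)).
    2:{ intros i _; simpl Nat.eqb; destruct (i =? n)%nat; [reflexivity|].
        rewrite !S_INR, !RtoC_plus; ring. }
    fold (punctured n (n + S m)); rewrite IH; simpl Nat.eqb.
    replace (fact (S n)) with (S n * fact n)%nat by reflexivity.
    rewrite mult_INR, RtoC_mult, Cpow_S; simpl (INR 0); ring.
Qed.

(** The limit is the residue of Gamma at - n; the quotient is the Euler product for Gamma deprived
    of its singular factor. *)
Lemma punctured_lim (n : nat) :
  Clim (fun nu => (INR (fact (pred nu)) / (RCpow (INR nu) (INR n) * punctured n nu))%C)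
    ((- (1)) ^ n / INR (fact n)).
Proof.
  assert (U : forall a b : nat, Clim (fun m => RtoC (INR (m + S a) / INR (m + S b))) 1).
  { intros a b; apply Clim_RtoC.
    apply (is_lim_seq_ext (fun m => 1 + (INR a - INR b) * / INR (m + S b))).
    - intros m; rewrite !plus_INR, !S_INR; field.
      generalize (pos_INR m) (pos_INR b); lra.
    - replace (Finite 1) with (Finite (1 + 0)) by (f_equal; ring).
      apply is_lim_seq_plus'; [apply is_lim_seq_const|].
      apply (is_lim_seq_incr_n (fun m => (INR a - INR b) * / INR m) (S b)).
      apply is_lim_seq_const_div. }
  assert (V : Clim (fun m => ((- (1)) ^ n / INR (fact n) *
                 cprod (fun i => RtoC (INR (m + S i) / INR (m + S n))) n)%C)
                ((- (1)) ^ n / INR (fact n))).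
  { rewrite <- (Cmult_1_r ((- (1)) ^ n / INR (fact n))).
    apply Clim_mult; [rewrite Cmult_1_r; apply Clim_const|].
    replace (RtoC 1) with (cprod (fun _ => RtoC 1) n) by (rewrite cprod_const; apply Cpow_1_l).
    apply Clim_cprod; intros i _; apply U. }
  apply (is_lim_seq_incr_n _ (S n)).
  revert V; apply is_lim_seq_ext; intros m; do 2 f_equal.
  replace (m + S n)%nat with (n + S m)%nat by lia.
  rewrite punctured_eq.
  assert (S1 : ((- (1)) ^ n * (- (1)) ^ n = 1)%C).
  { rewrite <- Cpow_mult_l; replace (- (1) * - (1))%C with (RtoC 1) by ring; apply Cpow_1_l. }
  assert (S2 : ((- (1)) ^ n <> 0)%C).
  { apply Cpow_nz, Re_neq_0; unfold Re; simpl; lra. }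
  replace (pred (n + S m)) with (m + n)%nat by lia.
  assert (F : RtoC (INR (fact (m + n))) = (cprod (fun i => RtoC (INR (m + S i))) n * INR (fact m))%C).
  { clear. induction n as [|n IH]; simpl cprod.
    - rewrite Nat.add_0_r; ring.
    - replace (m + S n)%nat with (S (m + n)) at 1 by lia.
      replace (fact (S (m + n))) with (S (m + n) * fact (m + n))%nat by reflexivity.
      rewrite mult_INR, RtoC_mult, IH; replace (S (m + n)) with (m + S n)%nat by lia; ring. }
  rewrite F, RCpow_RtoC, Rpower_pow, RtoC_pow by (apply lt_0_INR; lia).
  assert (NZ : RtoC (INR (n + S m)) <> 0%C) by (apply RtoC_neq, not_0_INR; lia).
  rewrite (cprod_ext _ (fun i => RtoC (INR (m + S i)) / INR (n + S m))%C).
  2:{ intros i _; apply RtoC_div, not_0_INR; lia. }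
  rewrite cprod_div, cprod_const by (intros; exact NZ).
  pose proof (RtoC_fact_nz n); pose proof (RtoC_fact_nz m).
  apply Cpow_nz with (n := n) in NZ.
  set (e := ((- (1)) ^ n)%C) in *; clearbody e.
  assert (S3 : (/ e = e)%C) by (transitivity (/ e * (e * e))%C; [rewrite S1; ring|field; exact S2]).
  rewrite <- S3 at 1; field; auto.
Qed.

(** * The approximants as exponentials times rational functions *)

Lemma rsum_add (f : nat -> R) (n m : nat) :
  rsum f (n + m) = rsum f n + rsum (fun i => f (n + i)%nat) m.
Proof.
  induction m as [|m IH]; simpl; [rewrite Nat.add_0_r; ring|].
  rewrite Nat.add_succ_r; simpl; rewrite IH; ring.
Qed.

Lemma rsum_ext (f g : nat -> R) (n : nat) :
  (forall i, (i < n)%nat -> f i = g i) -> rsum f n = rsum g n.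
Proof.
  induction n as [|n IH]; simpl; intros H; [reflexivity|].
  rewrite IH, H by (intros; try apply H; lia); reflexivity.
Qed.

Lemma rsum_minus (f g : nat -> R) (n : nat) :
  rsum (fun i => f i - g i) n = rsum f n - rsum g n.
Proof. induction n as [|n IH]; simpl; [ring|rewrite IH; ring]. Qed.

Lemma rsum_affine (u v : R) (n : nat) :
  rsum (fun i => u + v * INR i) n = INR n * u + v * (INR n * (INR n - 1) / 2).
Proof.
  induction n as [|n IH]; [simpl; field|].
  cbn [rsum]; rewrite IH, S_INR; field.
Qed.

Section Offsets.

Variables (k l : nat) (r : R).
Hypothesis Hl : (0 < l)%nat.
Hypothesis Hk : (l < k)%nat.

(* The poles of the numerator Gamma factor are the [- (l m + pole_off j)], [j < k]; the zeros
   coming from the two reciprocal Gamma factors are the [- (l m + zero_off j)], [j < k]. *)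
Definition pole_off (j : nat) : R := INR l * (r + INR (S j)) / INR k - 1.

Definition zero_off (j : nat) : R :=
  if (j <? l)%nat then INR j
  else INR l * (r + INR (S (j - l))) / INR (k - l) - 1.

Definition pole_at (i : nat) : R := INR l * INR (i / k) + pole_off (i mod k).
Definition zero_at (i : nat) : R := INR l * INR (i / k) + zero_off (i mod k).

(** In the variable s / l successive blocks differ by 1, and [gap j] is the distance from pole to
    zero. *)
Definition gap (j : nat) : R := (zero_off j - pole_off j) / INR l.

Lemma INR_l_pos : 0 < INR l. Proof. apply lt_0_INR, Hl. Qed.
Lemma INR_k_pos : 0 < INR k. Proof. apply lt_0_INR; lia. Qed.
Lemma INR_kl_pos : 0 < INR (k - l). Proof. apply lt_0_INR; lia. Qed.
Lemma INR_kl : INR (k - l) = INR k - INR l. Proof. apply minus_INR; lia. Qed.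

Lemma divmod_block (m j : nat) : (j < k)%nat ->
  ((k * m + j) / k = m /\ (k * m + j) mod k = j)%nat.
Proof.
  intros Hj; rewrite Nat.mul_comm; split.
  - rewrite Nat.div_add_l, Nat.div_small by lia; lia.
  - rewrite Nat.add_comm, Nat.Div0.mod_add, Nat.mod_small by lia; reflexivity.
Qed.

Lemma pole_at_block (m j : nat) : (j < k)%nat ->
  pole_at (k * m + j) = INR l * INR m + pole_off j.
Proof. intros Hj; unfold pole_at; destruct (divmod_block m j Hj) as [-> ->]; reflexivity. Qed.

Lemma zero_at_block (m j : nat) : (j < k)%nat ->
  zero_at (k * m + j) = INR l * INR m + zero_off j.
Proof. intros Hj; unfold zero_at; destruct (divmod_block m j Hj) as [-> ->]; reflexivity. Qed.

(** The poles form one arithmetic progression of step l / k, which gives injectivity and order; the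
    form with i / k and i mod k serves the splitting into classes. *)
Lemma pole_at_eq (i : nat) : pole_at i = pole_off i.
Proof.
  unfold pole_at, pole_off; pose proof INR_k_pos.
  rewrite (Nat.div_mod_eq i k) at 3; rewrite !S_INR, plus_INR, mult_INR; field; lra.
Qed.

(** Three arithmetic progressions, of lengths k, l and k - l; r and the quadratic terms cancel
    because k = l + (k - l). *)
Lemma gap_sum : rsum gap k = / 2.
Proof.
  pose proof INR_l_pos; pose proof INR_k_pos; pose proof INR_kl_pos; pose proof INR_kl as E.
  rewrite (rsum_ext gap (fun j => zero_off j * / INR l - pole_off j * / INR l))
    by (intros; unfold gap; field; lra).
  rewrite rsum_minus.
  rewrite (rsum_ext (fun j => pole_off j * / INR l)
    (fun j => ((r + 1) / INR k - / INR l) + / INR k * INR j))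
    by (intros; unfold pole_off; rewrite S_INR; field; lra).
  rewrite rsum_affine.
  replace k with (l + (k - l))%nat at 1 by lia; rewrite rsum_add.
  rewrite (rsum_ext (fun j => zero_off j * / INR l) (fun j => 0 + / INR l * INR j)).
  2:{ intros i Hi; unfold zero_off; apply Nat.ltb_lt in Hi; rewrite Hi; ring. }
  rewrite (rsum_ext (fun i => zero_off (l + i) * / INR l)
    (fun j => ((r + 1) / INR (k - l) - / INR l) + / INR (k - l) * INR j)).
  2:{ intros i _; unfold zero_off; replace (l + i <? l)%nat with false
        by (symmetry; apply Nat.ltb_ge; lia).
      replace (l + i - l)%nat with i by lia; rewrite S_INR; field; lra. }
  rewrite !rsum_affine, E; rewrite E in *; field; lra.
Qed.

Let p := INR k / INR l.

Lemma rising_num (s : C) (n : nat) :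
  rising (psi_num p r s) (k * n) =
  (RtoC p ^ (k * n) * cprod (fun i => s + pole_at i)%C (k * n))%C.
Proof.
  pose proof INR_l_pos; pose proof INR_k_pos.
  rewrite <- cprod_const, <- cprod_mult; apply cprod_ext; intros i _.
  rewrite pole_at_eq; unfold psi_num, pole_off, p; rewrite S_INR.
  apply C_ext; unfold Re, Im; simpl; field; lra.
Qed.

(** Each block takes l consecutive factors of the first rising product and k - l of the second, so
    that zeros and poles advance together by l per block. *)
Lemma rising_den (s : C) (n : nat) :
  (rising s (l * n) * rising (psi_den p r s) ((k - l) * n))%C =
  (RtoC (p - 1) ^ ((k - l) * n) * cprod (fun i => s + zero_at i)%C (k * n))%C.
Proof.
  pose proof INR_l_pos; pose proof INR_k_pos; pose proof INR_kl_pos.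
  unfold rising; rewrite !cprod_split, <- cprod_mult, Cpow_mult_r, <- (cprod_const _ n),
    <- cprod_mult.
  apply cprod_ext; intros m _.
  assert (Ek : forall f, cprod f k = (cprod f l * cprod (fun j => f (l + j)%nat) (k - l))%C).
  { intros f; rewrite <- cprod_add; f_equal; lia. }
  rewrite (Ek (fun j => s + zero_at (k * m + j))%C).
  rewrite (cprod_ext (fun j => s + zero_at (k * m + j))%C (fun j => s + INR (l * m + j))%C).
  2:{ intros j Hj; rewrite zero_at_block by lia; unfold zero_off; apply Nat.ltb_lt in Hj.
      rewrite Hj, plus_INR, mult_INR; reflexivity. }
  rewrite (cprod_ext (fun j => psi_den p r s + INR ((k - l) * m + j))%C
    (fun j => RtoC (p - 1) * (s + zero_at (k * m + (l + j))))%C).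
  2:{ intros j Hj; rewrite zero_at_block by lia; unfold zero_off.
      replace (l + j <? l)%nat with false by (symmetry; apply Nat.ltb_ge; lia).
      replace (l + j - l)%nat with j by lia.
      replace (p - 1) with (INR (k - l) / INR l) by (unfold p; rewrite INR_kl; field; lra).
      unfold psi_den; replace (p - 1) with (INR (k - l) / INR l)
        by (unfold p; rewrite INR_kl; field; lra).
      rewrite plus_INR, mult_INR, S_INR.
      apply C_ext; unfold Re, Im; simpl; field; lra. }
  rewrite cprod_mult, cprod_const; ring.
Qed.

Lemma euler_ratio (s : C) (n : nat) : (0 < n)%nat ->
  (forall i, s + pole_at i <> 0)%C ->
  (euler s (l * n) * euler (psi_den p r s) ((k - l) * n) / euler (psi_num p r s) (k * n))%C =
  (RCpow (INR k) (psi_num p r s) / (RCpow (INR l) s * RCpow (INR (k - l)) (psi_den p r s))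
   * kappa k l n * cprod (fun i => (s + zero_at i) / (s + pole_at i))%C (k * n))%C.
Proof.
  intros Hn Hs.
  pose proof INR_l_pos as Pl; pose proof INR_k_pos as Pk; pose proof INR_kl_pos as Pe.
  assert (Pn : 0 < INR n) by (apply lt_0_INR, Hn).
  set (X := psi_num p r s); set (Y := psi_den p r s).
  (* The relation between the three Gamma arguments that cancels the powers of n, up to the single
     factor n kept in [kappa]. *)
  assert (EX : (X + 1 = s + Y)%C).
  { unfold X, Y, psi_num, psi_den; rewrite RtoC_minus; ring. }
  assert (EP : (RCpow (INR n) X * INR n = RCpow (INR n) s * RCpow (INR n) Y)%C).
  { rewrite <- RCpow_plus, <- EX, RCpow_plus, RCpow_RtoC, Rpower_1 by exact Pn; reflexivity. }
  set (Q := cprod (fun i => s + pole_at i)%C (k * n)).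
  assert (HQ : Q <> 0%C) by (apply cprod_nz; auto).
  rewrite cprod_div by auto; fold Q.
  set (Z := cprod (fun i => s + zero_at i)%C (k * n)).
  pose proof (rising_num s n) as RX; fold X Q in RX.
  pose proof (rising_den s n) as RY; fold Y Z in RY.
  unfold euler; rewrite RX, !mult_INR, !RCpow_mult_base by assumption.
  assert (RE : (rising Y ((k - l) * n) * rising s (l * n) = RtoC (p - 1) ^ ((k - l) * n) * Z)%C)
    by (rewrite <- RY; ring).
  unfold kappa.
  set (fk := fact (pred (k * n))); set (fl := fact (pred (l * n)));
    set (fe := fact (pred ((k - l) * n))).
  assert (NL : RtoC (INR l) <> 0%C) by (apply RtoC_neq; lra).
  assert (NK : RtoC (INR k) <> 0%C) by (apply RtoC_neq; lra).
  assert (NE : RtoC (INR (k - l)) <> 0%C) by (apply RtoC_neq; lra).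
  assert (NN : RtoC (INR n) <> 0%C) by (apply RtoC_neq; lra).
  assert (Fk : RtoC (INR fk) <> 0%C) by apply RtoC_fact_nz.
  assert (Fl : RtoC (INR fl) <> 0%C) by apply RtoC_fact_nz.
  assert (Fe : RtoC (INR fe) <> 0%C) by apply RtoC_fact_nz.
  assert (EK : (RtoC (INR fk / (INR fl * INR fe)
      * (INR l ^ (l * n) * INR (k - l) ^ ((k - l) * n) / (INR k ^ (k * n) * INR n))) =
     INR fk / (INR fl * INR fe) * (INR l ^ (l * n) * INR (k - l) ^ ((k - l) * n)
       / (INR k ^ (k * n) * INR n)))%C).
  { assert (INR fl <> 0) by apply INR_fact_neq_0; assert (INR fe <> 0) by apply INR_fact_neq_0.
    assert (INR k ^ (k * n) <> 0) by (apply pow_nonzero; lra).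
    rewrite RtoC_mult, !RtoC_div, !RtoC_mult, !RtoC_pow
      by (apply Rmult_integral_contrapositive_currified; first [assumption|lra]).
    reflexivity. }
  rewrite EK.
  assert (Ep : RtoC p = (INR k / INR l)%C) by (unfold p; apply RtoC_div; lra).
  assert (Ep1 : RtoC (p - 1) = (INR (k - l) / INR l)%C).
  { rewrite <- RtoC_div by lra; f_equal; unfold p; rewrite INR_kl; field; lra. }
  assert (Hdiv : forall (a b : C) m, b <> 0%C -> ((a / b) ^ m = a ^ m / b ^ m)%C).
  { intros a b m Hb; unfold Cdiv; rewrite Cpow_mult_l, Cpow_inv by exact Hb; reflexivity. }
  rewrite Ep, Hdiv by exact NL; rewrite Ep1, Hdiv in RE by exact NL.
  assert (EL : (INR l ^ (k * n) = INR l ^ (l * n) * INR l ^ ((k - l) * n))%C).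
  { rewrite <- Cpow_add_r; f_equal; nia. }
  rewrite EL.
  pose proof (Cpow_nz _ (l * n) NL); pose proof (Cpow_nz _ ((k - l) * n) NL).
  pose proof (Cpow_nz _ (k * n) NK).
  pose proof (RCpow_nz (INR n) s); pose proof (RCpow_nz (INR n) Y);
    pose proof (RCpow_nz (INR n) X); pose proof (RCpow_nz (INR l) s);
    pose proof (RCpow_nz (INR k) X); pose proof (RCpow_nz (INR (k - l)) Y).
  assert (RS : (rising s (l * n) * rising Y ((k - l) * n) =
     INR (k - l) ^ ((k - l) * n) / INR l ^ ((k - l) * n) * Z)%C)
    by (rewrite <- RE; ring).
  match goal with |- ?L = _ => transitivity
    ((rising s (l * n) * rising Y ((k - l) * n)) * INR fk * RCpow (INR k) X
     * (INR l ^ (l * n) * INR l ^ ((k - l) * n)) * (RCpow (INR n) X * INR n)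
     / (INR fl * INR fe * RCpow (INR l) s * RCpow (INR (k - l)) Y
        * (RCpow (INR n) s * RCpow (INR n) Y) * INR k ^ (k * n) * Q * INR n))%C end.
  { field; repeat split; assumption. }
  rewrite RS, EP; field; repeat split; assumption.
Qed.

Lemma ln_c_const :
  ln (c_const p) =
  p * ln (INR k) - ln (INR l) - (p - 1) * ln (INR (k - l)).
Proof.
  pose proof INR_l_pos as Pl; pose proof INR_k_pos as Pk; pose proof INR_kl_pos as Pe.
  unfold c_const; rewrite ln_mult by apply exp_pos.
  unfold Rpower; rewrite !ln_exp.
  replace (p - 1) with (INR (k - l) / INR l) by (unfold p; rewrite INR_kl; field; lra).
  replace (1 - p) with (- (INR (k - l) / INR l)) by (unfold p; rewrite INR_kl; field; lra).
  unfold p; rewrite !ln_div by assumption; rewrite INR_kl; field; lra.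
Qed.

(** The part independent of s of the powers of k, l and k - l; the rest combines with x^(-s) into
    exp (mu s). *)
Definition scale : R :=
  Rpower (INR k) (r + 1 - p) * Rpower (INR (k - l)) (p - r - 2).

Lemma RCpow_scale (x : R) (s : C) :
  (RCpow x (- s) * (RCpow (INR k) (psi_num p r s)
    / (RCpow (INR l) s * RCpow (INR (k - l)) (psi_den p r s))))%C =
  (scale * Cexp ((ln (c_const p) - ln x)%R * s))%C.
Proof.
  unfold scale; rewrite RtoC_mult, <- !RCpow_RtoC.
  assert (Ed : forall a b c : C, b <> 0%C -> c <> 0%C ->
            (a / (b * c) = a * (/ b * / c))%C) by (intros; field; auto).
  rewrite Ed by apply RCpow_nz.
  rewrite <- !RCpow_opp; unfold RCpow; rewrite <- !Cexp_plus; f_equal.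
  rewrite ln_c_const; unfold psi_num, psi_den.
  apply C_ext; unfold Re, Im; simpl; ring.
Qed.

Lemma scale_gamma_coef : scale * INR l * kappa_inf k l = gamma_coef k l r.
Proof.
  pose proof INR_l_pos as Pl; pose proof INR_k_pos as Pk; pose proof INR_kl_pos as Pe.
  assert (P2 : 0 < 2 * PI) by (generalize PI_RGT_0; lra).
  unfold gamma_coef; fold p; rewrite <- INR_kl.
  assert (Pp : 0 < p) by (apply Rdiv_lt_0_compat; assumption).
  assert (Ep : p - 1 = INR (k - l) / INR l) by (unfold p; rewrite INR_kl; field; lra).
  rewrite Ep.
  unfold scale, kappa_inf; rewrite <- !Rpower_sqrt.
  2: apply Rmult_lt_0_compat; assumption.
  2: apply Rdiv_lt_0_compat; apply Rmult_lt_0_compat; assumption.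
  unfold Rpower.
  rewrite (ln_div (INR l * INR (k - l)))  by (apply Rmult_lt_0_compat; assumption).
  rewrite (ln_mult (INR l)), (ln_mult (2 * PI) (INR k)), (ln_mult (2 * PI) (INR (k - l)))
    by assumption.
  rewrite (ln_div (INR (k - l))) by assumption.
  replace (ln p) with (ln (INR k) - ln (INR l)) by (unfold p; rewrite ln_div by assumption; ring).
  match goal with |- exp ?a * exp ?b * ?c * exp ?d = ?c * exp ?e / (exp ?f * exp ?g) =>
    transitivity (c * exp (a + b + d)); [rewrite !exp_plus; ring|];
    transitivity (c * exp (e + - f + - g));
      [|rewrite !exp_plus, !exp_Ropp; field; split; apply Rgt_not_eq, exp_pos] end.
  do 2 f_equal; unfold p; field; lra.
Qed.

End Offsets.

(** * Contour estimate and bounds for the residues *)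

Lemma Cmod_csum_le (f : nat -> C) (n : nat) :
  Cmod (csum f n) <= rsum (fun i => Cmod (f i)) n.
Proof.
  induction n as [|n IH]; simpl; [rewrite Cmod_0; lra|].
  eapply Rle_trans; [apply Cmod_triangle|]; lra.
Qed.

Lemma rsum_le (f g : nat -> R) (n : nat) :
  (forall i, (i < n)%nat -> f i <= g i) -> rsum f n <= rsum g n.
Proof.
  induction n as [|n IH]; simpl; intros H; [lra|].
  specialize (IH ltac:(intros; apply H; lia)); specialize (H n ltac:(lia)); lra.
Qed.

Section Residues.

Variables (k l : nat) (r : R).
Hypothesis Hl : (0 < l)%nat.
Hypothesis Hk : (l < k)%nat.

Let a (i : nat) : C := RtoC (pole_at k l r i).
Let b (i : nat) : C := RtoC (zero_at k l r i).
Let Pl : 0 < INR l := INR_l_pos l Hl.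
Let Pk : 0 < INR k := INR_k_pos k l Hl Hk.

Lemma pole_lt (i j : nat) : (i < j)%nat -> pole_off k l r i < pole_off k l r j.
Proof.
  intros H; unfold pole_off; apply Rplus_lt_compat_r.
  apply Rmult_lt_compat_r; [apply Rinv_0_lt_compat, Pk|].
  apply Rmult_lt_compat_l; [exact Pl|].
  apply Rplus_lt_compat_l, lt_INR; lia.
Qed.

Lemma pole_at_inj (i j : nat) : a i = a j -> i = j.
Proof.
  unfold a; rewrite !pole_at_eq by assumption; intros E; apply RtoC_inj in E.
  destruct (Nat.lt_total i j) as [H|[H|H]]; [|exact H|];
    apply pole_lt in H; lra.
Qed.

Lemma pole_at_range (i n : nat) : (i < n)%nat ->
  pole_off k l r 0 <= pole_at k l r i < pole_off k l r n.
Proof.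
  intros H; rewrite pole_at_eq by assumption; split; [|apply pole_lt, H].
  destruct i as [|i]; [lra|left; apply pole_lt; lia].
Qed.

Lemma ratio_groups (s : C) (n : nat) :
  (forall i, (i < k * n)%nat -> s + a i <> 0)%C ->
  cprod (fun i => (s + b i) / (s + a i))%C (k * n) =
  cprod (fun m => cprod (fun j => 1 + gap k l r j /
    (((Re s / INR l)%R, (Im s / INR l)%R) + INR m + (pole_off k l r j / INR l)%R))%C k) n.
Proof.
  intros H; rewrite cprod_split; apply cprod_ext; intros m Hm.
  apply cprod_ext; intros j Hj.
  specialize (H (k * m + j)%nat ltac:(nia)); revert H; unfold a, b.
  rewrite pole_at_block, zero_at_block by assumption.
  assert (NL : RtoC (INR l) <> 0%C) by (apply RtoC_neq; lra).
  replace (Re s / INR l, Im s / INR l) with (s / INR l)%C.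
  2:{ rewrite <- (Cmult_1_r s); unfold Cdiv; rewrite <- RtoC_inv by lra.
      apply C_ext; unfold Re, Im; simpl; field; lra. }
  unfold gap; rewrite !RtoC_div, RtoC_minus, !RtoC_plus, RtoC_mult by lra.
  intros H; field; repeat split; try exact NL; intros E; apply H; rewrite <- E; ring.
Qed.

Lemma ratio_horizontal_le : exists K, forall (s : C) (n : nat), INR l <= Rabs (Im s) ->
  Cmod (cprod (fun i => (s + b i) / (s + a i))%C (k * n))
  <= exp (ln (2 + 2 * INR n ^ 2 / (Im s / INR l) ^ 2) / 4 + K).
Proof.
  destruct (horizontal_le k (gap k l r) (fun j => pole_off k l r j / INR l)
    (gap_sum k l r Hl Hk)) as [K HK].
  exists K; intros s n Hs.
  rewrite ratio_groups.
  - apply HK; rewrite <- pow2_abs; unfold Rdiv; rewrite Rabs_mult, Rabs_inv.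
    rewrite (Rabs_pos_eq (INR l)) by lra.
    replace 1 with (1 ^ 2) by ring; apply pow_incr; split; [lra|].
    apply Rmult_le_reg_r with (INR l); [exact Pl|].
    rewrite Rmult_assoc, Rinv_l by lra; lra.
  - intros i _ E; apply (f_equal Im) in E; unfold Im in *; simpl in E.
    rewrite Rplus_0_r in E; rewrite E, Rabs_R0 in Hs; lra.
Qed.

(** The residue theorem on [-x, d] x [-T, T] with x -> oo: the left side vanishes, and each
    horizontal side is at most its uniform bound times the integral of exp (mu y) up to d. *)
Lemma contour_estimate : exists K, forall (n : nat) (d mu T : R) (v : C),
  0 < mu -> - pole_off k l r 0 < d -> INR l <= T ->
  cint (fun t => Cexp (mu * (d, t)) *
          cprod (fun i => ((d, t) + b i) / ((d, t) + a i)) (k * n) * Ci)%C (- T) T v ->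
  Cmod (v - 2 * PI * Ci *
    csum (fun i => residue a b (k * n) i * Cexp (- (mu * a i)))%C (k * n))
  <= 2 * (exp (ln (2 + 2 * INR n ^ 2 / (T / INR l) ^ 2) / 4 + K) * (exp (mu * d) / mu)).
Proof.
  destruct ratio_horizontal_le as [K HK]; exists K.
  intros n d mu T v Hmu Hd HT Hv.
  set (N := (k * n)%nat) in *; set (M := exp (ln (2 + 2 * INR n ^ 2 / (T / INR l) ^ 2) / 4 + K)).
  set (W := rsum (fun i => Cmod (residue a b N i)) N).
  assert (W0 : 0 <= W) by (apply rsum_nonneg; intros; apply Cmod_ge_0).
  apply le_epsilon; intros eps Heps.
  (* Three demands: the left side keeps distance 1 from all N poles, lies to the left of d, and
     contributes at most eps by exp (mu x) >= 1 + mu x. There the quotient is at most 1 + W by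
     partial fractions. *)
  set (x := Rmax (pole_off k l r N + 1) (Rmax (1 - d) (2 * T * (1 + W) / (mu * eps) + 1))).
  assert (X1 : pole_off k l r N + 1 <= x) by apply Rmax_l.
  assert (X2 : 1 - d <= x) by (eapply Rle_trans; [|apply Rmax_r]; apply Rmax_l).
  assert (X3 : 2 * T * (1 + W) / (mu * eps) + 1 <= x)
    by (eapply Rle_trans; [|apply Rmax_r]; apply Rmax_r).
  assert (X0 : 0 < 2 * T * (1 + W) / (mu * eps)).
  { apply Rdiv_lt_0_compat; repeat apply Rmult_lt_0_compat; lra. }
  set (F := fun s => (Cexp (mu * s) * cprod (fun i => (s + b i) / (s + a i)) N)%C).
  assert (HF : is_contour F (- x) d T
     (2 * PI * Ci * csum (fun i => residue a b N i * Cexp (- (mu * a i)))%C N)%C).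
  { assert (Hr : forall i, (i < N)%nat -> - x < - pole_at k l r i < d).
    { intros i Hi; pose proof (pole_at_range i N Hi); lra. }
    apply (is_contour_ext (- x) d T ltac:(lra) ltac:(lra)
      (fun s => Cexp (mu * s) + csum (fun i => (residue a b N i * Cexp (- (mu * a i)))
                 * (Cexp (mu * (s + a i)) / (s + a i))) N)%C).
    - intros s Hs; unfold F; rewrite (partial_fractions a b N).
      + rewrite Cmult_plus_distr_l, Cmult_1_r; f_equal.
        rewrite <- csum_scal; apply csum_ext; intros i Hi.
        replace (mu * (s + a i))%C with (mu * s + mu * a i)%C by ring.
        rewrite Cexp_plus, Cexp_opp; field.
        split; [|apply Cexp_nz].
        apply (on_rect_nz (- x) d T); [lra|apply Hr, Hi|exact Hs].
      + intros i j _ _; apply pole_at_inj.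
      + intros i Hi; apply (on_rect_nz (- x) d T); [lra|apply Hr, Hi|exact Hs].
    - replace (2 * PI * Ci * csum (fun i => residue a b N i * Cexp (- (mu * a i))) N)%C
        with (0 + csum (fun i => residue a b N i * Cexp (- (mu * a i)) * (2 * PI * Ci)) N)%C.
      2:{ rewrite Cplus_0_l, <- csum_scal; apply csum_ext; intros; ring. }
      apply is_contour_plus; [lra|apply is_contour_Cexp; lra|].
      apply (is_contour_csum (- x) d T ltac:(lra) ltac:(lra)
        (fun i s => residue a b N i * Cexp (- (mu * a i)) * (Cexp (mu * (s + a i)) / (s + a i)))%C).
      intros i Hi; apply is_contour_scal; [lra|].
      apply is_contour_kernel; [lra|lra|apply Hr, Hi]. }
  destruct HF as [r' [l' [u [w [Hr' [Hl' [Hu [Hw E]]]]]]]].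
  rewrite (cint_unique _ _ _ _ _ Hv Hr'), E.
  replace (r' - (r' - l' - u + w))%C with (l' + u - w)%C by ring.
  assert (BI : is_RInt (fun y => M * exp (mu * y)) (- x) d
                 (M * (exp (mu * d) / mu) - M * (exp (mu * - x) / mu))).
  { apply (is_RInt_derive (fun y => M * (exp (mu * y) / mu))).
    - intros y _; auto_derive; [trivial|field; lra].
    - intros y _; apply (ex_derive_continuous (fun y => M * exp (mu * y))).
      auto_derive; trivial. }
  assert (M0 : 0 < M) by apply exp_pos.
  assert (BI' : M * (exp (mu * d) / mu) - M * (exp (mu * - x) / mu) <= M * (exp (mu * d) / mu)).
  { assert (0 < M * (exp (mu * - x) / mu)); [|lra].
    apply Rmult_lt_0_compat; [exact M0|apply Rdiv_lt_0_compat; [apply exp_pos|exact Hmu]]. }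
  assert (FH : forall y t, Rabs t = T -> Cmod (F (y, t)) <= M * exp (mu * y)).
  { intros y t Ht; unfold F; rewrite Cmod_mult, Cmod_Cexp, Rmult_comm.
    replace (Re (mu * (y, t))) with (mu * y) by (unfold Re; simpl; ring).
    apply Rmult_le_compat_r; [left; apply exp_pos|].
    eapply Rle_trans; [apply HK; simpl; lra|].
    unfold M; simpl Im; right; do 5 f_equal.
    unfold Rdiv; rewrite !Rpow_mult_distr, <- (pow2_abs t), Ht; reflexivity. }
  assert (Bu : Cmod u <= M * (exp (mu * d) / mu)).
  { eapply Rle_trans; [|exact BI'].
    apply (cint_le (fun y => F (y, T)) (fun y => M * exp (mu * y)) (- x) d);
      [lra| |exact Hu|exact BI].
    intros y _; apply FH, Rabs_pos_eq; lra. }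
  assert (Bw : Cmod w <= M * (exp (mu * d) / mu)).
  { eapply Rle_trans; [|exact BI'].
    apply (cint_le (fun y => F (y, - T)) (fun y => M * exp (mu * y)) (- x) d);
      [lra| |exact Hw|exact BI].
    intros y _; apply FH; rewrite Rabs_Ropp; apply Rabs_pos_eq; lra. }
  assert (Bl : Cmod l' <= eps).
  { eapply Rle_trans.
    - apply (cint_le_const (fun t => F ((- x)%R, t) * Ci)%C (exp (- (mu * x)) * (1 + W)) (- T) T);
        [lra| |exact Hl'].
      intros t _; unfold F; rewrite !Cmod_mult, Cmod_Ci, Rmult_1_r, Cmod_Cexp.
      replace (Re (mu * (- x, t))) with (- (mu * x)) by (unfold Re; simpl; ring).
      apply Rmult_le_compat_l; [left; apply exp_pos|].
      assert (Far : forall i, (i < N)%nat -> 1 <= Cmod (((- x)%R, t) + a i)).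
      { intros i Hi; eapply Rle_trans; [|apply re_le_Cmod].
        pose proof (pole_at_range i N Hi).
        change (1 <= Rabs (- x + pole_at k l r i)); rewrite Rabs_left; lra. }
      assert (NZ : forall i, (i < N)%nat -> (((- x)%R, t) + a i <> 0)%C).
      { intros i Hi; apply Cmod_gt_0; specialize (Far i Hi); lra. }
      rewrite (partial_fractions a b N); [|intros i j _ _; apply pole_at_inj|exact NZ].
      eapply Rle_trans; [apply Cmod_triangle|]; rewrite Cmod_1; apply Rplus_le_compat_l.
      eapply Rle_trans; [apply Cmod_csum_le|]; apply rsum_le; intros i Hi.
      rewrite Cmod_div by auto.
      rewrite <- (Rmult_1_r (Cmod (residue a b N i))) at 2; unfold Rdiv.
      apply Rmult_le_compat_l; [apply Cmod_ge_0|].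
      rewrite <- Rinv_1; apply Rinv_le_contravar; [lra|auto].
    - replace (T - - T) with (2 * T) by ring.
      rewrite exp_Ropp; pose proof (exp_ineq1_le (mu * x)) as EX.
      apply Rmult_le_reg_r with (exp (mu * x)); [apply exp_pos|].
      replace (2 * T * (/ exp (mu * x) * (1 + W)) * exp (mu * x)) with (2 * T * (1 + W))
        by (field; apply Rgt_not_eq, exp_pos).
      apply Rle_trans with (eps * (mu * x)).
      + replace (2 * T * (1 + W)) with (2 * T * (1 + W) / (mu * eps) * (mu * eps)) by (field; lra).
        replace (eps * (mu * x)) with (x * (mu * eps)) by ring.
        apply Rmult_le_compat_r; [apply Rmult_le_pos; lra|lra].
      + apply Rmult_le_compat_l; lra. }
  eapply Rle_trans; [apply Cmod_sub_le|].
  eapply Rle_trans; [apply Rplus_le_compat_r, Cmod_triangle|].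
  lra.
Qed.

Lemma residue_blocks (nu n j0 : nat) : (j0 < k)%nat ->
  residue a b (k * nu) (k * n + j0) =
  cprod (fun m => cprod (fun j =>
    (INR l * (INR m - INR n) + (zero_off k l r j - pole_off k l r j0)%R) /
    (if ((m =? n) && (j =? j0))%nat%bool then RtoC 1
     else INR l * (INR m - INR n) + (pole_off k l r j - pole_off k l r j0)%R))%C k) nu.
Proof.
  intros Hj0; unfold residue; rewrite cprod_split; apply cprod_ext; intros m _.
  apply cprod_ext; intros j Hj; unfold a, b.
  rewrite !pole_at_block, zero_at_block by assumption.
  rewrite !RtoC_minus, !RtoC_plus, !RtoC_mult.
  f_equal; [ring|].
  replace (k * m + j =? k * n + j0)%nat with ((m =? n) && (j =? j0))%nat%bool.
  - destruct ((m =? n)%nat && (j =? j0)%nat)%bool; [reflexivity|ring].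
  - destruct (Nat.eqb_spec m n) as [->|Hm]; simpl.
    + destruct (Nat.eqb_spec j j0) as [->|Hj']; symmetry;
        [apply Nat.eqb_refl|apply Nat.eqb_neq; lia].
    + symmetry; apply Nat.eqb_neq; intros E; apply Hm.
      rewrite <- (proj1 (divmod_block k l Hl Hk m j Hj)), E; apply (divmod_block k l Hl Hk), Hj0.
Qed.

Lemma pole_diff (j j0 : nat) :
  pole_off k l r j - pole_off k l r j0 = INR l * ((INR j - INR j0) / INR k).
Proof. unfold pole_off; rewrite !S_INR; field; lra. Qed.

(** Multiplied by k, the expression is the difference of the indices k m + j and k n + j0. *)
Lemma pole_diff_nz (m n j j0 : nat) : (j < k)%nat -> (j0 < k)%nat ->
  (m <> n \/ j <> j0) ->
  INR m - INR n + (INR j - INR j0) / INR k <> 0.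
Proof.
  intros Hj Hj0 H E.
  assert (Q : INR (k * m + j) = INR (k * n + j0)).
  { rewrite !plus_INR, !mult_INR.
    apply (Rmult_eq_compat_l (INR k)) in E.
    replace (INR k * (INR m - INR n + (INR j - INR j0) / INR k))
      with (INR k * (INR m - INR n) + (INR j - INR j0)) in E by (field; lra).
    lra. }
  apply INR_eq in Q.
  destruct (divmod_block k l Hl Hk m j Hj) as [E1 E2]; destruct (divmod_block k l Hl Hk n j0 Hj0) as [E3 E4].
  rewrite Q in E1, E2; rewrite E1 in E3; rewrite E2 in E4; lia.
Qed.

(** Uniform in the pole index n, which is the domination needed later; the growth sqrt nu is
    compensated by [kappa]. The constant B of [residue_product_le] is k, since |j - j0| / k <= 1 -
    1/k. *)
Lemma residue_le (j0 : nat) : (j0 < k)%nat -> exists K, 0 <= K /\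
  forall n nu, (n < nu)%nat ->
  Cmod (residue a b (k * nu) (k * n + j0)) <= K * sqrt (INR nu).
Proof.
  intros Hj0.
  set (dd := fun j => pole_off k l r j / INR l).
  destruct (residue_product_le k (gap k l r) dd (gap_sum k l r Hl Hk) j0 (INR k))
    as [K HK].
  { apply (le_INR 1); lia. }
  { intros j Hj; unfold dd.
    replace (pole_off k l r j / INR l - pole_off k l r j0 / INR l)
      with ((INR j - INR j0) * / INR k)
      by (transitivity ((pole_off k l r j - pole_off k l r j0) / INR l);
          [rewrite pole_diff; field; lra|field; lra]).
    rewrite Rabs_mult, Rabs_inv, (Rabs_pos_eq (INR k)) by lra.
    apply Rmult_le_reg_r with (INR k); [exact Pk|].
    rewrite Rmult_assoc, Rinv_l, Rmult_1_r, Rmult_minus_distr_r, Rinv_l by lra.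
    assert (INR j <= INR k - 1 /\ INR j0 <= INR k - 1) as [B1 B2].
    { pose proof (le_INR _ _ Hj) as Q; pose proof (le_INR _ _ Hj0) as Q0.
      rewrite S_INR in Q, Q0; lra. }
    generalize (pos_INR j) (pos_INR j0); intros; apply Rabs_le; lra. }
  (* The block m = n, which is the same for all n. *)
  set (G := cprod (fun j => (zero_off k l r j - pole_off k l r j0)%R /
    (if (j =? j0)%nat then RtoC 1 else (pole_off k l r j - pole_off k l r j0)%R))%C k).
  exists (Cmod G * (2 * exp K)); split.
  { apply Rmult_le_pos; [apply Cmod_ge_0|generalize (exp_pos K); lra]. }
  intros n nu Hn; rewrite residue_blocks by exact Hj0.
  rewrite (cprod_extract _ n nu Hn), Cmod_mult, Rmult_assoc; apply Rmult_le_compat;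
    try apply Cmod_ge_0.
  - right; f_equal; apply cprod_ext; intros j Hj; rewrite Nat.eqb_refl; simpl.
    replace (INR l * (INR n - INR n))%C with (RtoC 0) by ring.
    destruct (j =? j0)%nat; rewrite !Cplus_0_l; reflexivity.
  - eapply Rle_trans.
    + rewrite (cprod_ext _ (fun m => if (m =? n)%nat then RtoC 1 else
        cprod (fun j => 1 + gap k l r j / (INR m - INR n + (dd j - dd j0)))%C k)).
      * apply HK.
      * intros m Hm; destruct (Nat.eqb_spec m n) as [_|Hmn]; [reflexivity|simpl].
        apply cprod_ext; intros j Hj.
        assert (NZ := pole_diff_nz m n j j0 Hj Hj0 (or_introl Hmn)).
        replace (dd j - dd j0)%C with (RtoC ((INR j - INR j0) / INR k)).
        2:{ rewrite <- RtoC_minus; f_equal; unfold dd.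
            transitivity ((pole_off k l r j - pole_off k l r j0) / INR l);
              [rewrite pole_diff; field; lra|field; lra]. }
        rewrite pole_diff.
        replace (zero_off k l r j - pole_off k l r j0)
          with (INR l * (gap k l r j + (INR j - INR j0) / INR k)).
        2:{ transitivity ((zero_off k l r j - pole_off k l r j) + (pole_off k l r j - pole_off k l r j0));
              [rewrite pole_diff; unfold gap; field; lra|ring]. }
        rewrite !RtoC_mult, (RtoC_plus (gap k l r j)).
        set (e := (INR j - INR j0) / INR k) in *.
        assert (NZ' : (INR m - INR n + e <> 0)%C).
        { rewrite <- RtoC_minus, <- RtoC_plus; apply RtoC_neq, NZ. }
        assert (NL : RtoC (INR l) <> 0%C) by (apply RtoC_neq; lra).
        field; split; [exact NZ'|].
        intros E; apply (Cmult_neq_0 _ _ NL NZ'); rewrite <- E; ring.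
    + rewrite exp_plus, pow1, Rdiv_1_r.
      assert (P : 1 <= INR nu) by (apply (le_INR 1); lia).
      replace (2 * exp K * sqrt (INR nu)) with (2 * sqrt (INR nu) * exp K) by ring.
      apply Rmult_le_compat_r; [left; apply exp_pos|].
      assert (L : ln (2 + 2 * INR nu ^ 2) / 4 <= ln (2 * sqrt (INR nu))).
      { apply Rle_trans with (ln ((2 * sqrt (INR nu)) ^ 4) / 4).
        - apply Rmult_le_compat_r; [lra|]; apply ln_le; [nra|].
          replace ((2 * sqrt (INR nu)) ^ 4) with (16 * (sqrt (INR nu) * sqrt (INR nu)) ^ 2) by ring.
          rewrite sqrt_sqrt by lra; nra.
        - rewrite ln_pow by (apply Rmult_lt_0_compat; [lra|apply sqrt_lt_R0; lra]).
          right; simpl; field. }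
      eapply Rle_trans; [apply exp_le, L|].
      rewrite exp_ln by (apply Rmult_lt_0_compat; [lra|apply sqrt_lt_R0; lra]); lra.
Qed.

End Residues.

(** * Limits of the residues *)

Lemma cprod_delta (c : C) (n m : nat) : (n < m)%nat ->
  cprod (fun i => if (i =? n)%nat then c else RtoC 1) m = c.
Proof.
  intros H; rewrite (cprod_extract _ n m H), Nat.eqb_refl.
  rewrite (cprod_ext _ (fun _ => RtoC 1)), cprod_const, Cpow_1_l; [ring|].
  intros i _; destruct (i =? n)%nat; reflexivity.
Qed.

Lemma rising_euler (s : C) (m : nat) :
  rising s m = (euler s m * (INR (fact (pred m)) * RCpow (INR m) s))%C.
Proof. unfold euler; field; split; [apply RCpow_nz|apply RtoC_fact_nz]. Qed.

Lemma RCpow_cprod (x : R) (g : nat -> R) (n : nat) :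
  cprod (fun j => RCpow x (RtoC (g j))) n = RCpow x (RtoC (rsum g n)).
Proof.
  induction n as [|n IH]; simpl.
  - unfold RCpow; rewrite Cmult_0_l, Cexp_0; reflexivity.
  - rewrite IH, RtoC_plus, RCpow_plus; reflexivity.
Qed.

Section Coefficients.

Variables (k l : nat) (r : R) (j0 : nat).
Hypothesis Hl : (0 < l)%nat.
Hypothesis Hk : (l < k)%nat.
Hypothesis Hj0 : (j0 < k)%nat.

Let a (i : nat) : C := RtoC (pole_at k l r i).
Let b (i : nat) : C := RtoC (zero_at k l r i).
Let Pl : 0 < INR l := INR_l_pos l Hl.
Let Pk : 0 < INR k := INR_k_pos k l Hl Hk.

(** With h = j0 + 1, the arguments of the Gamma factors in the denominator of c(h, k, l, r);
    [num_arg] gives those in its numerator. *)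
Definition den_arg (j : nat) : R := (zero_off k l r j - pole_off k l r j0) / INR l.
Definition num_arg (j : nat) : R := (INR j - INR j0) / INR k.

Lemma den_num_gap (j : nat) : den_arg j = num_arg j + gap k l r j.
Proof.
  unfold den_arg, num_arg, gap.
  transitivity ((pole_off k l r j - pole_off k l r j0) / INR l
                + (zero_off k l r j - pole_off k l r j) / INR l).
  - field; lra.
  - rewrite pole_diff by assumption; field; lra.
Qed.

Lemma num_arg_nz (j m n : nat) : (j < k)%nat -> j <> j0 ->
  (num_arg j - INR n + INR m <> 0)%C.
Proof.
  intros Hj Hne; rewrite <- RtoC_minus, <- RtoC_plus; apply RtoC_neq.
  pose proof (pole_diff_nz k l Hl Hk m n j j0 Hj Hj0 (or_intror Hne)).
  unfold num_arg; lra.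
Qed.

(** For fixed j the factors over all blocks m form a quotient of rising products at arguments
    shifted by - n. In the column j0 the omitted denominator at m = n leaves one factor l
    uncancelled. *)
Lemma residue_column (n nu j : nat) : (j < k)%nat -> (n < nu)%nat ->
  cprod (fun m => (INR l * (INR m - INR n) + (zero_off k l r j - pole_off k l r j0)%R) /
    (if ((m =? n) && (j =? j0))%nat%bool then RtoC 1
     else INR l * (INR m - INR n) + (pole_off k l r j - pole_off k l r j0)%R))%C nu =
  ((if (j =? j0)%nat then RtoC (INR l) else 1) *
   (rising (den_arg j - INR n) nu /
    (if (j =? j0)%nat then punctured n nu else rising (num_arg j - INR n) nu)))%C.
Proof.
  intros Hj Hn.
  assert (NL : RtoC (INR l) <> 0%C) by (apply RtoC_neq; lra).
  assert (EZ : RtoC (zero_off k l r j - pole_off k l r j0) = (INR l * den_arg j)%C).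
  { rewrite <- RtoC_mult; f_equal; unfold den_arg; field; lra. }
  rewrite EZ, pole_diff, RtoC_mult by assumption; fold (num_arg j).
  destruct (Nat.eqb_spec j j0) as [Ej|Hne].
  - rewrite (cprod_ext _ (fun m => (den_arg j - INR n + INR m) *
      ((if (m =? n)%nat then RtoC (INR l) else 1) /
       (if (m =? n)%nat then RtoC 1 else (INR m - INR n))))%C).
    + assert (NP : forall i, (i < nu)%nat ->
                (if (i =? n)%nat then RtoC 1 else INR i - INR n)%C <> 0%C).
      { intros i _; destruct (Nat.eqb_spec i n) as [_|Hi]; [apply C1_nz|].
        rewrite <- RtoC_minus; apply RtoC_neq; intros E; apply Hi, INR_eq; lra. }
      rewrite cprod_mult, cprod_div, cprod_delta by assumption.
      unfold rising, punctured; field; apply cprod_nz, NP.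
    + intros m _; rewrite Bool.andb_true_r.
      replace (num_arg j) with 0 by (unfold num_arg; rewrite Ej; field; lra).
      destruct (Nat.eqb_spec m n) as [->|Hi]; [field; apply C1_nz|].
      assert (NZ : (INR m - INR n <> 0)%C).
      { rewrite <- RtoC_minus; apply RtoC_neq; intros E; apply Hi, INR_eq; lra. }
      field; repeat split; first [exact NZ|exact NL|
        intros E; apply (Cmult_neq_0 _ _ NL NZ); rewrite <- E; ring].
  - rewrite (cprod_ext _ (fun m => (den_arg j - INR n + INR m) / (num_arg j - INR n + INR m))%C).
    + rewrite cprod_div by (intros i _; apply num_arg_nz; assumption).
      unfold rising; ring.
    + intros m _; rewrite Bool.andb_false_r.
      pose proof (num_arg_nz j m n Hj Hne) as NZ.
      field; repeat split; first [exact NZ|exact NL|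
        intros E; apply (Cmult_neq_0 _ _ NL NZ); rewrite <- E; ring].
Qed.

Definition euler_quot (n nu j : nat) : C :=
  if (j =? j0)%nat then
    (euler (den_arg j - INR n) nu *
     (INR (fact (pred nu)) / (RCpow (INR nu) (INR n) * punctured n nu)))%C
  else (euler (den_arg j - INR n) nu / euler (num_arg j - INR n) nu)%C.

Lemma rising_quot (n nu j : nat) : (j < k)%nat -> (n < nu)%nat ->
  (rising (den_arg j - INR n) nu /
    (if (j =? j0)%nat then punctured n nu else rising (num_arg j - INR n) nu))%C =
  (RCpow (INR nu) (RtoC (gap k l r j)) * euler_quot n nu j)%C.
Proof.
  intros Hj Hn; unfold euler_quot.
  assert (EG : RCpow (INR nu) (den_arg j - INR n) =
     (RCpow (INR nu) (RtoC (gap k l r j)) * RCpow (INR nu) (num_arg j - INR n))%C).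
  { rewrite <- RCpow_plus; f_equal; rewrite den_num_gap, RtoC_plus; ring. }
  destruct (Nat.eqb_spec j j0) as [Ej|Hne].
  - rewrite rising_euler, EG.
    replace (num_arg j) with 0 by (unfold num_arg; rewrite Ej; field; lra).
    replace (0 - INR n)%C with (- INR n)%C by ring.
    rewrite RCpow_opp; field; repeat split; try apply RCpow_nz.
    apply cprod_nz; intros i _; destruct (Nat.eqb_spec i n) as [_|Hi]; [apply C1_nz|].
    rewrite <- RtoC_minus; apply RtoC_neq; intros E; apply Hi, INR_eq; lra.
  - assert (NR : rising (num_arg j - INR n) nu <> 0%C)
      by (apply cprod_nz; intros i _; apply num_arg_nz; assumption).
    assert (NE : euler (num_arg j - INR n) nu <> 0%C).
    { intros E; apply NR; rewrite rising_euler, E; ring. }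
    rewrite !rising_euler, EG; field; repeat split;
      first [exact NE|apply RCpow_nz|apply RtoC_fact_nz].
Qed.

(** The powers nu^(gap j) left by the columns multiply to sqrt nu, by [gap_sum]. *)
Lemma residue_euler (n nu : nat) : (n < nu)%nat ->
  residue a b (k * nu) (k * n + j0) =
  (INR l * sqrt (INR nu) * cprod (euler_quot n nu) k)%C.
Proof.
  intros Hn; unfold a, b; rewrite residue_blocks by assumption.
  rewrite (cprod_exchange (fun m j =>
    (INR l * (INR m - INR n) + (zero_off k l r j - pole_off k l r j0)%R) /
    (if ((m =? n) && (j =? j0))%nat%bool then RtoC 1
     else INR l * (INR m - INR n) + (pole_off k l r j - pole_off k l r j0)%R))%C).
  rewrite (cprod_ext _ (fun j => (if (j =? j0)%nat then RtoC (INR l) else 1) *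
    (RCpow (INR nu) (RtoC (gap k l r j)) * euler_quot n nu j))%C).
  2:{ intros j Hj; rewrite residue_column, rising_quot by assumption; reflexivity. }
  rewrite !cprod_mult, cprod_delta, RCpow_cprod, gap_sum, RCpow_RtoC by assumption.
  rewrite Rpower_sqrt by (apply lt_0_INR; lia); ring.
Qed.

Definition euler_quot_lim (n j : nat) : C :=
  if (j =? j0)%nat then (rGamma (den_arg j - INR n) * ((- (1)) ^ n / INR (fact n)))%C
  else (rGamma (den_arg j - INR n) / rGamma (num_arg j - INR n))%C.

Lemma num_arg_range (j : nat) : (j < k)%nat -> -1 < num_arg j < 1.
Proof.
  intros Hj; unfold num_arg.
  apply lt_INR in Hj; pose proof (lt_INR _ _ Hj0); pose proof (pos_INR j).
  pose proof (pos_INR j0); split.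
  - apply Rmult_lt_reg_r with (INR k); [exact Pk|].
    unfold Rdiv; rewrite Rmult_assoc, Rinv_l by lra; lra.
  - apply Rmult_lt_reg_r with (INR k); [exact Pk|].
    unfold Rdiv; rewrite Rmult_assoc, Rinv_l by lra; lra.
Qed.

(** The argument is nonzero and exceeds -1, so one application of the functional equation reaches
    the half-plane Re > 0. *)
Lemma rGamma_num_arg_nz (j : nat) : (j < k)%nat -> j <> j0 ->
  rGamma (num_arg j) <> 0%C.
Proof.
  intros Hj Hne; rewrite rGamma_func_eq; apply Cmult_neq_0.
  - pose proof (num_arg_nz j 0 0 Hj Hne) as H; intros E; apply H; rewrite E; simpl; ring.
  - apply rGamma_nz; unfold Re; simpl; pose proof (num_arg_range j Hj); lra.
Qed.

Lemma minus_1_pow_nz (n : nat) : ((- (1)) ^ n <> 0)%C.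
Proof. apply Cpow_nz, Re_neq_0; unfold Re; simpl; lra. Qed.

Lemma pochhammer_num_nz (j n : nat) : (j < k)%nat ->
  RtoC (pochhammer (1 - num_arg j) n) <> 0%C.
Proof.
  intros Hj; apply RtoC_neq, Rgt_not_eq, pochhammer_pos.
  pose proof (num_arg_range j Hj); lra.
Qed.

Lemma euler_quot_converges (n j : nat) : (j < k)%nat ->
  Clim (fun nu => euler_quot n nu j) (euler_quot_lim n j).
Proof.
  intros Hj; unfold euler_quot, euler_quot_lim.
  destruct (Nat.eqb_spec j j0) as [Ej|Hne].
  - apply Clim_mult; [apply euler_lim|apply punctured_lim].
  - apply Clim_mult; [apply euler_lim|apply Clim_inv; [|apply euler_lim]].
    rewrite rGamma_sub_nat; repeat apply Cmult_neq_0.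
    + apply minus_1_pow_nz.
    + apply pochhammer_num_nz, Hj.
    + apply rGamma_num_arg_nz; assumption.
Qed.

Lemma residue_lim (n : nat) :
  Clim (fun nu => kappa k l nu * residue a b (k * nu) (k * n + j0))%C
    (INR l * kappa_inf k l * cprod (euler_quot_lim n) k)%C.
Proof.
  apply (Clim_ext_loc (fun nu =>
    INR l * RtoC (sqrt (INR nu) * kappa k l nu) * cprod (euler_quot n nu) k)%C).
  - exists (S n); intros nu Hnu; rewrite residue_euler, RtoC_mult by lia; ring.
  - apply Clim_mult; [apply Clim_mult|].
    + apply Clim_const.
    + apply Clim_RtoC, kappa_lim; assumption.
    + apply Clim_cprod; intros j Hj; apply euler_quot_converges, Hj.
Qed.

Definition coef : C :=
  (cprod (fun j => rGamma (den_arg j)) k *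
   cprod (fun j => if (j =? j0)%nat then RtoC 1 else Gamma (num_arg j)) k)%C.

Fixpoint rprod (f : nat -> R) (n : nat) : R :=
  match n with
  | O => 1
  | S m => rprod f m * f m
  end.

Lemma RtoC_rprod (f : nat -> R) (n : nat) :
  RtoC (rprod f n) = cprod (fun i => RtoC (f i)) n.
Proof. induction n as [|n IH]; simpl; [reflexivity|rewrite RtoC_mult, IH; reflexivity]. Qed.

(** The n-th hypergeometric coefficient: [1 - den_arg j] are the upper and [1 - num_arg j], j <> j0,
    the lower parameters. *)
Definition series_coef (n : nat) : R :=
  rprod (fun j => pochhammer (1 - den_arg j) n) k /
  rprod (fun j => if (j =? j0)%nat then 1 else pochhammer (1 - num_arg j) n) k /
  INR (fact n).

Lemma rprod_nz (f : nat -> R) (n : nat) :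
  (forall i, (i < n)%nat -> f i <> 0) -> rprod f n <> 0.
Proof.
  induction n as [|n IH]; simpl; intros H; [lra|].
  apply Rmult_integral_contrapositive_currified; [apply IH; intros; apply H|apply H]; lia.
Qed.

(** The signs (-1)^n disappear column by column: within the quotient for j <> j0, and against the
    sign of the residue of Gamma for j = j0. *)
Lemma euler_quot_lim_prod (n : nat) :
  cprod (euler_quot_lim n) k = (coef * series_coef n)%C.
Proof.
  set (A := fun j => RtoC (pochhammer (1 - den_arg j) n)).
  set (B := fun j => if (j =? j0)%nat then RtoC 1 else RtoC (pochhammer (1 - num_arg j) n)).
  assert (HB : forall j, (j < k)%nat -> B j <> 0%C).
  { intros j Hj; unfold B; destruct (j =? j0)%nat; [apply C1_nz|apply pochhammer_num_nz, Hj]. }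
  rewrite (cprod_ext _ (fun j => rGamma (den_arg j)
     * (if (j =? j0)%nat then RtoC 1 else Gamma (num_arg j))
     * (A j / B j) * (if (j =? j0)%nat then (/ INR (fact n))%C else RtoC 1))%C).
  - rewrite !cprod_mult, cprod_div, cprod_delta by assumption.
    unfold coef, series_coef, Rdiv; rewrite !RtoC_mult, !RtoC_inv, !RtoC_rprod.
    + unfold Cdiv; fold A.
      rewrite (cprod_ext (fun i => RtoC (if (i =? j0)%nat then 1 else pochhammer (1 - num_arg i) n)) B).
      * ring.
      * intros j _; unfold B; destruct (j =? j0)%nat; reflexivity.
    + apply INR_fact_neq_0.
    + apply rprod_nz; intros j Hj; destruct (j =? j0)%nat; [lra|].
      intros E; apply (pochhammer_num_nz j n Hj); rewrite E; reflexivity.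
  - intros j Hj; unfold euler_quot_lim, A, B; pose proof (minus_1_pow_nz n) as NS.
    destruct (Nat.eqb_spec j j0) as [Ej|Hne].
    + rewrite rGamma_sub_nat.
      assert (S1 : ((- (1)) ^ n * (- (1)) ^ n = 1)%C).
      { rewrite <- Cpow_mult_l; replace (- (1) * - (1))%C with (RtoC 1) by ring; apply Cpow_1_l. }
      pose proof (RtoC_fact_nz n) as NF.
      match goal with |- (?e * ?p * ?g * (?e / ?f) = _)%C =>
        transitivity ((e * e) * p * g / f)%C; [field; exact NF|rewrite S1; field; exact NF] end.
    + rewrite !rGamma_sub_nat; unfold Gamma; field; repeat split.
      * apply pochhammer_num_nz, Hj.
      * apply rGamma_num_arg_nz; assumption.
      * exact NS.
Qed.

End Coefficients.

(** * Identification of the hypergeometric coefficients *)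

Lemma rprod_ext (f g : nat -> R) (n : nat) :
  (forall i, (i < n)%nat -> f i = g i) -> rprod f n = rprod g n.
Proof.
  induction n as [|n IH]; simpl; intros H; [reflexivity|].
  rewrite IH, H by (intros; try apply H; lia); reflexivity.
Qed.

Lemma rprod_add (f : nat -> R) (n m : nat) :
  rprod f (n + m) = rprod f n * rprod (fun i => f (n + i)%nat) m.
Proof.
  induction m as [|m IH]; simpl; [rewrite Nat.add_0_r; ring|].
  rewrite Nat.add_succ_r; simpl; rewrite IH; ring.
Qed.

Lemma fold_rprod (g : nat -> R) (s n : nat) :
  fold_right Rmult 1 (map g (seq s n)) = rprod (fun i => g (s + i)%nat) n.
Proof.
  revert s; induction n as [|n IH]; intros s; [reflexivity|].
  change (S n) with (1 + n)%nat; rewrite rprod_add; simpl; rewrite IH, Nat.add_0_r.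
  rewrite Rmult_1_l; f_equal; apply rprod_ext; intros i _; f_equal; lia.
Qed.

Lemma fold_right_Rmult_app (s t : list R) :
  fold_right Rmult 1 (s ++ t) = fold_right Rmult 1 s * fold_right Rmult 1 t.
Proof. induction s as [|x s IH]; simpl; [ring|rewrite IH; ring]. Qed.

Section Identification.

Variables (k l : nat) (r : R) (j0 : nat).
Hypothesis Hl : (0 < l)%nat.
Hypothesis Hk : (l < k)%nat.
Hypothesis Hj0 : (j0 < k)%nat.

Let Pl : 0 < INR l := INR_l_pos l Hl.
Let Pk : 0 < INR k := INR_k_pos k l Hl Hk.
Let Pe : 0 < INR (k - l) := INR_kl_pos k l Hl Hk.

Lemma den_arg_low (j : nat) : (j < l)%nat ->
  den_arg k l r j0 j = INR (S j) / INR l - (r + INR (S j0)) / INR k.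
Proof.
  intros Hj; unfold den_arg, zero_off, pole_off.
  apply Nat.ltb_lt in Hj; rewrite Hj, !S_INR; field; lra.
Qed.

Lemma den_arg_high (i : nat) :
  den_arg k l r j0 (l + i) =
  (r + INR (S i)) / (INR k - INR l) - (r + INR (S j0)) / INR k.
Proof.
  unfold den_arg, zero_off, pole_off.
  replace (l + i <? l)%nat with false by (symmetry; apply Nat.ltb_ge; lia).
  replace (l + i - l)%nat with i by lia.
  rewrite <- (INR_kl k l) by assumption; field; lra.
Qed.

Lemma cprod_punctured (g : nat -> C) :
  cprod (fun j => if (j =? j0)%nat then RtoC 1 else g j) k =
  (cprod g j0 * cprod (fun i => g (S j0 + i)%nat) (k - S j0))%C.
Proof.
  replace k with (j0 + (1 + (k - S j0)))%nat at 1 by lia.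
  rewrite !cprod_add; simpl cprod; rewrite Nat.add_0_r, Nat.eqb_refl.
  rewrite (cprod_ext _ g).
  2:{ intros i Hi; replace (i =? j0)%nat with false by (symmetry; apply Nat.eqb_neq; lia).
      reflexivity. }
  rewrite (cprod_ext (fun i => if (j0 + S i =? j0)%nat then RtoC 1 else g (j0 + S i)%nat)
    (fun i => g (S (j0 + i)))).
  - ring.
  - intros i _; replace (j0 + S i =? j0)%nat with false by (symmetry; apply Nat.eqb_neq; lia).
    f_equal; lia.
Qed.

Lemma rprod_punctured (g : nat -> R) :
  rprod (fun j => if (j =? j0)%nat then 1 else g j) k =
  rprod g j0 * rprod (fun i => g (S j0 + i)%nat) (k - S j0).
Proof.
  apply RtoC_inj; rewrite RtoC_mult, !RtoC_rprod.
  rewrite <- (cprod_punctured (fun j => RtoC (g j))).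
  apply cprod_ext; intros i _; destruct (i =? j0)%nat; reflexivity.
Qed.

(** Column j corresponds to index j + 1 of the formula; the product without j0 splits into the two
    ranges below and above h. *)
Lemma coef_c_coef : coef k l r j0 = c_coef (S j0) k l r.
Proof.
  unfold coef, c_coef; rewrite !Cprod_cprod, cprod_punctured.
  replace (S (S j0 - 1) - 1)%nat with j0 by lia.
  replace (S k - (S j0 + 1))%nat with (k - S j0)%nat by lia.
  replace (S l - 1)%nat with l by lia.
  replace (S k - (l + 1))%nat with (k - l)%nat by lia.
  assert (Ek : forall f, cprod f k = (cprod f l * cprod (fun j => f (l + j)%nat) (k - l))%C).
  { intros f; rewrite <- cprod_add; f_equal; lia. }
  rewrite (Ek (fun j => rGamma (den_arg k l r j0 j))).
  rewrite (cprod_ext (fun j => rGamma (den_arg k l r j0 j))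
    (fun i => rGamma (INR (1 + i) / INR l - (r + INR (S j0)) / INR k)%R)).
  2:{ intros i Hi; rewrite den_arg_low by exact Hi; reflexivity. }
  rewrite (cprod_ext (fun j => rGamma (den_arg k l r j0 (l + j)))
    (fun i => rGamma ((r + INR (l + 1 + i) - INR l) / (INR k - INR l)
                      - (r + INR (S j0)) / INR k)%R)).
  2:{ intros i _; rewrite den_arg_high; do 2 f_equal.
      rewrite !plus_INR, S_INR; simpl INR; f_equal; f_equal; ring. }
  rewrite (cprod_ext (fun j => Gamma (num_arg k j0 j))
    (fun i => Gamma ((INR (1 + i) - INR (S j0)) / INR k)%R)).
  2:{ intros i _; unfold num_arg; do 2 f_equal.
      change (1 + i)%nat with (S i); rewrite !S_INR; f_equal; ring. }
  rewrite (cprod_ext (fun i => Gamma (num_arg k j0 (S j0 + i)))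
    (fun i => Gamma ((INR (S j0 + 1 + i) - INR (S j0)) / INR k)%R)).
  2:{ intros i _; unfold num_arg; do 2 f_equal.
      rewrite !plus_INR, !S_INR; simpl INR; f_equal; ring. }
  ring.
Qed.

Lemma a_params_prod (n : nat) :
  prod_poch (a_params (S j0) k l r) n =
  rprod (fun j => pochhammer (1 - den_arg k l r j0 j) n) k.
Proof.
  unfold prod_poch, a_params.
  rewrite !map_app, !map_map, fold_right_Rmult_app, !fold_rprod.
  assert (Ek : forall f, rprod f k = rprod f l * rprod (fun j => f (l + j)%nat) (k - l)).
  { intros f; rewrite <- rprod_add; f_equal; lia. }
  rewrite Ek; f_equal.
  - apply rprod_ext; intros i Hi; rewrite den_arg_low by exact Hi; f_equal.
    change (1 + i)%nat with (S i); field; lra.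
  - apply rprod_ext; intros i _; rewrite den_arg_high; f_equal.
    pose proof (INR_kl k l Hl Hk) as E; rewrite !plus_INR, !S_INR; simpl INR.
    field; lra.
Qed.

Lemma b_params_prod (n : nat) :
  prod_poch (b_params (S j0) k) n =
  rprod (fun j => if (j =? j0)%nat then 1 else pochhammer (1 - num_arg k j0 j) n) k.
Proof.
  unfold prod_poch, b_params.
  rewrite !map_app, !map_map, fold_right_Rmult_app, !fold_rprod, rprod_punctured.
  replace (S j0 - 1)%nat with j0 by lia; f_equal.
  - apply rprod_ext; intros i _; f_equal; unfold num_arg.
    change (1 + i)%nat with (S i); rewrite !S_INR; field; lra.
  - apply rprod_ext; intros i _; f_equal; unfold num_arg.
    rewrite !plus_INR, !S_INR; simpl INR; field; lra.
Qed.

Lemma hypergeom_series (z : R) :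
  hypergeom (a_params (S j0) k l r) (b_params (S j0) k) z =
  Series (fun n => series_coef k l r j0 n * z ^ n).
Proof.
  unfold hypergeom; apply Series_ext; intros n.
  rewrite a_params_prod, b_params_prod; unfold series_coef, Rdiv; ring.
Qed.

End Identification.

(** * The inverse Mellin transform *)

Lemma quotient_diff_le (a b c A B D : C) (M e c0 : R) : 0 < c0 -> 0 <= e ->
  Cmod (A - a) <= e -> Cmod (B - b) <= e -> Cmod (D - c) <= e ->
  Cmod b <= M -> Cmod A <= M -> Cmod B <= M -> Cmod D <= M ->
  c0 <= Cmod c -> c0 <= Cmod D ->
  Cmod (a * b / c - A * B / D) <= 3 * M ^ 2 * e / c0 ^ 2.
Proof.
  intros Hc0 He Ha Hb Hc Mb MA MB MD Lc LD.
  assert (Nc : c <> 0%C) by (apply Cmod_gt_0; lra).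
  assert (ND : D <> 0%C) by (apply Cmod_gt_0; lra).
  (* The three factors are exchanged one at a time, which accounts for the 3 in the bound. *)
  replace (a * b / c - A * B / D)%C
    with ((- (A - a) * b * D + - (A * (B - b) * D) + A * B * (D - c)) / (c * D))%C
    by (field; auto).
  rewrite Cmod_div, Cmod_mult by (apply Cmult_neq_0; assumption).
  assert (M0 : 0 <= M) by (generalize (Cmod_ge_0 b); lra).
  unfold Rdiv; apply Rmult_le_compat.
  - apply Cmod_ge_0.
  - left; apply Rinv_0_lt_compat, Rmult_lt_0_compat; lra.
  - eapply Rle_trans; [apply Cmod_triangle|].
    eapply Rle_trans; [apply Rplus_le_compat_r, Cmod_triangle|].
    rewrite Cmod_opp, !Cmod_mult, Cmod_opp.
    assert (P : forall u v w, 0 <= u -> 0 <= v -> 0 <= w -> u <= e -> v <= M -> w <= M ->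
              u * v * w <= M ^ 2 * e).
    { intros u v w U V W Hu Hv Hw; replace (M ^ 2 * e) with (e * M * M) by ring.
      apply Rmult_le_compat; try assumption; [apply Rmult_le_pos; assumption|].
      apply Rmult_le_compat; assumption. }
    pose proof (P (Cmod (A - a)) (Cmod b) (Cmod D)) as P1.
    pose proof (P (Cmod (B - b)) (Cmod A) (Cmod D)) as P2.
    pose proof (P (Cmod (D - c)) (Cmod A) (Cmod B)) as P3.
    specialize (P1 ltac:(apply Cmod_ge_0) ltac:(apply Cmod_ge_0) ltac:(apply Cmod_ge_0) Ha Mb MD).
    specialize (P2 ltac:(apply Cmod_ge_0) ltac:(apply Cmod_ge_0) ltac:(apply Cmod_ge_0) Hb MA MD).
    specialize (P3 ltac:(apply Cmod_ge_0) ltac:(apply Cmod_ge_0) ltac:(apply Cmod_ge_0) Hc MA MB).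
    lra.
  - apply Rinv_le_contravar; [apply pow_lt, Hc0|].
    replace (c0 ^ 2) with (c0 * c0) by ring; apply Rmult_le_compat; lra.
Qed.

(** To the right of the poles of the numerator the limit branch of [psi] is never taken. *)
Lemma psi_eq (p r : R) (s : C) : 0 < Re (psi_num p r s) ->
  psi p r s = (rGamma s * rGamma (psi_den p r s) / rGamma (psi_num p r s))%C.
Proof.
  intros H; unfold psi; destruct Ceq_dec as [E|_].
  - exfalso; apply (rGamma_nz _ H), E.
  - unfold psi_ratio, Gamma, Cdiv; ring.
Qed.

Lemma cint_filterlim (f : nat -> R -> C) (g : R -> C) (h : nat -> C) (T : R) : 0 < T ->
  (forall n, cint (f n) (- T) T (h n)) ->
  (forall eps, 0 < eps -> exists N, forall n t, (N <= n)%nat -> Rabs t <= T ->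
     Cmod (f n t - g t) < eps) ->
  exists v, cint g (- T) T v /\ Clim h v.
Proof.
  intros HT Hf Hu.
  (* [filterlim_RInt] asks for convergence uniform on the whole line; clipping the variable
     transfers it from [-T, T] without changing the integrals. *)
  set (clip := fun t => Rmax (- T) (Rmin t T)).
  assert (C1 : forall t, Rabs (clip t) <= T).
  { intros t; unfold clip, Rmax, Rmin; apply Rabs_le.
    repeat destruct Rle_dec; lra. }
  assert (C2 : forall t, - T <= t <= T -> clip t = t).
  { intros t Ht; unfold clip; rewrite Rmin_left, Rmax_right; lra. }
  destruct (filterlim_RInt (V := C_R_CompleteNormedModule)
    (fun n t => f n (clip t)) (- T) T eventually eventually_filter
    (fun t => g (clip t)) h) as [v [Hh Hg]].
  - intros n; apply (cint_ext (f n)); [lra| |apply Hf].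
    intros t Ht; rewrite C2 by exact Ht; reflexivity.
  - apply filterlim_locally; intros eps.
    destruct (Hu eps (cond_pos eps)) as [N HN]; exists N; intros n Hn t.
    specialize (HN n (clip t) Hn (C1 t)).
    split; (eapply Rle_lt_trans; [|exact HN]).
    + apply (re_le_Cmod (f n (clip t) - g (clip t))).
    + apply (im_le_Cmod (f n (clip t) - g (clip t))).
  - exists v; split.
    + apply (cint_ext (fun t => g (clip t))); [lra| |exact Hg].
      intros t Ht; rewrite C2 by exact Ht; reflexivity.
    + apply Clim_components; split; apply is_lim_seq_spec; intros eps;
        pose proof (proj1 (filterlim_locally h v) Hh eps) as [N HN];
        exists N; intros n Hn; destruct (HN n Hn) as [B1 B2]; assumption.
Qed.

Lemma sum_n_m_csum (f : nat -> C) (k : nat) :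
  sum_n_m f 1 k = csum (fun j => f (S j)) k.
Proof.
  induction k as [|k IH].
  - rewrite sum_n_m_zero by lia; reflexivity.
  - rewrite sum_n_Sm, IH by lia; reflexivity.
Qed.

Lemma kappa_bounded (k l : nat) : (0 < l)%nat -> (l < k)%nat ->
  exists B, 0 <= B /\ forall n, sqrt (INR n) * Rabs (kappa k l n) <= B.
Proof.
  intros Hl Hk.
  destruct (filterlim_bounded (K := R_AbsRing) (V := R_NormedModule)
    (fun n => sqrt (INR n) * kappa k l n)) as [B HB].
  { exists (kappa_inf k l); apply kappa_lim; assumption. }
  assert (H : forall n, sqrt (INR n) * Rabs (kappa k l n) <= B).
  { intros n; rewrite <- (Rabs_pos_eq (sqrt (INR n))) by apply sqrt_pos.
    rewrite <- Rabs_mult; apply (HB n). }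
  exists B; split; [|exact H].
  eapply Rle_trans; [|apply (H O)]; apply Rmult_le_pos; [apply sqrt_pos|apply Rabs_pos].
Qed.

Section Main.

Variables (k l : nat) (r x : R).
Hypothesis Hl : (0 < l)%nat.
Hypothesis Hk : (l < k)%nat.

Let p := INR k / INR l.
Let Pl : 0 < INR l := INR_l_pos l Hl.
Let Pk : 0 < INR k := INR_k_pos k l Hl Hk.
Let a (i : nat) : C := RtoC (pole_at k l r i).
Let b (i : nat) : C := RtoC (zero_at k l r i).

Hypothesis Hx : 0 < x.
Hypothesis Hxc : x < c_const p.

Let mu := ln (c_const p) - ln x.
(** Within a class consecutive poles differ by l, so exp (- mu a) is multiplied by z at each
    step. *)
Let z := exp (- (mu * INR l)).

Lemma mu_pos : 0 < mu.
Proof. unfold mu; pose proof (ln_increasing x (c_const p) Hx Hxc); lra. Qed.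

Lemma z_eq : x ^ l / c_const p ^ l = z.
Proof.
  unfold z, mu; rewrite <- (exp_ln (x ^ l / c_const p ^ l)).
  2:{ apply Rdiv_lt_0_compat; apply pow_lt; lra. }
  f_equal; rewrite ln_div, !ln_pow by (try apply pow_lt; lra); ring.
Qed.

Lemma z_range : 0 <= z < 1.
Proof.
  split; [left; apply exp_pos|].
  unfold z; rewrite <- exp_0; apply exp_increasing.
  pose proof (Rmult_lt_0_compat _ _ mu_pos Pl); lra.
Qed.

Definition coefficient (j : nat) : C :=
  (INR l * kappa_inf k l * coef k l r j * Cexp (- (mu * pole_off k l r j)%R))%C.

(** The growth sqrt nu of the residues against the decay of [kappa] gives a bounded coefficient, and
    0 <= z < 1 gives the geometric majorant. *)
Lemma block_series (j0 : nat) : (j0 < k)%nat ->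
  Clim (fun nu => csum (fun n => kappa k l nu * residue a b (k * nu) (k * n + j0)
          * Cexp (- (mu * a (k * n + j0)%nat)))%C nu)
    (coefficient j0 * Series (fun n => series_coef k l r j0 n * z ^ n)%R)%C.
Proof.
  intros Hj0.
  destruct (residue_le k l r Hl Hk j0 Hj0) as [K [HK HR]].
  destruct (kappa_bounded k l Hl Hk) as [B [B0 HB]].
  set (q := Cexp (- (mu * pole_off k l r j0)%R)).
  assert (EZ : forall n, Cexp (- (mu * a (k * n + j0)%nat)) = (q * RtoC (z ^ n))%C).
  { intros n; unfold a, q, z; rewrite pole_at_block by assumption.
    rewrite <- Rpower_pow by apply exp_pos; unfold Rpower; rewrite ln_exp.
    rewrite <- Cexp_RtoC, <- Cexp_plus; f_equal.
    rewrite RtoC_mult, RtoC_plus, !RtoC_mult, !RtoC_opp, RtoC_mult; ring. }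
  apply (tannery_scal _ _ _ (Cmod q * (B * K)) z z_range).
  - apply Rmult_le_pos; [apply Cmod_ge_0|apply Rmult_le_pos; assumption].
  - intros nu n Hn; rewrite EZ, !Cmod_mult, !Cmod_R, (Rabs_pos_eq (z ^ n)).
    2:{ apply pow_le, z_range. }
    replace (Cmod q * (B * K) * z ^ n) with ((B * K) * (Cmod q * z ^ n)) by ring.
    apply Rmult_le_compat_r.
    { apply Rmult_le_pos; [apply Cmod_ge_0|apply pow_le, z_range]. }
    pose proof (HB nu) as HBn; specialize (HR n nu Hn).
    apply Rle_trans with (Rabs (kappa k l nu) * (K * sqrt (INR nu))).
    + apply Rmult_le_compat_l; [apply Rabs_pos|exact HR].
    + replace (Rabs (kappa k l nu) * (K * sqrt (INR nu)))
        with (sqrt (INR nu) * Rabs (kappa k l nu) * K) by ring.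
      apply Rmult_le_compat_r; assumption.
  - intros n.
    apply (Clim_ext_loc (fun nu => kappa k l nu * residue a b (k * nu) (k * n + j0)
             * (q * RtoC (z ^ n)))%C).
    { exists O; intros nu _; rewrite EZ; reflexivity. }
    replace (coefficient j0 * RtoC (series_coef k l r j0 n * z ^ n))%C
      with (INR l * kappa_inf k l * cprod (euler_quot_lim k l r j0 n) k * (q * RtoC (z ^ n)))%C.
    + apply Clim_mult; [apply residue_lim; assumption|apply Clim_const].
    + rewrite euler_quot_lim_prod by assumption.
      unfold coefficient; fold q; rewrite RtoC_mult; ring.
Qed.

Definition total : C :=
  csum (fun j => coefficient j * Series (fun n => series_coef k l r j n * z ^ n)%R)%C k.

Lemma residue_sum_lim :
  Clim (fun nu => csum (fun i => kappa k l nu * residue a b (k * nu) i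
          * Cexp (- (mu * a i)))%C (k * nu)) total.
Proof.
  apply (Clim_ext_loc (fun nu => csum (fun j0 => csum (fun n =>
    kappa k l nu * residue a b (k * nu) (k * n + j0)
          * Cexp (- (mu * a (k * n + j0)%nat)))%C nu) k)).
  - exists O; intros nu _; rewrite csum_split; symmetry.
    apply (csum_exchange (fun n j0 => kappa k l nu * residue a b (k * nu) (k * n + j0)
          * Cexp (- (mu * a (k * n + j0)%nat)))%C).
  - apply Clim_csum; intros j Hj; apply block_series, Hj.
Qed.

Variable d : R.
Hypothesis Hd : 1 - (1 + r) / p < d.

(** The admissibility condition on d says that the line lies to the right of the rightmost pole. *)
Lemma pole_lt_d : - pole_off k l r 0 < d.
Proof.
  replace (- pole_off k l r 0) with (1 - (1 + r) / p); [exact Hd|].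
  unfold pole_off, p; simpl INR; field; lra.
Qed.

Lemma Re_psi_num_pos (t : R) : 0 < Re (psi_num p r (d, t)).
Proof.
  replace (Re (psi_num p r (d, t))) with (p * (d - (1 - (1 + r) / p))).
  - apply Rmult_lt_0_compat; [apply Rdiv_lt_0_compat; assumption|lra].
  - assert (0 < p) by (apply Rdiv_lt_0_compat; assumption).
    unfold psi_num, Re; simpl; field; lra.
Qed.

Lemma pole_nz (t : R) (i : nat) : ((d, t) + a i <> 0)%C.
Proof.
  apply Re_neq_0; change (d + pole_at k l r i <> 0).
  pose proof (pole_at_range k l r Hl Hk i (S i) (Nat.lt_succ_diag_r i)).
  pose proof pole_lt_d; lra.
Qed.

Definition integrand (t : R) : C := (RCpow x (- (d, t)) * psi p r (d, t) * Ci)%C.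

Definition approx (n : nat) (t : R) : C :=
  (RCpow x (- (d, t)) *
   (euler (d, t) (l * n) * euler (psi_den p r (d, t)) ((k - l) * n)
    / euler (psi_num p r (d, t)) (k * n)) * Ci)%C.

Lemma approx_uniform (T eps : R) : 0 < T -> 0 < eps ->
  exists N, forall n t, (N <= n)%nat -> Rabs t <= T -> Cmod (approx n t - integrand t) < eps.
Proof.
  intros HT Heps.
  assert (Pp : 1 < p).
  { unfold p; apply Rmult_lt_reg_r with (INR l); [exact Pl|].
    unfold Rdiv; rewrite Rmult_assoc, Rinv_l by lra; pose proof (lt_INR _ _ Hk); lra. }
  (* One radius for the arguments of all three Gamma factors, so that a single rate 1/n applies. *)
  set (Rr := (Rabs d + T + 1) * p + Rabs r + 1).
  assert (Bs : forall t, Rabs t <= T -> Cmod ((d, t) - 1) <= Rabs d + T + 1).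
  { intros t Ht; eapply Rle_trans; [apply Cmod_sub_le|]; rewrite Cmod_1.
    eapply Rle_trans; [apply Rplus_le_compat_r, Cmod_le_abs|]; simpl; lra. }
  assert (Bq : forall u t, Rabs t <= T -> 0 <= u <= p ->
            Cmod (((d, t) - 1) * RtoC u + RtoC r + 1) <= Rr).
  { intros u t Ht Hu.
    eapply Rle_trans; [apply Cmod_triangle|]; rewrite Cmod_1.
    eapply Rle_trans; [apply Rplus_le_compat_r, Cmod_triangle|].
    rewrite Cmod_mult, !Cmod_R, (Rabs_pos_eq u) by lra.
    assert (Cmod ((d, t) - 1) * u <= (Rabs d + T + 1) * p).
    { apply Rmult_le_compat; [apply Cmod_ge_0|lra|apply Bs, Ht|lra]. }
    unfold Rr; lra. }
  assert (B1 : forall t, Rabs t <= T -> Cmod (d, t) <= Rr).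
  { intros t Ht; eapply Rle_trans; [apply Cmod_le_abs|]; simpl.
    assert ((Rabs d + T + 1) * 1 <= (Rabs d + T + 1) * p).
    { apply Rmult_le_compat_l; generalize (Rabs_pos d); lra. }
    generalize (Rabs_pos r); unfold Rr; lra. }
  assert (B2 : forall t, Rabs t <= T -> Cmod (psi_den p r (d, t)) <= Rr)
    by (intros; apply Bq; [assumption|lra]).
  assert (B3 : forall t, Rabs t <= T -> Cmod (psi_num p r (d, t)) <= Rr)
    by (intros; apply Bq; [assumption|lra]).
  assert (Rr0 : 0 <= Rr) by (generalize (B1 0 ltac:(rewrite Rabs_R0; lra)) (Cmod_ge_0 (d, 0)); lra).
  (* The real part of [psi_num] is constant along the line, so the lower bound for the denominator
     obtained at t = 0 serves every t. *)
  destruct (euler_ge Rr _ (Re_psi_num_pos 0)) as [c [Hc [N1 [N1pos HN1]]]].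
  assert (ReX : forall t, Re (psi_num p r (d, 0)) <= Re (psi_num p r (d, t))).
  { intros t; right; unfold psi_num, Re; simpl; ring. }
  set (A := exp (- (d * ln x))).
  set (D := A * (3 * euler_bound Rr ^ 2 * euler_rate Rr / c ^ 2)).
  pose proof (is_lim_seq_const_div D) as L; apply is_lim_seq_spec in L.
  destruct (L (mkposreal eps Heps)) as [N2 HN2].
  exists (S (max N1 N2)); intros n t Hn Ht.
  specialize (HN2 n ltac:(lia)); simpl in HN2; rewrite Rminus_0_r in HN2.
  eapply Rle_lt_trans; [|eapply Rle_lt_trans; [apply Rle_abs|exact HN2]].
  unfold approx, integrand; rewrite psi_eq by apply Re_psi_num_pos.
  match goal with |- Cmod (?u * ?v * _ - ?u * ?w * _) <= _ =>
    replace (u * v * Ci - u * w * Ci)%C with (u * (v - w) * Ci)%C by ring end.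
  rewrite !Cmod_mult, Cmod_Ci, Rmult_1_r, Cmod_RCpow.
  unfold D; rewrite Rmult_assoc; apply Rmult_le_compat; [left; apply exp_pos|apply Cmod_ge_0| |].
  { right; unfold A; f_equal; unfold Re; simpl; ring. }
  replace (3 * euler_bound Rr ^ 2 * euler_rate Rr / c ^ 2 * / INR n)
    with (3 * euler_bound Rr ^ 2 * (euler_rate Rr * / INR n) / c ^ 2)
    by (field; split; [apply not_0_INR; lia|lra]).
  assert (n0 : (0 < n)%nat) by lia.
  assert (RT : forall s m, Cmod s <= Rr -> (n <= m)%nat ->
            Cmod (rGamma s - euler s m) <= euler_rate Rr * / INR n).
  { intros s m Hs Hm; eapply Rle_trans; [apply (rGamma_euler_rate Rr); [exact Hs|lia]|].
    apply Rmult_le_compat_l; [apply euler_rate_pos, Rr0|].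
    apply Rinv_le_contravar; [apply lt_0_INR, n0|apply le_INR, Hm]. }
  assert (LX : forall m, (N1 <= m)%nat -> c <= Cmod (euler (psi_num p r (d, t)) m)).
  { intros m Hm; apply HN1; [apply B3, Ht|apply ReX|exact Hm]. }
  apply quotient_diff_le.
  - exact Hc.
  - apply Rmult_le_pos; [apply euler_rate_pos, Rr0|left; apply Rinv_0_lt_compat, lt_0_INR, n0].
  - apply RT; [apply B1, Ht|nia].
  - apply RT; [apply B2, Ht|nia].
  - apply RT; [apply B3, Ht|nia].
  - apply euler_le; [apply B2, Ht|nia].
  - apply rGamma_le, B1, Ht.
  - apply rGamma_le, B2, Ht.
  - apply rGamma_le, B3, Ht.
  - apply LX; nia.
  - apply (rGamma_ge c N1), LX.
Qed.

Lemma approx_eq (n : nat) (t : R) : (0 < n)%nat ->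
  approx n t = (scale k l r * kappa k l n *
    (Cexp (mu * (d, t)) * cprod (fun i => ((d, t) + b i) / ((d, t) + a i)) (k * n) * Ci))%C.
Proof.
  intros Hn; unfold approx, p.
  rewrite euler_ratio by (try assumption; intros i; apply pole_nz).
  pose proof (RCpow_scale k l r Hl Hk x (d, t)) as E; fold p in E.
  fold mu in E.
  transitivity (RCpow x (- (d, t)) *
   (RCpow (INR k) (psi_num p r (d, t)) /
    (RCpow (INR l) (d, t) * RCpow (INR (k - l)) (psi_den p r (d, t)))) * kappa k l n *
   cprod (fun i => ((d, t) + b i) / ((d, t) + a i)) (k * n) * Ci)%C.
  - unfold p, a, b; ring.
  - rewrite E; ring.
Qed.

(** With T fixed, n -> oo is taken on both sides of [contour_estimate]: uniform convergence handles
    the integral and [residue_sum_lim] the residues. K does not depend on T. *)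
Lemma truncated_estimate : exists K, 0 <= K /\ forall T, INR l <= T ->
  exists v, cint integrand (- T) T v /\
    Cmod (v - 2 * PI * Ci * (scale k l r * total)) <= K * sqrt (/ T).
Proof.
  destruct (contour_estimate k l r Hl Hk) as [K0 HK0].
  destruct (kappa_bounded k l Hl Hk) as [B [B0 HB]].
  set (E := exp (mu * d) / mu).
  assert (E0 : 0 < E) by (apply Rdiv_lt_0_compat; [apply exp_pos|apply mu_pos]).
  set (K := Rabs (scale k l r) * B * (2 * (exp K0 * E)) * sqrt (2 * INR l)).
  assert (E1 : 0 <= exp K0 * E) by (apply Rmult_le_pos; [left; apply exp_pos|lra]).
  exists K; split.
  { unfold K; apply Rmult_le_pos; [|apply sqrt_pos].
    apply Rmult_le_pos; [apply Rmult_le_pos; [apply Rabs_pos|exact B0]|lra]. }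
  intros T HT.
  assert (T0 : 0 < T) by lra.
  assert (Ex : forall n, exists w, cint (fun t => Cexp (mu * (d, t)) *
     cprod (fun i => ((d, t) + b i) / ((d, t) + a i)) (k * n) * Ci)%C (- T) T w).
  { intros n; apply cint_cont; [lra|]; intros t _.
    assert (P : ccont (fun t => (d, t)) t)
      by (split; simpl; [apply continuous_const|apply continuous_id]).
    apply ccont_mult; [|apply ccont_const]; apply ccont_mult.
    - apply ccont_Cexp, ccont_mult; [apply ccont_const|exact P].
    - induction (k * n)%nat as [|m IH]; simpl; [apply ccont_const|].
      apply ccont_mult; [exact IH|]; unfold Cdiv; apply ccont_mult.
      + apply ccont_plus; [exact P|apply ccont_const].
      + apply ccont_inv; [apply pole_nz|apply ccont_plus; [exact P|apply ccont_const]]. }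
  set (w := fun n => RInt (V := C_R_CompleteNormedModule) (fun t => Cexp (mu * (d, t)) *
     cprod (fun i => ((d, t) + b i) / ((d, t) + a i)) (k * n) * Ci)%C (- T) T).
  assert (Hw : forall n, cint (fun t => Cexp (mu * (d, t)) *
     cprod (fun i => ((d, t) + b i) / ((d, t) + a i)) (k * n) * Ci)%C (- T) T (w n)).
  { intros n; apply (RInt_correct (V := C_R_CompleteNormedModule)); exact (Ex n). }
  (* The index is shifted because the closed form [approx_eq] is stated for n > 0. *)
  destruct (cint_filterlim (fun n => approx (S n)) integrand
    (fun n => scale k l r * kappa k l (S n) * w (S n))%C T T0) as [v [Hv Lv]].
  { intros n; apply (cint_ext (fun t => scale k l r * kappa k l (S n) * (Cexp (mu * (d, t)) *
     cprod (fun i => ((d, t) + b i) / ((d, t) + a i)) (k * (S n)) * Ci))%C); [lra| |].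
    - intros t _; symmetry; apply approx_eq; lia.
    - apply cint_scal, Hw. }
  { intros eps Heps; destruct (approx_uniform T eps T0 Heps) as [N HN].
    exists N; intros n t Hn Ht; apply HN; [lia|exact Ht]. }
  exists v; split; [exact Hv|].
  set (S0 := fun n => csum (fun i => kappa k l n * residue a b (k * n) i
          * Cexp (- (mu * a i)))%C (k * n)).
  assert (LS : Clim (fun n => scale k l r * kappa k l (S n) * w (S n)
                 + - (2 * PI * Ci * (scale k l r * S0 (S n))))%C
                 (v + - (2 * PI * Ci * (scale k l r * total)))).
  { apply Clim_plus; [exact Lv|].
    apply (Clim_ext_loc (fun n => - (2 * PI * Ci * scale k l r) * S0 (S n))%C).
    { exists O; intros n _; ring. }
    replace (- (2 * PI * Ci * (scale k l r * total)))%C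
      with (- (2 * PI * Ci * scale k l r) * total)%C by ring.
    apply Clim_mult; [apply Clim_const|].
    pose proof residue_sum_lim as RL; apply is_lim_seq_incr_1 in RL; exact RL. }
  apply (Clim_Cmod_le _ _ _ LS).
  destruct (INR_unbounded T) as [N HN].
  exists N; intros n' Hn'; set (n := S n').
  assert (Pn : T < INR n) by (eapply Rlt_le_trans; [exact HN|apply le_INR; unfold n; lia]).
  specialize (HK0 n d mu T (w n) mu_pos pole_lt_d HT (Hw n)).
  fold a b in HK0; fold E in HK0.
  set (S1 := csum (fun i => residue a b (k * n) i * Cexp (- (mu * a i)))%C (k * n)) in HK0.
  assert (ES : S0 n = (kappa k l n * S1)%C).
  { unfold S0, S1; rewrite <- csum_scal; apply csum_ext; intros; ring. }
  rewrite ES.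
  replace (scale k l r * kappa k l n * w n + - (2 * PI * Ci * (scale k l r * (kappa k l n * S1))))%C
    with (scale k l r * kappa k l n * (w n - 2 * PI * Ci * S1))%C by ring.
  rewrite !Cmod_mult, !Cmod_R.
  set (X := exp (ln (2 + 2 * INR n ^ 2 / (T / INR l) ^ 2) / 4 + K0)) in HK0.
  assert (HX : X <= sqrt (INR n) * (sqrt (2 * INR l) * sqrt (/ T)) * exp K0).
  { unfold X; rewrite exp_plus; apply Rmult_le_compat_r; [left; apply exp_pos|].
    (* As n > T, u >= l >= 1 and (2 + 2 u^2)^(1/4) <= (2 u)^(1/2). The factor sqrt n goes into
       [kappa], and T^(-1/2) remains. *)
    set (u := INR n * INR l / T).
    assert (U : INR l <= u).
    { unfold u; apply Rmult_le_reg_r with T; [exact T0|].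
      replace (INR n * INR l / T * T) with (INR n * INR l) by (field; lra).
      rewrite Rmult_comm; apply Rmult_le_compat_r; lra. }
    assert (L1 : 1 <= INR l) by (apply (le_INR 1); lia).
    replace (INR n ^ 2 / (T / INR l) ^ 2) with (u ^ 2) by (unfold u; field; lra).
    replace (2 * INR n ^ 2 / (T / INR l) ^ 2) with (2 * u ^ 2) by (unfold u; field; lra).
    assert (ER : sqrt (INR n) * (sqrt (2 * INR l) * sqrt (/ T)) = sqrt (2 * u)).
    { assert (0 < / T) by (apply Rinv_0_lt_compat, T0).
      rewrite <- !sqrt_mult by (try apply Rmult_le_pos; lra).
      f_equal; unfold u; field; lra. }
    rewrite ER, <- (exp_ln (sqrt (2 * u))) by (apply sqrt_lt_R0; lra).
    apply exp_le.
    apply Rle_trans with (ln (sqrt (2 * u) ^ 4) / 4).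
    - apply Rmult_le_compat_r; [lra|]; apply ln_le; [nra|].
      replace (sqrt (2 * u) ^ 4) with ((sqrt (2 * u) * sqrt (2 * u)) ^ 2) by ring.
      rewrite sqrt_sqrt by lra; nra.
    - rewrite ln_pow by (apply sqrt_lt_R0; lra); right; simpl; field. }
  pose proof (HB n) as HBn.
  apply Rle_trans with (Rabs (scale k l r) * Rabs (kappa k l n) *
    (2 * (sqrt (INR n) * (sqrt (2 * INR l) * sqrt (/ T)) * exp K0 * E))).
  - apply Rmult_le_compat_l; [apply Rmult_le_pos; apply Rabs_pos|].
    eapply Rle_trans; [exact HK0|].
    apply Rmult_le_compat_l; [lra|]; apply Rmult_le_compat_r; lra.
  - unfold K.
    replace (Rabs (scale k l r) * Rabs (kappa k l n) *
      (2 * (sqrt (INR n) * (sqrt (2 * INR l) * sqrt (/ T)) * exp K0 * E)))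
      with (sqrt (INR n) * Rabs (kappa k l n) *
        (Rabs (scale k l r) * (2 * (exp K0 * E)) * sqrt (2 * INR l) * sqrt (/ T))) by ring.
    replace (Rabs (scale k l r) * B * (2 * (exp K0 * E)) * sqrt (2 * INR l) * sqrt (/ T))
      with (B * (Rabs (scale k l r) * (2 * (exp K0 * E)) * sqrt (2 * INR l) * sqrt (/ T))) by ring.
    apply Rmult_le_compat_r; [|exact HBn].
    apply Rmult_le_pos; [|apply sqrt_pos]; apply Rmult_le_pos; [|apply sqrt_pos].
    apply Rmult_le_pos; [apply Rabs_pos|lra].
Qed.

(** The estimate covers T >= l only; shorter segments inherit integrability from a longer one. *)
Lemma integrand_cint (T : R) : 0 < T -> exists v, cint integrand (- T) T v.
Proof.
  intros HT; destruct truncated_estimate as [K [_ HK]].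
  set (T' := Rmax T (INR l)).
  assert (T1 : T <= T') by apply Rmax_l.
  destruct (HK T' (Rmax_r _ _)) as [v [Hv _]].
  destruct (ex_RInt_Chasles_2 (V := C_R_CompleteNormedModule) integrand (- T') (- T) T') as [u Hu];
    [lra|exists v; exact Hv|].
  destruct (ex_RInt_Chasles_1 (V := C_R_CompleteNormedModule) integrand (- T) T T') as [w Hw];
    [lra|exists u; exact Hu|].
  exists w; exact Hw.
Qed.

Lemma inverse_Mellin_total : is_inverse_Mellin (psi p r) d x (scale k l r * total)%C.
Proof.
  exists (2 * PI * Ci * (scale k l r * total))%C; split.
  - set (J := fun T => RInt (V := C_R_CompleteNormedModule) integrand (- T) T).
    exists J; split.
    + intros T HT; apply (RInt_correct (V := C_R_CompleteNormedModule) integrand).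
      destruct (integrand_cint T HT) as [v Hv]; exists v; exact Hv.
    + destruct truncated_estimate as [K [K0 HK]].
      apply filterlim_locally; intros eps; pose proof (cond_pos eps) as He.
      (* Beyond M the estimate is available and K / sqrt T < eps. *)
      set (M := Rmax (INR l) ((K / eps) ^ 2 + 1)).
      exists M; intros T HT.
      assert (T1 : INR l <= T) by (left; eapply Rle_lt_trans; [apply Rmax_l|exact HT]).
      assert (T2 : (K / eps) ^ 2 + 1 < T) by (eapply Rle_lt_trans; [apply Rmax_r|exact HT]).
      destruct (HK T T1) as [v [Hv Lv]].
      assert (EJ : J T = v) by (apply (is_RInt_unique (V := C_R_CompleteNormedModule)), Hv).
      rewrite EJ.
      assert (Small : Cmod (v - 2 * PI * Ci * (scale k l r * total)) < eps).
      { eapply Rle_lt_trans; [exact Lv|].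
        assert (T0 : 0 < T) by lra.
        assert (Q : K / eps < sqrt T).
        { apply Rsqr_incrst_0; [|apply Rmult_le_pos; [exact K0|left; apply Rinv_0_lt_compat, He]|apply sqrt_pos].
          rewrite Rsqr_sqrt by lra; unfold Rsqr; simpl in T2; lra. }
        assert (ST : 0 < sqrt T) by (apply sqrt_lt_R0, T0).
        rewrite sqrt_inv; apply Rmult_lt_reg_r with (sqrt T); [exact ST|].
        rewrite Rmult_assoc, Rinv_l by lra.
        apply Rmult_lt_compat_l with (r := eps) in Q; [|exact He].
        replace (eps * (K / eps)) with K in Q by (field; lra); lra. }
      split; (eapply Rle_lt_trans; [|exact Small]).
      * apply (re_le_Cmod (v - 2 * PI * Ci * (scale k l r * total))).
      * apply (im_le_Cmod (v - 2 * PI * Ci * (scale k l r * total))).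
  - field; repeat split; first [apply Ci_nz|apply RtoC_neq; generalize PI_RGT_0; lra].
Qed.

Lemma total_eq :
  (scale k l r * total =
   gamma_coef k l r *
   sum_n_m (fun h : nat => c_coef h k l r
     * RtoC (hypergeom (a_params h k l r) (b_params h k) z)
     * RtoC (Rpower z ((r + INR h) / INR k - 1 / INR l))) 1 k)%C.
Proof.
  rewrite sum_n_m_csum, <- scale_gamma_coef by assumption; unfold total.
  rewrite <- !csum_scal; apply csum_ext; intros j Hj.
  rewrite <- coef_c_coef, hypergeom_series by assumption; unfold coefficient.
  (* For h = j + 1, [pole_off j] is l ((r + h) / k - 1/l), so the exponential at the first pole of a
     class is the stated power of z. *)
  replace (Rpower z ((r + INR (S j)) / INR k - 1 / INR l)) with (exp (- (mu * pole_off k l r j))).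
  2:{ unfold Rpower, z; rewrite ln_exp; f_equal; unfold pole_off; field; lra. }
  rewrite <- RtoC_opp, Cexp_RtoC, !RtoC_mult; ring.
Qed.

End Main.

Theorem theorem4p4 :
  forall (k l : nat) (r x : R),
    (1 <= l)%nat -> (l < k)%nat ->
    let p := (INR k / INR l)%R in
    (0 < x)%R -> (x < c_const p)%R ->
    let z := (x ^ l / c_const p ^ l)%R in
    is_V p r x
      (RtoC (gamma_coef k l r) *
       sum_n_m
         (fun h : nat =>
            c_coef h k l r *
            RtoC (hypergeom (a_params h k l r) (b_params h k) z) *
            RtoC (Rpower z ((r + INR h) / INR k - 1 / INR l)))%C
         1 k)%C.
Proof.
  intros k l r x Hl Hk p Hx Hxc z d Hd; unfold z, p.
  rewrite z_eq, <- total_eq by assumption.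
  apply inverse_Mellin_total; assumption.
Qed.
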